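(* Let $\mathcal T$ be a conforming triangular grid of a two-dimensional polygonal domain $\Omega$. Let $r_1\ge1$, $r_2$ and $k$ be integers with $r_2\ge 2r_1$ and $k\ge 2r_2+1$, and put $\mathbf r=(r_1,r_2)$, $\mathbf r'=(r_1-1,r_2-1)$, $\mathbf r''=(r_1-2,r_2-2)$. Then the sequence $$\mathbb R\xrightarrow{\ \hookrightarrow\ }V_k^{(\mathbf r)}(\mathcal T)\xrightarrow{\ \operatorname{curl}\ }\big[V_{k-1}^{(\mathbf r')}(\mathcal T)\big]^2\xrightarrow{\ \operatorname{div}\ }V_{k-2}^{(\mathbf r'')}(\mathcal T)\longrightarrow0$$ is a complex and exact, provided that the domain $\Omega$ is simply connected.
   Context: For a scalar function $\phi$ on a planar domain, $\operatorname{curl}\phi=(\partial_{x_2}\phi,-\partial_{x_1}\phi)$; for a vector field $\mathbf v=(v_1,v_2)$, $\operatorname{div}\mathbf v=\partial_{x_1}v_1+\partial_{x_2}v_2$. ''Complex'' means that the operators map each space into the next and consecutive compositions vanish; ''exact'' means that the image of each map equals the kernel of the next one. The finite element space $V_m^{(\boldsymbol\rho)}(\mathcal T)$, for $\boldsymbol\rho=(\rho_1,\rho_2)$ with integers $\rho_1\ge-1$, $\rho_2\ge0$, $\rho_2\ge2\rho_1$ and $m\ge2\rho_2+1$, is the set of $u\in L^2(\Omega)$ such that $u|_K$ is a polynomial of degree $\le m$ for every triangle $K\in\mathcal T$, and the following degrees of freedom are single-valued: (i) for every vertex $\mathbf x$ of $\mathcal T$, all partial derivatives of $u$ at $\mathbf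 x$ of order $\le\rho_2$ (i.e. they take the same value when computed from any triangle containing $\mathbf x$); (ii) for every edge $e$ of $\mathcal T$, with a fixed unit normal $\mathbf n$ and barycentric coordinates $\lambda_{e,1},\lambda_{e,2}$ on $e$, and every integer $0\le n\le\rho_1$, the moments $\frac1{|e|}\int_e\frac{\partial^nu}{\partial\mathbf n^n}v$ for all $v\in\operatorname{span}\{\lambda_{e,1}^{\sigma_1}\lambda_{e,2}^{\sigma_2}:\sigma_1,\sigma_2\in\mathbb N_0,\ \sigma_1+\sigma_2=m-n,\ \sigma_1,\sigma_2>\rho_2-n\}$ (i.e. they take the same value when computed from any triangle containing $e$). When $\rho_1=-1$ there are no edge conditions (ii), so functions may be discontinuous across edges. *)

(* Defs.v *)
From HB Require Import structures.
From mathcomp Require Import all_boot all_order all_algebra.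
From mathcomp Require Import all_classical all_reals all_analysis.

Set Implicit Arguments.
Unset Strict Implicit.
Unset Printing Implicit Defensive.

Import Order.TTheory GRing.Theory Num.Theory.
Import numFieldNormedType.Exports.

Local Open Scope classical_set_scope.
Local Open Scope ring_scope.

Definition plane_measure (R : realType) :
    {measure set (measurableTypeR R * measurableTypeR R)%type -> \bar R} :=
  (@lebesgue_measure R \x @lebesgue_measure R)%E.

Definition open_cone (R : realType) (x : R * R) (theta beta : R) :
    set (R * R) :=
  [set y | exists s t : R, [/\ 0 < s, 0 < t, t < beta &
    y = x + s *: (cos (theta + t), sin (theta + t))]].

(* The opening angle [beta] of the domain at a boundary point lies in
   ]0, 2 pi[ (it is [pi] away from the corners), so cracks and boundary points
   where two parts of the domain touch are excluded: these are the Lipschitz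
   domains with polygonal boundary, holes being allowed. *)
Definition polygonal_domain (R : realType) (Omega : set (R * R)) : Prop :=
  [/\ Omega !=set0, open Omega, connected Omega, bounded_set Omega &
    forall x, (closure Omega `\` Omega) x ->
      exists theta beta : R, [/\ 0 < beta, beta < pi *+ 2 &
        \forall y \near x, Omega y <-> open_cone x theta beta y]].

Definition simply_connected (R : realType) (A : set (R * R)) : Prop :=
  connected A /\
  forall gamma : R -> R * R,
    {within [set` `[0, 1]], continuous gamma} ->
    (forall t, t \in `[0, 1] -> A (gamma t)) ->
    gamma 0 = gamma 1 ->
    exists H : R * R -> R * R,
      [/\ {within [set` `[0, 1]] `*` [set` `[0, 1]], continuous H},
          forall t s, t \in `[0, 1] -> s \in `[0, 1] -> A (H (t, s)),
          forall t, t \in `[0, 1] -> H (t, 0) = gamma t /\ H (t, 1) = gamma 0 &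
          forall s, s \in `[0, 1] -> H (0, s) = gamma 0 /\ H (1, s) = gamma 0].

Definition segment (R : realType) (x y : R * R) : set (R * R) :=
  [set x + t *: (y - x) | t in [set` `[0, 1]]].

Definition triangle (R : realType) (K : 'I_3 -> R * R) : set (R * R) :=
  [set x | exists lambda : 'I_3 -> R, [/\ forall a, 0 <= lambda a,
    \sum_a lambda a = 1 & x = \sum_a lambda a *: K a]].

Definition nondegenerate (R : realType) (K : 'I_3 -> R * R) : Prop :=
  let u := K (inord 1) - K (inord 0) in
  let v := K (inord 2) - K (inord 0) in
  u.1 * v.2 - u.2 * v.1 != 0.

Definition is_vertex (R : realType) (K : 'I_3 -> R * R) (x : R * R) : Prop :=
  exists a, K a = x.

Definition is_edge (R : realType) (K : 'I_3 -> R * R) (x y : R * R) : Prop :=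
  exists a b, [/\ a != b, K a = x & K b = y].

Definition conforming_grid (R : realType) (Omega : set (R * R)) (N : nat)
    (T : 'I_N -> 'I_3 -> R * R) : Prop :=
  [/\ forall i, nondegenerate (T i),
      closure Omega = \bigcup_(i in [set: 'I_N]) triangle (T i) &
      forall i j, i != j ->
        [\/ triangle (T i) `&` triangle (T j) = set0,
            exists x, [/\ is_vertex (T i) x, is_vertex (T j) x &
              triangle (T i) `&` triangle (T j) = [set x]] |
            exists x y, [/\ is_edge (T i) x y, is_edge (T j) x y &
              triangle (T i) `&` triangle (T j) = segment x y]]].

Definition d1 (R : realType) (u : R * R -> R) : R * R -> R :=
  fun x => 'D_((1, 0) : R * R) u x.

Definition d2 (R : realType) (u : R * R -> R) : R * R -> R :=
  fun x => 'D_((0, 1) : R * R) u x.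

Definition curl (R : realType) (phi : R * R -> R) : R * R -> R * R :=
  fun x => (d2 phi x, - d1 phi x).

Definition div (R : realType) (v : R * R -> R * R) : R * R -> R :=
  fun x => d1 (fst \o v) x + d2 (snd \o v) x.

Definition eq_L2 (R : realType) (Omega : set (R * R)) (V : Type)
    (f g : R * R -> V) : Prop :=
  ae_eq (plane_measure R) Omega f g.

Definition in_L2 (R : realType) (Omega : set (R * R)) (u : R * R -> R) : Prop :=
  exists2 f : R * R -> R,
    f \in Lfun (plane_measure R) 2%:E &
    eq_L2 Omega u f.

(* Total degree at most [m]; only the zero function when [m < 0]. *)
Definition polynomial_of_degree_le (R : realType) (m : int)
    (p : R * R -> R) : Prop :=
  exists c : nat -> nat -> R, forall x,
    p x = \sum_(a < `|m|.+1) \sum_(b < `|m|.+1 | (a + b)%:Z <= m)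
            c a b * x.1 ^+ a * x.2 ^+ b.

Definition edge_length (R : realType) (x y : R * R) : R :=
  Num.sqrt ((y.1 - x.1) ^+ 2 + (y.2 - x.2) ^+ 2).

Definition unit_normal (R : realType) (x y : R * R) : R * R :=
  (edge_length x y)^-1 *: (y.2 - x.2, - (y.1 - x.1)).

Definition edge_integral (R : realType) (x y : R * R) (g : R -> R) : R :=
  edge_length x y * \int[@lebesgue_measure R]_(t in `[0, 1]) g t.

Definition normal_derivative (R : realType) (x y : R * R) (n : nat)
    (p : R * R -> R) : R * R -> R :=
  iter n (fun q z => 'D_(unit_normal x y) q z) p.

(* Functions on the edge are written in the parameter [t], at the point
   [x + t *: (y - x)], whose barycentric coordinates are [1 - t] and [t]. *)
Definition edge_test_space (R : realType) (rho2 m : int) (n : nat) :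
    set (R -> R) :=
  [set v | exists c : nat -> nat -> R, forall t,
    v t = \sum_(s1 < `|m|.+1)
            \sum_(s2 < `|m|.+1 | [&& (s1 + s2)%:Z == m - n%:Z,
                                     rho2 - n%:Z < s1%:Z & rho2 - n%:Z < s2%:Z])
              c s1 s2 * ((1 - t) ^+ s1 * t ^+ s2)].

Definition edge_moment (R : realType) (x y : R * R) (n : nat)
    (p : R * R -> R) (v : R -> R) : R :=
  (edge_length x y)^-1 *
  edge_integral x y (fun t => normal_derivative x y n p (x + t *: (y - x)) * v t).

(* An element of L^2(Omega) is handled through its representatives that are
   polynomial at every interior point of each triangle; the values on the
   edges, a null set, are arbitrary.  The polynomial [p i] is the extension of
   [u] to the closed triangle, from which the degrees of freedom are computed.
   With such representatives, [curl] and [div] are the classical operators at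
   every point off the edges, and equality of classes is [eq_L2]. *)
Definition fe_space (R : realType) (Omega : set (R * R)) (N : nat)
    (T : 'I_N -> 'I_3 -> R * R) (rho1 rho2 m : int) : set (R * R -> R) :=
  [set u | in_L2 Omega u /\ exists p : 'I_N -> R * R -> R,
    [/\ forall i, polynomial_of_degree_le m (p i),
        forall i x, (triangle (T i))° x -> u x = p i x,
        forall i j x, is_vertex (T i) x -> is_vertex (T j) x ->
          forall a b : nat, (a + b)%:Z <= rho2 ->
            iter a (@d1 R) (iter b (@d2 R) (p i)) x =
            iter a (@d1 R) (iter b (@d2 R) (p j)) x &
        forall i j x y, is_edge (T i) x y -> is_edge (T j) x y ->
          forall n : nat, n%:Z <= rho1 ->
          forall v, edge_test_space rho2 m n v ->
            edge_moment x y n (p i) v = edge_moment x y n (p j) v]].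

Definition fe_space2 (R : realType) (Omega : set (R * R)) (N : nat)
    (T : 'I_N -> 'I_3 -> R * R) (rho1 rho2 m : int) : set (R * R -> R * R) :=
  [set v | fe_space Omega T rho1 rho2 m (fst \o v) /\
           fe_space Omega T rho1 rho2 m (snd \o v)].

Definition curl_div_complex (R : realType) (Omega : set (R * R))
    (V : set (R * R -> R)) (W : set (R * R -> R * R)) (Q : set (R * R -> R)) :
    Prop :=
  [/\ forall c : R, V (cst c),
      forall phi, V phi -> W (curl phi),
      forall v, W v -> Q (div v),
      forall c : R, eq_L2 Omega (curl (cst c)) (cst 0) &
      forall phi, V phi -> eq_L2 Omega (div (curl phi)) (cst 0)].

Definition curl_div_exact (R : realType) (Omega : set (R * R))
    (V : set (R * R -> R)) (W : set (R * R -> R * R)) (Q : set (R * R -> R)) :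
    Prop :=
  [/\ forall c d : R, eq_L2 Omega (cst c) (cst d) -> c = d,
      forall phi, V phi ->
        (eq_L2 Omega (curl phi) (cst 0) <-> exists c : R, eq_L2 Omega phi (cst c)),
      forall v, W v ->
        (eq_L2 Omega (div v) (cst 0) <-> exists2 phi, V phi & eq_L2 Omega v (curl phi)) &
      forall q, Q q -> exists2 v, W v & eq_L2 Omega q (div v)].

(* Main.v *)
Require Import Defs.
From HB Require Import structures.
From mathcomp Require Import all_boot all_order all_algebra.
From mathcomp Require Import all_classical all_reals all_analysis.
From mathcomp Require Import polyXY measurable_realfun zify lra.

(* An element of a finite element space is given by polynomials P_i on the
   triangles whose jumps P_i - P_j vanish to order rho_2 at common vertices and to
   order rho_1 along common edges: once the jump of a normal derivative is known
   to vanish to high order at both ends of the edge, it is itself an admissible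
   test function for its own moments.

   Kernel of div: on each triangle a divergence-free polynomial field is curl F_i.
   The F_i - F_j are constant on common edges, so the increments of the F_i along
   short paths are well defined, and they depend only on the homotopy class of the
   path.  As Omega is simply connected, they are the increments of one function on
   Omega, which extends to closure Omega because Omega is locally a sector at its
   boundary; correcting each F_i by a constant makes them match.

   Surjectivity of div: solve div u_i = q_i on each triangle.  Near a vertex or an
   edge the jumps of u are, to the required order, curls of polynomials, and one
   seeks g_i such that u_i - curl g_i matches.  Since 2 r_1 <= r_2 and 2 r_2 < k,
   polynomials of degree k interpolate compatible vertex and edge data on a
   triangle.  The data are compatible up to constants, which gives one linear
   equation per triangle in unknowns attached to the edges.  Every nonempty
   set of triangles has an edge lying on only one of them, so this system is
   triangular. *)

Set Implicit Arguments.
Unset Strict Implicit.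
Unset Printing Implicit Defensive.

Import Order.TTheory GRing.Theory Num.Theory.
Import numFieldNormedType.Exports.

Local Open Scope ring_scope.

(** * Bivariate polynomials *)

(* The inner variable is the first coordinate of the plane, the outer one the second. *)
Notation bipoly R := {poly {poly R}}.

Section Bipoly.
Context {R : realFieldType}.
Implicit Types (P Q : bipoly R) (x y z w : R * R) (p q : {poly R}).

(** One gain of order drives surjectivity: where the divergence of a field vanishes to order s at a
    point of a given line, the field agrees with a curl to order s + 1. Hence the jumps of arbitrary
    local solutions are curls to precisely the order demanded of the corrected field. A potential is
    fixed by its curl up to a constant, and constants are all that obstructs gluing: data on the
    three edges of a triangle can be shifted into agreement at its vertices exactly when their
    increments along the edges add up to zero. The parameter of an edge multiplies a polynomial that
    is constant to high order at each vertex, with different constants at the two ends, so it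
    changes that increment without disturbing the curl at the vertices. For the kernel, simple
    connectedness speaks of continuous homotopies, while the data live on closed triangles. The link
    is a ball around each point that meets only the triangles containing that point; a homotopy is
    cut into cells below a Lebesgue number for these balls. Vanishing to order s means that
    derivatives of order less than s vanish, so rho reads s - 1 and rho_1 = -1 is the empty
    condition. *)

Definition bconst (c : R) : bipoly R := c%:P%:P.
Definition bX : bipoly R := 'X%:P.
Definition bY : bipoly R := 'X.

(** The ring is generated by the constants and the two variables, so two nested inductions on
    univariate polynomials suffice. Facts about derivatives and restrictions to lines are reduced to
    these four cases. *)
Lemma bipoly_ind (S : bipoly R -> Prop) :
  (forall c, S (bconst c)) -> (forall P, S P -> S (bX * P)) ->
  (forall P, S P -> S (bY * P)) -> (forall P Q, S P -> S Q -> S (P + Q)) ->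
  forall P, S P.
Proof.
move=> Sc SX SY SD; elim/poly_ind=> [|P p SP]; first exact: (Sc 0).
rewrite mulrC; apply: (SD _ _); first exact: SY.
elim/poly_ind: p => [|p c Sp]; first exact: (Sc 0).
by rewrite polyCD polyCM mulrC; apply: (SD _ _); [exact: SX|exact: Sc].
Qed.

Definition ev P x : R := P.[x.2%:P].[x.1].

Lemma evD P Q x : ev (P + Q) x = ev P x + ev Q x.
Proof. by rewrite /ev !hornerD. Qed.
Lemma evN P x : ev (- P) x = - ev P x.
Proof. by rewrite /ev !hornerN. Qed.
Lemma evB P Q x : ev (P - Q) x = ev P x - ev Q x.
Proof. by rewrite evD evN. Qed.
Lemma evM P Q x : ev (P * Q) x = ev P x * ev Q x.
Proof. by rewrite /ev !hornerM. Qed.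
Lemma evC c x : ev (bconst c) x = c.
Proof. by rewrite /ev !hornerC. Qed.
Lemma ev0 x : ev 0 x = 0.
Proof. by rewrite /ev !horner0. Qed.
Lemma ev1 x : ev 1 x = 1.
Proof. exact: (evC 1). Qed.
Lemma evbX x : ev bX x = x.1.
Proof. by rewrite /ev hornerC hornerX. Qed.
Lemma evbY x : ev bY x = x.2.
Proof. by rewrite /ev hornerX hornerC. Qed.
Lemma evXn P n x : ev (P ^+ n) x = ev P x ^+ n.
Proof. by elim: n => [|n IH]; rewrite ?expr0 ?ev1// !exprS evM IH. Qed.
Lemma ev_sum (I : Type) (r : seq I) (F : I -> bipoly R) x :
  ev (\sum_(i <- r) F i) x = \sum_(i <- r) ev (F i) x.
Proof. by elim/big_rec2: _ => [|i u v _ <-]; rewrite ?ev0 ?evD. Qed.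

Definition evE := (evD, evN, evM, evC, ev0, ev1, evbX, evbY, evXn).

Lemma poly_eq0_inf p : (forall t, p.[t] = 0) -> p = 0.
Proof.
move=> p0; apply/eqP/negPn/negP=> pN0.
have := @max_poly_roots R p [seq i%:R | i <- iota 0 (size p)] pN0.
rewrite map_inj_uniq ?iota_uniq ?size_map ?size_iota ?ltnn; last first.
  by move=> i j /eqP; rewrite eqr_nat => /eqP.
by move=> H; suff: false by []; apply: H => //; apply/allP=> t _; apply/rootP.
Qed.

Lemma ev_eq0 P : (forall x, ev P x = 0) -> P = 0.
Proof.
move=> P0; apply/eqP/negPn/negP=> PN0.
have := @max_poly_roots _ P [seq i%:R%:P | i <- iota 0 (size P)] PN0.
rewrite map_inj_uniq ?iota_uniq ?size_map ?size_iota ?ltnn; last first.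
  by move=> i j /polyC_inj /eqP; rewrite eqr_nat => /eqP.
move=> H; suff: false by []; apply: H => //; apply/allP=> t /mapP[i _ ->].
apply/rootP/poly_eq0_inf => s; exact: (P0 (s, _)).
Qed.

(** Over an infinite field a polynomial is determined by its values. [bipoly_ring] uses this to turn
    ring identities into arithmetic at a point. *)
Lemma ev_inj P Q : (forall x, ev P x = ev Q x) -> P = Q.
Proof.
by move=> PQ; apply/subr0_eq/ev_eq0 => x; rewrite evB PQ subrr.
Qed.

Lemma horner_inj p q : (forall t, p.[t] = q.[t]) -> p = q.
Proof.
by move=> pq; apply/subr0_eq/poly_eq0_inf => t; rewrite hornerD hornerN pq subrr.
Qed.

End Bipoly.

Ltac bipoly_ring := apply: ev_inj => ?; rewrite ?evE /=; lra.
Ltac poly_ring := apply: horner_inj => ?; rewrite ?hornerE /=; lra.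

Arguments bipoly_ind [R] S _ _ _ _ P.

(** * Derivatives, total degree and order of vanishing *)

Section Derivatives.
Context {R : realFieldType}.
Implicit Types (P Q : bipoly R) (x w : R * R) (c d : R).

(** The first coordinate is the inner variable, so it is exchanged with the outer one before [deriv]
    applies. *)
Definition bD1 P : bipoly R := swapXY (deriv (swapXY P)).
Definition bD2 P : bipoly R := deriv P.
Fact bD_key : unit. Proof. by []. Qed.
Definition bD := locked_with bD_key
  (fun w P => bconst w.1 * bD1 P + bconst w.2 * bD2 P).
Lemma bDE w P : bD w P = bconst w.1 * bD1 P + bconst w.2 * bD2 P.
Proof. by rewrite /bD unlock. Qed.

Lemma bD1D P Q : bD1 (P + Q) = bD1 P + bD1 Q.
Proof. by rewrite /bD1 raddfD /= derivD raddfD. Qed.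
Lemma bD2D P Q : bD2 (P + Q) = bD2 P + bD2 Q.
Proof. exact: derivD. Qed.
Lemma bD1M P Q : bD1 (P * Q) = bD1 P * Q + P * bD1 Q.
Proof. by rewrite /bD1 rmorphM /= derivM rmorphD /= !rmorphM /= !swapXYK. Qed.
Lemma bD2M P Q : bD2 (P * Q) = bD2 P * Q + P * bD2 Q.
Proof. exact: derivM. Qed.
Lemma bD1C c : bD1 (bconst c) = 0.
Proof. by rewrite /bD1 swapXY_polyC map_polyC /= derivC raddf0. Qed.
Lemma bD2C c : bD2 (bconst c) = 0.
Proof. exact: derivC. Qed.
Lemma bD1X : bD1 bX = 1.
Proof. by rewrite /bD1 swapXY_Y derivX rmorph1. Qed.
Lemma bD1Y : bD1 bY = 0.
Proof. by rewrite /bD1 swapXY_X derivC raddf0. Qed.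
Lemma bD2X : bD2 bX = 0.
Proof. exact: derivC. Qed.
Lemma bD2Y : bD2 bY = 1.
Proof. exact: derivX. Qed.

Lemma bDD w P Q : bD w (P + Q) = bD w P + bD w Q.
Proof. by rewrite !bDE bD1D bD2D; bipoly_ring. Qed.
Lemma bDM w P Q : bD w (P * Q) = bD w P * Q + P * bD w Q.
Proof. by rewrite !bDE bD1M bD2M; bipoly_ring. Qed.
Lemma bDC w c : bD w (bconst c) = 0.
Proof. by rewrite !bDE bD1C bD2C; bipoly_ring. Qed.
Lemma bDX w : bD w bX = bconst w.1.
Proof. by rewrite !bDE bD1X bD2X; bipoly_ring. Qed.
Lemma bDY w : bD w bY = bconst w.2.
Proof. by rewrite !bDE bD1Y bD2Y; bipoly_ring. Qed.
Lemma bDCM w c P : bD w (bconst c * P) = bconst c * bD w P.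
Proof. by rewrite bDM bDC mul0r add0r. Qed.
Lemma bconstN c : bconst (- c) = - bconst c.
Proof. by rewrite /bconst !polyCN. Qed.
Lemma bconst1 : bconst (1 : R) = 1. Proof. by []. Qed.
Lemma bconst0 : bconst (0 : R) = 0. Proof. by []. Qed.
Lemma bconstD c d : bconst (c + d) = bconst c + bconst d.
Proof. by rewrite /bconst !polyCD. Qed.
Lemma bconstM c d : bconst (c * d) = bconst c * bconst d.
Proof. by rewrite /bconst !polyCM. Qed.
Lemma bDN w P : bD w (- P) = - bD w P.
Proof. by rewrite -mulN1r -bconst1 -bconstN bDCM bconstN bconst1 mulN1r. Qed.
Lemma bDB w P Q : bD w (P - Q) = bD w P - bD w Q.
Proof. by rewrite bDD bDN. Qed.
Lemma bD0 w : bD w 0 = 0. Proof. exact: (bDC w 0). Qed.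
Lemma bD_1 w : bD w 1 = 0. Proof. exact: (bDC w 1). Qed.
Lemma bD1E P : bD1 P = bD (1, 0) P.
Proof. by rewrite !bDE /= bconst1 bconst0; bipoly_ring. Qed.
Lemma bD2E P : bD2 P = bD (0, 1) P.
Proof. by rewrite !bDE /= bconst1 bconst0; bipoly_ring. Qed.

Lemma bDcomm v w P : bD v (bD w P) = bD w (bD v P).
Proof.
elim/bipoly_ind: P => [c|P|P|P Q].
- by rewrite !bDC ?bD0.
- by move=> IH; rewrite !bDM !bDX !bDD !bDM !bDX !bDC IH; bipoly_ring.
- by move=> IH; rewrite !bDM !bDY !bDD !bDM !bDY !bDC IH; bipoly_ring.
- by move=> IP IQ; rewrite !bDD IP IQ.
Qed.

Lemma bD_lin w (a b : R) (v v' : R * R) P : w = (a * v.1 + b * v'.1, a * v.2 + b * v'.2) ->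
  bD w P = bconst a * bD v P + bconst b * bD v' P.
Proof. by move=> ->; rewrite !bDE /= !bconstD !bconstM; bipoly_ring. Qed.

(* Total degree at most [m]. *)
Fixpoint deg (m : nat) P : Prop :=
  if m is m'.+1 then
    exists P1 P2 c, [/\ deg m' P1, deg m' P2 & P = bX * P1 + bY * P2 + bconst c]
  else exists c, P = bconst c.

Lemma deg0 m : deg m 0.
Proof.
elim: m => [|m IH] /=; first by exists 0.
by exists 0, 0, 0; split=> //; rewrite !mulr0 bconst0 !addr0.
Qed.

Lemma degC m c : deg m (bconst c).
Proof.
case: m => [|m] /=; first by exists c.
by exists 0, 0, c; split; rewrite ?mulr0 ?add0r //; apply: deg0.
Qed.

Lemma degS m P : deg m P -> deg m.+1 P.
Proof.
elim: m P => [|m IH] P; first by case=> c ->; apply: degC.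
by case=> P1 [P2] [c] [/IH d1 /IH d2 ->]; exists P1, P2, c.
Qed.

Lemma deg_leq m n P : (m <= n)%N -> deg m P -> deg n P.
Proof.
move=> /subnK <-; elim: (n - m)%N => [//|k IH] dP; rewrite addSn.
exact/degS/IH.
Qed.

Lemma degD m P Q : deg m P -> deg m Q -> deg m (P + Q).
Proof.
elim: m P Q => [|m IH] P Q.
  by case=> c -> [d ->]; exists (c + d); rewrite bconstD.
case=> P1 [P2] [c] [d1 d2 ->] [Q1 [Q2 [d [e1 e2 ->]]]].
exists (P1 + Q1), (P2 + Q2), (c + d); split; try exact: IH.
by rewrite bconstD; bipoly_ring.
Qed.

Lemma degCM m c P : deg m P -> deg m (bconst c * P).
Proof.
elim: m P => [|m IH] P; first by case=> d ->; exists (c * d); rewrite bconstM.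
case=> P1 [P2] [d] [/IH d1 /IH d2 ->].
exists (bconst c * P1), (bconst c * P2), (c * d); split => //.
by rewrite bconstM; bipoly_ring.
Qed.

Lemma degN m P : deg m P -> deg m (- P).
Proof. by move=> /(degCM (-1)); rewrite bconstN bconst1 mulN1r. Qed.

Lemma degB m P Q : deg m P -> deg m Q -> deg m (P - Q).
Proof. by move=> dP dQ; apply/degD/degN. Qed.

Lemma deg_sum m (I : Type) (r : seq I) (F : I -> bipoly R) :
  (forall i, deg m (F i)) -> deg m (\sum_(i <- r) F i).
Proof. by move=> dF; elim/big_rec: _ => [|i u _]; [exact: deg0|apply: degD]. Qed.

Lemma degXM m P : deg m P -> deg m.+1 (bX * P).
Proof.
move=> dP; exists P, 0, 0; split => //; first exact: deg0.
by rewrite mulr0 bconst0 !addr0.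
Qed.
Lemma degYM m P : deg m P -> deg m.+1 (bY * P).
Proof.
move=> dP; exists 0, P, 0; split => //; first exact: deg0.
by rewrite mulr0 bconst0 add0r addr0.
Qed.

Lemma degM m n P Q : deg m P -> deg n Q -> deg (m + n) (P * Q).
Proof.
elim: m P => [|m IH] P; first by case=> c -> dQ; apply: degCM.
case=> P1 [P2] [c] [d1 d2 ->] dQ; rewrite !mulrDl -!mulrA addSn.
apply: degD; last by apply: degCM; apply: deg_leq dQ; lia.
by apply: degD; [apply: degXM; exact: IH|apply: degYM; exact: IH].
Qed.

Lemma degbX : deg 1 bX.
Proof. by rewrite -[bX]mulr1; apply/degXM/degC. Qed.
Lemma degbY : deg 1 bY.
Proof. by rewrite -[bY]mulr1; apply/degYM/degC. Qed.

Lemma degXn m n P : deg m P -> deg (n * m) (P ^+ n).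
Proof.
move=> dP; elim: n => [|n IH]; first exact: (degC _ 1).
by rewrite exprS mulSn; apply: degM.
Qed.

Lemma deg_bD m w P : deg m P -> deg m.-1 (bD w P).
Proof.
elim: m P => [|m IH] P; first by case=> c ->; rewrite bDC; exact: deg0.
case=> P1 [P2] [c] [d1 d2 ->] /=.
rewrite !bDD !bDM bDX bDY bDC addr0.
have H (v Q : bipoly R) : (v = bX \/ v = bY) -> deg m Q -> deg m (v * bD w Q).
  case: m IH {d1 d2} => [IH _ [d ->]|m IH]; first by rewrite bDC mulr0; apply: deg0.
  by case=> -> /IH ?; [apply: degXM|apply: degYM].
by do 2?apply: degD; try apply: degCM => //; apply: H; auto.
Qed.

(* All derivatives of order less than [s] vanish at [x]. *)
Fixpoint vanish (s : nat) P x : Prop :=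
  if s is s'.+1 then ev P x = 0 /\ forall w, vanish s' (bD w P) x else True.

Lemma vanish0 s x : vanish s 0 x.
Proof. by elim: s x => //= s IH x; rewrite ev0; split=> // w; rewrite bD0; exact: IH. Qed.

Lemma vanishD s P Q x : vanish s P x -> vanish s Q x -> vanish s (P + Q) x.
Proof.
elim: s P Q => //= s IH P Q [p0 vP] [q0 vQ].
by rewrite evD p0 q0 addr0; split=> // w; rewrite bDD; apply: IH.
Qed.

Lemma vanishW s P x : vanish s.+1 P x -> vanish s P x.
Proof. by elim: s P => //= s IH P [-> vP]; split=> // w; apply: IH; exact: vP. Qed.

Lemma vanish_leq s t P x : (s <= t)%N -> vanish t P x -> vanish s P x.
Proof. by move=> /subnK <-; elim: (t - s)%N => //= k IH /vanishW. Qed.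

(** By the Leibniz rule one differentiation lowers the order of a single factor, so induction on
    [s + t] closes. *)
Lemma vanishM s t P Q x : vanish s P x -> vanish t Q x -> vanish (s + t) (P * Q) x.
Proof.
move: {-1}(s + t)%N (erefl (s + t)%N) => n; elim: n s t P Q => // n IH s t P Q st vP vQ.
split; rewrite ?evM.
  case: s st vP => [|s] st; last by case=> -> _; rewrite mul0r.
  by case: t st vQ => // t _ [-> _]; rewrite mulr0.
move=> w; rewrite bDM; apply: vanishD.
  case: s st vP => [|s] st vP.
    by apply: (IH 0 n) => //; apply: vanishW; rewrite -[n.+1]st.
  by apply: (IH s t) => //; [lia|apply: vP.2].
case: t st vQ => [|t] st vQ.
  by apply: (IH n 0) => //; [lia|apply: vanishW; rewrite -[n.+1]st addn0].
by apply: (IH s t) => //; [lia|apply: vQ.2].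
Qed.

Lemma vanishMl s P Q x : vanish s P x -> vanish s (Q * P) x.
Proof. exact: (@vanishM 0). Qed.
Lemma vanishMr s P Q x : vanish s P x -> vanish s (P * Q) x.
Proof. by rewrite mulrC; apply: vanishMl. Qed.

Lemma vanishN s P x : vanish s P x -> vanish s (- P) x.
Proof. by rewrite -mulN1r; apply: vanishMl. Qed.
Lemma vanishB s P Q x : vanish s P x -> vanish s Q x -> vanish s (P - Q) x.
Proof. by move=> vP vQ; apply/vanishD/vanishN. Qed.
Lemma vanish_sum s (I : Type) (r : seq I) (C : pred I) (F : I -> bipoly R) x :
  (forall i, C i -> vanish s (F i) x) -> vanish s (\sum_(i <- r | C i) F i) x.
Proof. by move=> vF; elim/big_rec: _ => [|i u Ci]; [exact: vanish0|apply: vanishD; apply: vF]. Qed.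
Lemma vanish_sym s P Q x : vanish s (P - Q) x -> vanish s (Q - P) x.
Proof. by move=> /vanishN; rewrite opprB. Qed.
Lemma vanish_trans s P Q S x : vanish s (P - Q) x -> vanish s (Q - S) x -> vanish s (P - S) x.
Proof. by move=> PQ QS; rewrite -[P](subrK Q) -addrA; apply: vanishD. Qed.

Lemma vanishXn n P x : ev P x = 0 -> vanish n (P ^+ n) x.
Proof.
move=> P0; elim: n => // n IH; rewrite exprS; apply: (@vanishM 1) => //=.
Qed.

Lemma vanish_bD s P x w : vanish s P x -> vanish s.-1 (bD w P) x.
Proof. by case: s => //= s [_]. Qed.

Lemma vanishS s P x (v v' : R * R) : v.1 * v'.2 - v.2 * v'.1 != 0 ->
  vanish s.+1 P x <->
    [/\ ev P x = 0, vanish s (bD v P) x & vanish s (bD v' P) x].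
Proof.
move=> vv'; split=> [[? H]|[? H H']]; first by split=> //; apply: H.
split=> // w.
pose d := v.1 * v'.2 - v.2 * v'.1.
(* Cramer's rule for [w] in the basis [v], [v']. *)
rewrite (@bD_lin w ((w.1 * v'.2 - w.2 * v'.1) / d) ((w.2 * v.1 - w.1 * v.2) / d) v v').
  by apply: vanishD; apply: vanishMl.
have := mulfV (vv' : d != 0); move: (d^-1) => e de.
case: w => a b /=; congr pair.
  by have := congr1 (fun u => a * u) de; rewrite /d; lra.
by have := congr1 (fun u => b * u) de; rewrite /d; lra.
Qed.

End Derivatives.

Arguments vanish {R} s P x : simpl never.

(** * Restriction to lines *)

Section Restriction.
Context {R : realFieldType}.
Implicit Types (P Q : bipoly R) (x y z w : R * R) (p q : {poly R}).

Definition pt x w (t : R) : R * R := (x.1 + t * w.1, x.2 + t * w.2).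

(** The parametrization [x + t w] of a line is substituted into both variables, giving a polynomial
    in t. *)
Definition rs x w P : {poly R} :=
  (map_poly (comp_poly (x.1%:P + w.1 *: 'X)) P).[x.2%:P + w.2 *: 'X].

Lemma rsD x w P Q : rs x w (P + Q) = rs x w P + rs x w Q.
Proof. by rewrite /rs rmorphD hornerD. Qed.
Lemma rsM x w P Q : rs x w (P * Q) = rs x w P * rs x w Q.
Proof. by rewrite /rs rmorphM hornerM. Qed.
Lemma rsC x w c : rs x w (bconst c) = c%:P.
Proof. by rewrite /rs map_polyC /= hornerC comp_polyC. Qed.
Lemma rsX x w : rs x w bX = x.1%:P + w.1 *: 'X.
Proof. by rewrite /rs map_polyC /= hornerC comp_polyX. Qed.
Lemma rsY x w : rs x w bY = x.2%:P + w.2 *: 'X.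
Proof. by rewrite /rs map_polyX /= hornerX. Qed.
Lemma rsN x w P : rs x w (- P) = - rs x w P.
Proof. by rewrite /rs rmorphN hornerN. Qed.
Lemma rsB x w P Q : rs x w (P - Q) = rs x w P - rs x w Q.
Proof. by rewrite rsD rsN. Qed.
Lemma rsXn x w P n : rs x w (P ^+ n) = rs x w P ^+ n.
Proof.
elim: n => [|n IH]; last by rewrite !exprS rsM IH.
by rewrite !expr0 -bconst1 rsC.
Qed.

Lemma horner_rs x w P t : (rs x w P).[t] = ev P (pt x w t).
Proof.
elim/bipoly_ind: P => [c|P IH|P IH|P Q IP IQ].
- by rewrite rsC hornerC evC.
- by rewrite rsM rsX hornerM IH evM evbX hornerD hornerC hornerZ hornerX /= [t * _]mulrC.
- by rewrite rsM rsY hornerM IH evM evbY hornerD hornerC hornerZ hornerX /= [t * _]mulrC.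
- by rewrite rsD hornerD IP IQ evD.
Qed.

Lemma deriv_rs x w P : (rs x w P)^`() = rs x w (bD w P).
Proof.
elim/bipoly_ind: P => [c|P IH|P IH|P Q IP IQ].
- by rewrite rsC derivC bDC -bconst0 rsC.
- rewrite bDM bDX rsD !rsM rsX rsC derivM IH; congr (_ * _ + _).
  by rewrite derivD derivC derivZ derivX add0r -mul_polyC mulr1.
- rewrite bDM bDY rsD !rsM rsY rsC derivM IH; congr (_ * _ + _).
  by rewrite derivD derivC derivZ derivX add0r -mul_polyC mulr1.
- by rewrite rsD derivD IP IQ bDD rsD.
Qed.

Lemma size_rs m x w P : deg m P -> (size (rs x w P) <= m.+1)%N.
Proof.
have lin (a b : R) : (size (a%:P + b *: 'X : {poly R})%R <= 2)%N.
  apply: leq_trans (size_polyD _ _) _; rewrite geq_max.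
  rewrite (leq_trans (size_polyC_leq1 _)) //.
  by rewrite (leq_trans (size_scale_leq _ _)) ?size_polyX.
elim: m P => [|m IH] P; first by case=> c ->; rewrite rsC size_polyC_leq1.
case=> P1 [P2] [c] [/IH d1 /IH d2 ->].
rewrite !rsD !rsM rsX rsY rsC.
apply: leq_trans (size_polyD _ _) _; rewrite geq_max (leq_trans (size_polyC_leq1 _)) // andbT.
apply: leq_trans (size_polyD _ _) _; rewrite geq_max.
by apply/andP; split; apply: leq_trans (size_polyMleq _ _) _;
  have := lin; [move=> /(_ x.1 w.1)|move=> /(_ x.2 w.2)]; lia.
Qed.

Lemma rs_eq0 x P : (forall w, rs x w P = 0) -> P = 0.
Proof.
move=> H; apply: ev_eq0 => y.
have := horner_rs x (y.1 - x.1, y.2 - x.2) P 1.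
rewrite H horner0 => ->; congr (ev P _).
by case: y => a b; rewrite /pt /=; congr pair; lra.
Qed.

(** If [p = q (X - a)^(m+1)] with [q] nonzero at [a], then [p' = (q' (X - a) + (m+1) q) (X - a)^m],
    and in characteristic 0 the cofactor is again nonzero at [a]: differentiation lowers a positive
    multiplicity by exactly one. *)
Lemma dvdp_deriv_XsubC p a s : p.[a] = 0 -> ('X - a%:P) ^+ s %| p^`() ->
  ('X - a%:P) ^+ s.+1 %| p.
Proof.
move=> pa0 dv; have [->|pN0] := eqVneq p 0; first exact: dvdp0.
have [m [q qa pE]] := multiplicity_XsubC p a.
move: qa; rewrite pN0 /= => qa.
case: m pE => [|m] pE.
  by move: pa0; rewrite pE expr0 mulr1 => /rootP; rewrite (negPf qa).
suff: (s <= m)%N by move=> sm; rewrite pE dvdp_mull // dvdp_exp2l.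
rewrite leqNgt; apply/negP => ms.
have p'E : p^`() = (q^`() * ('X - a%:P) + q *+ m.+1) * ('X - a%:P) ^+ m.
  rewrite pE derivM deriv_exp derivXsubC mul1r /= [RHS]mulrDl exprS mulrA.
  by rewrite mulrnAr -mulrnAl.
move: dv; rewrite p'E -(subnK ms) addnS -addSn exprD dvdp_mul2r; last first.
  by rewrite expf_neq0 // polyXsubC_eq0.
rewrite exprS => {}dv; have : 'X - a%:P %| q^`() * ('X - a%:P) + q *+ m.+1.
  by apply: dvdp_trans dv; rewrite dvdp_mulIl.
rewrite dvdp_addr ?dvdp_mulIr // dvdp_XsubCl => /rootP/eqP.
by rewrite hornerMn mulrn_eq0 /= -rootE (negPf qa).
Qed.

Lemma vanish_dvdp s P x w a : vanish s P (pt x w a) -> ('X - a%:P) ^+ s %| rs x w P.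
Proof.
elim: s P => [|s IH] P; first by rewrite expr0 dvd1p.
case=> P0 vP; apply: dvdp_deriv_XsubC; first by rewrite horner_rs.
by rewrite deriv_rs; apply/IH/vP.
Qed.

(* Vanishing normal derivatives suffice because tangential ones vanish along with the function. *)
Lemma vanish_line s P x w v : v.1 * w.2 - v.2 * w.1 != 0 ->
  (forall n, (n < s)%N -> rs x w (iter n (bD v) P) = 0) ->
  forall t, vanish s P (pt x w t).
Proof.
move=> vw; elim: s P => [|s IH] P H t //.
apply/(vanishS _ _ _ vw); split.
- by rewrite -horner_rs (H 0) ?horner0.
- by apply: IH => n ns; rewrite -iterSr; apply: H.
- apply: IH => n ns.
  have -> : iter n (bD v) (bD w P) = bD w (iter n (bD v) P).
    by elim: n {ns} => //= n ->; rewrite bDcomm.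
  by rewrite -deriv_rs H ?deriv0 // ltnS ltnW.
Qed.

Lemma vanish_iter s P x w v n : (n < s)%N ->
  (forall t, vanish s P (pt x w t)) -> rs x w (iter n (bD v) P) = 0.
Proof.
move=> ns H; apply: poly_eq0_inf => t; rewrite horner_rs.
have : vanish (s - n) (iter n (bD v) P) (pt x w t).
  elim: n {ns} => [|n IH]; first by rewrite subn0.
  by rewrite iterS subnS; apply: vanish_bD.
by rewrite -(subnSK ns) => -[].
Qed.

(** Derivatives commute, so each mixed partial can be brought to this order. It is the form of the
    vertex degrees of freedom. *)
Lemma vanish_partials s P x :
  vanish s P x <-> forall a b, (a + b < s)%N -> ev (iter a (@bD1 R) (iter b (@bD2 R) P)) x = 0.
Proof.
elim: s P => [|s IH] P; first by split.
have e12 : (1 : R) * 1 - 0 * 0 != 0 by rewrite mulr1 mulr0 subr0 oner_eq0.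
have comm a b Q : iter a (@bD1 R) (iter b (@bD2 R) (bD1 Q)) = iter a.+1 (@bD1 R) (iter b (@bD2 R) Q).
  rewrite iterSr; congr iter; elim: b => //= b ->.
  by rewrite !bD1E !bD2E bDcomm.
rewrite (@vanishS R s P x (1, 0) (0, 1) e12) -bD1E -bD2E; split.
  move=> [P0 /IH H1 /IH H2] [|a] b ab.
    case: b ab => [//|b] ab; rewrite iterSr; exact: (H2 0 b).
  by rewrite -comm; apply: H1.
move=> H; split; first exact: (H 0 0).
  by apply/IH => a b ab; rewrite comm; apply: H.
by apply/IH => a b ab; rewrite -iterSr; apply: H; rewrite addnS.
Qed.

(** The Bernstein polynomials of degree d span: since [1 = X + (1 - X)], any polynomial of degree at
    most d is [X] times one plus [1 - X] times another, both of degree at most d - 1. *)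
Lemma bernstein_ind d (S : {poly R} -> Prop) :
  S 0 -> (forall p q, S p -> S q -> S (p + q)) -> (forall c p, S p -> S (c *: p)) ->
  (forall i j, (i + j)%N = d -> S ((1 - 'X) ^+ i * 'X ^+ j)) ->
  forall p, (size p <= d.+1)%N -> S p.
Proof.
elim: d S => [|d IH] S S0 SD SZ SM p sp.
  rewrite [p]size1_polyC // -[_%:P]mulr1 mul_polyC; apply: (SZ _ _).
  by have := SM 0%N 0%N erefl; rewrite !expr0 mulr1.
have SX q : (size q <= d.+1)%N -> S ('X * q).
  apply: (IH (fun q => S ('X * q))) => [|p1 q1|c q1|i j ij]; rewrite ?mulr0 ?mulrDr -?scalerAr //.
  - exact: (SD _ _). - exact: (SZ _ _).
  by rewrite mulrCA -exprS; apply: (SM _ _); rewrite addnS ij.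
have S1X q : (size q <= d.+1)%N -> S ((1 - 'X) * q).
  apply: (IH (fun q => S ((1 - 'X) * q))) => [|p1 q1|c q1|i j ij]; rewrite ?mulr0 ?mulrDr -?scalerAr //.
  - exact: (SD _ _). - exact: (SZ _ _).
  by rewrite mulrA -exprS; apply: (SM _ _); rewrite addSn ij.
elim/poly_ind: p sp => [//|p c _] sp.
have sp' : (size p <= d.+1)%N.
  have [->|pN0] := eqVneq p 0; first by rewrite size_poly0.
  by move: sp; rewrite size_MXaddC (negPf pN0) /= ltnS.
have -> : p * 'X + c%:P = 'X * p + ('X * c%:P + (1 - 'X) * c%:P) by poly_ring.
apply: (SD _ _); first exact: SX.
by apply: (SD _ _); [apply: SX|apply: S1X]; rewrite (leq_trans (size_polyC_leq1 _)).
Qed.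

(* The quotient of p by ((1 - 'X) 'X)^s is expanded in the Bernstein basis. *)
Lemma bernstein_vanish_ind s m (S : {poly R} -> Prop) :
  S 0 -> (forall p q, S p -> S q -> S (p + q)) -> (forall c p, S p -> S (c *: p)) ->
  (forall i j, (i + j)%N = m -> (s <= i)%N -> (s <= j)%N -> S ((1 - 'X) ^+ i * 'X ^+ j)) ->
  forall p, (size p <= m.+1)%N -> 'X ^+ s %| p -> ('X - 1%:P) ^+ s %| p -> S p.
Proof.
move=> S0 SD SZ SM p sp d0 d1.
have [->|pN0] := eqVneq p 0; first exact: S0.
have cop : coprimep ('X ^+ s) (('X - 1%:P : {poly R}) ^+ s).
  apply/coprimep_expl/coprimep_expr; rewrite coprimep_XsubC.
  by rewrite rootX oner_eq0.
have : 'X ^+ s * (1 - 'X) ^+ s %| p.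
  rewrite -[1 - 'X]opprB exprNn mulrCA -signr_odd; case: (odd s); rewrite ?expr0 ?expr1 ?mul1r ?mulN1r.
    by rewrite -scaleN1r dvdpZl ?oppr_eq0 ?oner_eq0 // Gauss_dvdp ?d0.
  by rewrite Gauss_dvdp ?d0.
rewrite dvdp_eq => /eqP pE; set q := _ %/ _ in pE.
have qN0 : q != 0 by apply: contraNneq pN0 => q0; rewrite pE q0 mul0r.
have sX1 : size (1 - 'X : {poly R}) = 2 by rewrite -opprB size_polyN size_XsubC.
have X1N0 : (1 - 'X : {poly R}) != 0 by rewrite -size_poly_gt0 sX1.
have e1 : size ((1 - 'X : {poly R}) ^+ s) = s.+1.
  have := size_exp (1 - 'X : {poly R}) s; rewrite sX1 mul1n => /(congr1 succn).
  by rewrite prednK // size_poly_gt0 expf_neq0.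
have sX : size ('X ^+ s * (1 - 'X : {poly R}) ^+ s) = (s + s).+1.
  by rewrite size_mul ?expf_neq0 ?polyX_eq0 // size_polyXn e1 addnS.
have szq : (size q + (s + s) <= m.+1)%N.
  move: sp; rewrite pE size_mul // ?sX ?addnS //.
  by rewrite -size_poly_gt0 sX.
have q0 : (0 < size q)%N by rewrite size_poly_gt0.
have m2 : (s + s <= m)%N by exact: leq_trans (leq_add q0 (leqnn (s + s))) szq.
rewrite pE; apply: (@bernstein_ind (m - (s + s)) (fun q => S (q * ('X ^+ s * (1 - 'X) ^+ s)))).
- by rewrite mul0r.
- by move=> u v ? ?; rewrite mulrDl; apply: (SD _ _).
- by move=> c u ?; rewrite -scalerAl; apply: (SZ _ _).
- move=> i j ij.
  have -> : (1 - 'X) ^+ i * 'X ^+ j * ('X ^+ s * (1 - 'X) ^+ s) =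
      (1 - 'X) ^+ (i + s) * 'X ^+ (j + s) :> {poly R} by rewrite !exprD; poly_ring.
  apply: (SM _ _); lia.
- by rewrite -(leq_add2r (s + s)) addSn subnK.
Qed.

End Restriction.

(** * Polynomial potentials *)

Section PolynomialPotential.
Context {R : realFieldType}.
Implicit Types (P Q I : bipoly R) (x y z w : R * R) (p q : {poly R}).

Definition lincomb3 (L0 L1 L2 P : bipoly R) : Prop :=
  exists a b c, P = bconst a * L0 + bconst b * L1 + bconst c * L2.

(** Homogenization: once 1 and the two variables are combinations of [L0], [L1], [L2], lower degrees
    can be filled up to degree exactly k. It serves for ordinary monomials, for barycentric
    coordinates and for coordinates adapted to a line. *)
Lemma deg_lincomb3_ind (L0 L1 L2 : bipoly R) k (S : bipoly R -> Prop) :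
  lincomb3 L0 L1 L2 1 -> lincomb3 L0 L1 L2 bX -> lincomb3 L0 L1 L2 bY ->
  S 0 -> (forall P Q, S P -> S Q -> S (P + Q)) ->
  (forall c P, S P -> S (bconst c * P)) ->
  (forall i j l, (i + j + l)%N = k -> S (L0 ^+ i * L1 ^+ j * L2 ^+ l)) ->
  forall P, deg k P -> S P.
Proof.
move=> H1 HX HY; elim: k S => [|k IH] S S0 SD SZ SM P.
  case=> c ->; rewrite -[bconst c]mulr1; apply: (SZ _ _).
  by have := SM 0%N 0%N 0%N erefl; rewrite !expr0 !mulr1.
have SL (L : bipoly R) Q : (forall i j l, (i + j + l)%N = k -> S (L * (L0 ^+ i * L1 ^+ j * L2 ^+ l))) ->
    deg k Q -> S (L * Q).
  move=> SL; apply: (IH (fun Q => S (L * Q))); rewrite ?mulr0 //.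
    by move=> A B ? ?; rewrite mulrDr; apply: (SD _ _).
  by move=> c A ?; rewrite mulrCA; apply: (SZ _ _).
have SL0 Q : deg k Q -> S (L0 * Q).
  by apply: SL => i j l ijl; rewrite !mulrA -exprS; apply: (SM _ _ _); lia.
have SL1 Q : deg k Q -> S (L1 * Q).
  move=> dQ; apply: SL => // i j l ijl.
  by rewrite mulrA [L1 * _]mulrCA -exprS; apply: (SM _ _ _); lia.
have SL2 Q : deg k Q -> S (L2 * Q).
  move=> dQ; apply: SL => // i j l ijl.
  by rewrite mulrCA -exprS; apply: (SM _ _ _); lia.
have SC L Q : lincomb3 L0 L1 L2 L -> deg k Q -> S (L * Q).
  move=> [a [b [c ->]]] dQ; rewrite !mulrDl -!mulrA.
  by apply: (SD _ _); [apply: (SD _ _)|]; apply: (SZ _ _); auto.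
case=> P1 [P2] [c] [d1 d2 ->]; apply: (SD _ _); first by apply: (SD _ _); apply: SC.
by rewrite -[bconst c]mul1r; apply: SC => //; apply: degC.
Qed.

Lemma deriv_eq0 p : p^`() = 0 -> p = p.[0]%:P.
Proof.
move=> p'; apply/polyP => -[|i]; rewrite coefC /= ?horner_coef0 //.
by have /eqP := coef_deriv p i; rewrite p' coef0 eq_sym mulrn_eq0 /= => /eqP.
Qed.

Definition normal w : R * R := (w.2, - w.1).

(** In coordinates adapted to the line, [L] has derivative 1 along the normal and vanishes on the
    line, while [M] is constant along the normal. So [L^i M^j] integrates to
    [L^(i+1) M^j / (i+1)]. *)
Lemma antiderivative m x w P : w.1 ^+ 2 + w.2 ^+ 2 != 0 -> deg m P ->
  exists I, [/\ deg m.+1 I, bD (normal w) I = P & forall t, ev I (pt x w t) = 0].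
Proof.
move=> w0; set d := _ + _ in w0.
pose L : bipoly R := bconst (w.2 / d) * (bX - bconst x.1) - bconst (w.1 / d) * (bY - bconst x.2).
pose M : bipoly R := bconst w.1 * (bX - bconst x.1) + bconst w.2 * (bY - bconst x.2).
have dL : deg 1 L.
  by apply: degB; apply: degCM; apply: degB; [exact: degbX|exact: degC|exact: degbY|exact: degC].
have dM : deg 1 M.
  by apply: degD; apply: degCM; apply: degB; [exact: degbX|exact: degC|exact: degbY|exact: degC].
have DL : bD (normal w) L = 1.
  rewrite bDB !bDCM !bDB !bDC bDX bDY; apply: ev_inj => y; rewrite !evE /=.
  by have := mulfV w0; move: (d^-1) => e; rewrite /d; lra.
have DM : bD (normal w) M = 0.
  rewrite bDD !bDCM !bDB !bDC bDX bDY; apply: ev_inj => y; rewrite !evE /=; lra.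
have LN t : ev L (pt x w t) = 0 by rewrite !evE /=; lra.
apply: (@deg_lincomb3_ind L M 1 m (fun P => exists I,
  [/\ deg m.+1 I, bD (normal w) I = P & forall t, ev I (pt x w t) = 0])).
- by exists 0, 0, 1; rewrite bconst0 bconst1; bipoly_ring.
- exists w.2, (w.1 / d), x.1; apply: ev_inj => y; rewrite !evE /=.
  by have := congr1 (fun u => (y.1 - x.1) * u) (mulfV w0); move: (d^-1) => e; rewrite /d; lra.
- exists (- w.1), (w.2 / d), x.2; apply: ev_inj => y; rewrite !evE /=.
  by have := congr1 (fun u => (y.2 - x.2) * u) (mulfV w0); move: (d^-1) => e; rewrite /d; lra.
- by exists 0; split; rewrite ?bD0 //; [exact: deg0|move=> t; rewrite ev0].
- move=> A B [I [dI DI I0]] [J [dJ DJ J0]]; exists (I + J); split.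
  + exact: degD. + by rewrite bDD DI DJ. + by move=> t; rewrite evD I0 J0 addr0.
- move=> c A [I [dI DI I0]]; exists (bconst c * I); split.
  + exact: degCM. + by rewrite bDCM DI. + by move=> t; rewrite evM I0 mulr0.
- move=> i j l ijl; exists (bconst (i.+1%:R^-1) * (L ^+ i.+1 * M ^+ j)); split.
  + apply: degCM; apply: (@deg_leq _ (i.+1 * 1 + j * 1)); first lia.
    by apply: degM; apply: degXn.
  + have DX n (A : bipoly R) : bD (normal w) (A ^+ n) = bconst n%:R * A ^+ n.-1 * bD (normal w) A.
      elim: n => [|n IHn]; first by rewrite expr0 bD_1 bconst0 !mul0r.
      rewrite exprS bDM IHn; case: n {IHn} => [|n] /=.
        by rewrite bconst0 !mul0r mulr0 bconst1 expr0; bipoly_ring.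
      by rewrite !exprS -[n.+2%:R]natr1 bconstD bconst1; bipoly_ring.
    rewrite expr1n mulr1 bDCM bDM !DX DL DM /= mulr0 mulr0 addr0 mulr1 !mulrA -bconstM.
    by rewrite mulVf ?pnatr_eq0 // bconst1 mul1r.
  + by move=> t; rewrite !evM evXn LN expr0n /= mul0r mulr0.
Qed.

(** The normal derivative of [I] is [P]. Its tangential derivative is zero on the line and is in
    turn the antiderivative of [bD w P], which has one order less: induction applies. *)
Lemma antiderivative_vanish s x w P I : w.1 ^+ 2 + w.2 ^+ 2 != 0 ->
  bD (normal w) I = P -> (forall t, ev I (pt x w t) = 0) ->
  forall t, vanish s P (pt x w t) -> vanish s.+1 I (pt x w t).
Proof.
move=> w0; elim: s P I => [|s IH] P I DI I0 t vP; first by split.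
have nw : (normal w).1 * w.2 - (normal w).2 * w.1 != 0.
  by rewrite /= mulNr opprK addrC -!expr2.
apply/(vanishS _ _ _ nw); split; [exact: I0|by rewrite DI|].
apply: (IH (bD w P)); last exact: vanish_bD vP.
  by rewrite bDcomm DI.
move=> u; rewrite -horner_rs -deriv_rs.
have -> : rs x w I = 0 by apply: poly_eq0_inf => v; rewrite horner_rs.
by rewrite deriv0 horner0.
Qed.

Lemma normal10 : normal (0, 1) = (1, 0) :> R * R.
Proof. by rewrite /normal /= oppr0. Qed.

(** The Poincare lemma in the plane, with control of the degree. *)
Lemma divfree_curl m P Q : deg m P -> deg m Q -> bD1 P + bD2 Q = 0 ->
  exists I, [/\ deg m.+1 I, bD2 I = P & - bD1 I = Q].
Proof.
move=> dP dQ div0.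
have e01 : ((0, 1) : R * R).1 ^+ 2 + ((0, 1) : R * R).2 ^+ 2 != 0.
  by rewrite /= expr0n expr1n add0r oner_eq0.
have e10 : ((1, 0) : R * R).1 ^+ 2 + ((1, 0) : R * R).2 ^+ 2 != 0.
  by rewrite /= !expr2 mulr1 mulr0 addr0 oner_eq0.
have [I [dI DI _]] := antiderivative (0, 0) e10 (degN dP).
have D2I : bD2 I = P.
  rewrite -[P]opprK -DI (@bD_lin _ _ 0 (-1) (1, 0) (0, 1)) /normal /=.
    by rewrite bconst0 bconstN bconst1 mul0r add0r mulN1r opprK bD2E.
  by congr pair; lra.
(* The defect [E] in the second component does not depend on the second variable, so its
   antiderivative [J] in the first, normalized to vanish on the second axis, does not either;
   subtracting [J] leaves [bD2 I] untouched. *)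
pose E := bD1 I + Q.
have dE : deg m E by apply: degD => //; rewrite bD1E; apply: (@deg_bD _ m.+1).
have D2E : bD2 E = 0.
  by rewrite bD2E bDD [bD1 I]bD1E bDcomm -bD1E -!bD2E D2I div0.
have [J [dJ DJ J0]] := antiderivative (0, 0) e01 dE.
rewrite normal10 in DJ.
have D2J : bD2 J = 0.
  apply: ev_eq0 => y.
  have -> : y = pt (0, y.2) (1, 0) y.1.
    by rewrite /pt /=; case: y => a b /=; congr pair; lra.
  rewrite -horner_rs [rs _ _ _]deriv_eq0.
    rewrite hornerC horner_rs /pt /= !mul0r !addr0.
    have -> : (0, y.2) = pt (0, 0) (0, 1) y.2 :> R * R by rewrite /pt /=; congr pair; lra.
    rewrite -horner_rs bD2E -deriv_rs.
    have -> : rs (0, 0) (0, 1) J = 0 by apply: poly_eq0_inf => v; rewrite horner_rs.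
    by rewrite deriv0 horner0.
  apply: poly_eq0_inf => t.
  by rewrite deriv_rs bD2E bDcomm DJ -bD2E D2E horner_rs ev0.
exists (I - J); split; first exact: degB.
  by rewrite bD2E bDB -!bD2E D2I D2J subr0.
by rewrite bD1E bDB DJ -bD1E /E; bipoly_ring.
Qed.

(* Subtracting from (U1, U2) the normal field whose normal component is the
   antiderivative of its divergence vanishing on the line leaves a curl. *)
Lemma line_potential m x w (U1 U2 : bipoly R) : w.1 ^+ 2 + w.2 ^+ 2 != 0 ->
  deg m U1 -> deg m U2 ->
  exists I, deg m.+1 I /\ forall s t, vanish s (bD1 U1 + bD2 U2) (pt x w t) ->
    vanish s.+1 (bD2 I - U1) (pt x w t) /\ vanish s.+1 (- bD1 I - U2) (pt x w t).
Proof.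
move=> w0 d1 d2.
(* For [m = 0] the degree cannot drop and [m.-1.+1] is not [m]; the field is then constant, hence
   already a curl. *)
have [m0|m_gt0] := posnP m.
  rewrite m0 in d1 d2; case: d1 d2 => c -> [d ->].
  have dv0 : bD1 (bconst c) + bD2 (bconst d) = 0 by rewrite bD1E bD2E !bDC addr0.
  have [I [dI I1 I2]] := divfree_curl (degC m c) (degC m d) dv0.
  exists I; split => // s t _; rewrite I1 I2 !subrr; split; exact: vanish0.
have dd : deg m.-1 (bD1 U1 + bD2 U2).
  by rewrite bD1E bD2E; apply: degD; apply: deg_bD.
have [J [dJ DJ J0]] := antiderivative x w0 dd.
rewrite prednK // in dJ.
pose V1 := U1 - bconst (normal w).1 * J; pose V2 := U2 - bconst (normal w).2 * J.
have [I [dI I1 I2]] : exists I, [/\ deg m.+1 I, bD2 I = V1 & - bD1 I = V2].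
  apply: divfree_curl; try by apply: degB => //; apply: degCM.
  rewrite /V1 /V2 [bD1 _]bD1E [bD2 _]bD2E !bDB !bDCM -!bD1E -!bD2E addrACA -opprD.
  by rewrite -bDE DJ subrr.
exists I; split => // s t /(antiderivative_vanish w0 DJ J0) vJ.
rewrite I1 I2 /V1 /V2 ![_ - _ * J - _]addrAC !subrr !sub0r.
by split; apply/vanishN/vanishMl.
Qed.

End PolynomialPotential.

(** * Barycentric coordinates *)

(** Vertex indices live in Z/3: [a + 1] and [a + 1 + 1] are the other two vertices, and span the
    edge opposite to [a]. *)
Lemma ord3_neq (a b : 'I_3) : b != a -> b = a + 1 \/ b = a + 1 + 1.
Proof.
case: a b => [[|[|[|//]]] ?] [[|[|[|//]]] ?] //= _;
  by [left; apply: val_inj|right; apply: val_inj].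
Qed.

Lemma ord3_cycle (a : 'I_3) : a + 1 + 1 + 1 = a.
Proof. by case: a => [[|[|[|//]]] ?]; apply: val_inj. Qed.

Lemma ord3_neq1 (a : 'I_3) : a + 1 != a.
Proof. by case: a => [[|[|[|//]]] ?]. Qed.

Lemma ord3_neq2 (a : 'I_3) : a + 1 + 1 != a.
Proof. by case: a => [[|[|[|//]]] ?]. Qed.

Lemma sum3 (V : nmodType) (F : 'I_3 -> V) (a : 'I_3) :
  \sum_b F b = F a + F (a + 1) + F (a + 1 + 1).
Proof.
have E (u v : 'I_3) : u = v :> nat -> F u = F v by move=> /val_inj ->.
rewrite !big_ord_recl big_ord0 addr0.
case: a => [[|[|[|//]]] lta].
- by rewrite -addrA; congr (_ + (_ + _)); apply: E.
- by rewrite addrC; congr (_ + _); [congr (_ + _)|]; apply: E.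
- by rewrite addrC -addrA addrC; congr (_ + _ + _); apply: E.
Qed.

Section Barycentric.
Context {R : realFieldType}.
Implicit Types (P Q : bipoly R) (x y w p q r : R * R).

(** Twice the signed area of the triangle [p q r]; it vanishes for [p] on the line [q r]. *)
Definition det3 p q r : R := (q.1 - p.1) * (r.2 - p.2) - (q.2 - p.2) * (r.1 - p.1).

Lemma det3_cycle p q r : det3 q r p = det3 p q r.
Proof. by rewrite /det3; lra. Qed.

Variable z : 'I_3 -> R * R.

Fact bary_key : unit. Proof. by []. Qed.
(** The ratio of signed areas, written out as an affine polynomial. *)
Definition bary := locked_with bary_key (fun a : 'I_3 =>
  let q := z (a + 1) in let r := z (a + 1 + 1) in
  bconst (det3 (z a) q r)^-1 *
  (bconst (q.1 * r.2 - q.2 * r.1) + bconst (q.2 - r.2) * bX + bconst (r.1 - q.1) * bY)).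

Lemma ev_bary a x : ev (bary a) x = det3 x (z (a + 1)) (z (a + 1 + 1)) / det3 (z a) (z (a + 1)) (z (a + 1 + 1)).
Proof. by rewrite /bary unlock !evE mulrC; congr (_ / _); rewrite /det3; lra. Qed.

Lemma deg_bary a : deg 1 (bary a).
Proof.
by rewrite /bary unlock; apply: degCM; apply: degD; [apply: degD|]; [exact: degC|apply: degCM|apply: degCM];
  [exact: degbX|exact: degbY].
Qed.

Hypothesis nz : det3 (z 0) (z (0 + 1)) (z (0 + 1 + 1)) != 0.

Lemma det3_neq0 a : det3 (z a) (z (a + 1)) (z (a + 1 + 1)) != 0.
Proof.
have [->//|] := eqVneq a 0; case/ord3_neq => ->.
  by rewrite ord3_cycle det3_cycle.
by rewrite ord3_cycle -det3_cycle.
Qed.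

Lemma bary_vertex a b : ev (bary a) (z b) = (a == b)%:R.
Proof.
rewrite ev_bary; have [->|] := eqVneq a b; first by rewrite divff // det3_neq0.
rewrite eq_sym => /ord3_neq[] ->; rewrite (_ : det3 _ _ _ = 0) ?mul0r //;
  by rewrite /det3; lra.
Qed.

Lemma sum_bary : \sum_a bary a = 1.
Proof.
apply: ev_inj => x; rewrite (sum3 _ 0) !evD !ev_bary ev1 !ord3_cycle.
rewrite [det3 (z (0 + 1)) _ _]det3_cycle -[det3 (z (0 + 1 + 1)) _ _]det3_cycle.
rewrite -!mulrDl; apply: (canLR (mulfK nz)); rewrite /det3; lra.
Qed.

Lemma bX_bary : bX = \sum_a bconst (z a).1 * bary a.
Proof.
apply: ev_inj => x; rewrite (sum3 _ 0) !evD !evM !evC !ev_bary evbX !ord3_cycle.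
rewrite [det3 (z (0 + 1)) _ _]det3_cycle -[det3 (z (0 + 1 + 1)) _ _]det3_cycle.
rewrite !mulrA -!mulrDl; apply: (canRL (mulfK nz)); rewrite /det3; lra.
Qed.

Lemma bY_bary : bY = \sum_a bconst (z a).2 * bary a.
Proof.
apply: ev_inj => x; rewrite (sum3 _ 0) !evD !evM !evC !ev_bary evbY !ord3_cycle.
rewrite [det3 (z (0 + 1)) _ _]det3_cycle -[det3 (z (0 + 1 + 1)) _ _]det3_cycle.
rewrite !mulrA -!mulrDl; apply: (canRL (mulfK nz)); rewrite /det3; lra.
Qed.

End Barycentric.

(** * Extension of vertex and edge data to a triangle *)

Section Span.
Context {R : realFieldType}.
Implicit Types (P Q : bipoly R) (x y w : R * R) (al : 'I_3 -> nat) (S : ('I_3 -> nat) -> Prop).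
Variable z : 'I_3 -> R * R.
Hypothesis nz : det3 (z 0) (z (0 + 1)) (z (0 + 1 + 1)) != 0.
Local Notation lam := (bary z).

Definition mono al : bipoly R := \prod_a lam a ^+ al a.

(** Only the existence of an expansion with exponents in [S] is recorded, so coefficients never have
    to be compared. *)
Inductive span S : bipoly R -> Prop :=
| span_nil : span S 0
| span_cons c al P : S al -> span S P -> span S (bconst c * mono al + P).

Lemma span_add S P Q : span S P -> span S Q -> span S (P + Q).
Proof.
move=> sP sQ; elim: sP => [|c al P' Sal _ IH]; first by rewrite add0r.
by rewrite -addrA; constructor.
Qed.

Lemma span_scale S c P : span S P -> span S (bconst c * P).
Proof.
elim=> [|d al P' Sal _ IH]; first by rewrite mulr0; constructor.
by rewrite mulrDr mulrA -bconstM; constructor.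
Qed.

Lemma span_sub (S S' : ('I_3 -> nat) -> Prop) P : (forall al, S al -> S' al) -> span S P -> span S' P.
Proof. by move=> SS'; elim=> [|c al P' /SS' Sal _ IH]; constructor. Qed.

Lemma span_split S (T : pred ('I_3 -> nat)) P : span S P ->
  exists P1 P2, [/\ P = P1 + P2, span (fun al => S al /\ T al) P1 &
    span (fun al => S al /\ ~~ T al) P2].
Proof.
elim=> [|c al P' Sal _ [P1 [P2 [-> s1 s2]]]].
  by exists 0, 0; split; rewrite ?addr0 //; constructor.
case: (boolP (T al)) => Tal.
  by exists (bconst c * mono al + P1), P2; split; rewrite ?addrA //; constructor.
by exists P1, (bconst c * mono al + P2); split; rewrite ?addrA 1?[P1 + _]addrC //; constructor.
Qed.

Lemma span_ind_vanish S P s x : (forall al, S al -> vanish s (mono al) x) -> span S P -> vanish s P x.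
Proof.
move=> H; elim=> [|c al P' Sal _ IH]; first exact: vanish0.
by apply: vanishD => //; apply/vanishMl/H.
Qed.

Lemma deg_mono al : deg (\sum_a al a) (mono al).
Proof.
rewrite /mono; elim/big_rec2: _ => [|a m P _ dP]; first exact: (degC 0 1).
by apply: degM => //; rewrite -[X in deg X]muln1; apply: degXn; apply: deg_bary.
Qed.

Lemma deg_span k P : deg k P -> span (fun al => \sum_a al a = k)%N P.
Proof.
apply: (@deg_lincomb3_ind R (lam 0) (lam (0 + 1)) (lam (0 + 1 + 1)) k (span (fun al => \sum_a al a = k)%N)).
- by exists 1, 1, 1; rewrite bconst1 !mul1r -(sum_bary nz) (sum3 _ 0).
- by eexists _, _, _; rewrite (bX_bary nz) (sum3 _ 0).
- by eexists _, _, _; rewrite (bY_bary nz) (sum3 _ 0).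
- by constructor.
- exact: span_add.
- exact: span_scale.
move=> i j l ijl; pose al (a : 'I_3) := nth 0%N [:: i; j; l] a.
have -> : lam 0 ^+ i * lam (0 + 1) ^+ j * lam (0 + 1 + 1) ^+ l = bconst 1 * mono al + 0.
  rewrite bconst1 mul1r addr0 /mono !big_ord_recl big_ord0 mulr1 mulrA.
  by congr (_ * _ * _); congr (bary _ _ ^+ _); apply: val_inj.
constructor; last by constructor.
by rewrite !big_ord_recl big_ord0 addn0 /al /= addnA.
Qed.

Lemma span_deg k S P : (forall al, S al -> \sum_a al a = k)%N -> span S P -> deg k P.
Proof.
move=> Sk; elim=> [|c al P' Sal _ IH]; first exact: deg0.
by apply: degD => //; apply: degCM; rewrite -(Sk _ Sal); apply: deg_mono.
Qed.

Lemma vanish_mono_edge al a x : ev (lam a) x = 0 -> vanish (al a) (mono al) x.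
Proof.
by move=> xa; rewrite /mono (bigD1 a) //=; apply/vanishMr/vanishXn.
Qed.

(** The two other coordinates vanish at [z a], each contributing its exponent to the order. *)
Lemma vanish_mono_vertex al a s : (al a + s <= \sum_b al b)%N -> vanish s (mono al) (z a).
Proof.
move=> als; apply: (@vanish_leq _ s (\sum_(b | b != a) al b)).
  by move: als; rewrite (bigD1 a) //= leq_add2l.
rewrite /mono [X in vanish _ X _](bigD1 a) //=; apply: vanishMl.
elim/big_rec2: _ => // b m P ba vP.
by apply: vanishM => //; apply: vanishXn; rewrite bary_vertex // (negPf ba).
Qed.

Lemma rs_bary a b w : exists c : R, rs (z a) w (lam b) = (b == a)%:R%:P + c *: 'X.
Proof.
have := size_rs (z a) w (deg_bary z b); set p := rs _ _ _ => sp.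
exists p`_1; apply/polyP => -[|[|i]]; rewrite coefD coefC coefZ coefX /= ?mulr0 ?mulr1 ?addr0 ?add0r //.
  rewrite -horner_coef0 horner_rs -(bary_vertex nz); congr ev.
  by rewrite /pt !mul0r !addr0; case: (z a).
by rewrite nth_default // (leq_trans sp).
Qed.

(** On a line through [z a] the coordinates other than [lam a] restrict to multiples of the
    parameter, and together they occur here with exponent d. *)
Lemma rs_span a k d w S P : (forall al, S al -> (\sum_b al b = k)%N /\ (al a + d = k)%N) ->
  span S P -> exists c : R, rs (z a) w P = rs (z a) w (lam a) ^+ (k - d) * 'X^d * c%:P.
Proof.
move=> Sk; elim=> [|c al P' Sal _ [e IH]].
  by exists 0; rewrite polyC0 mulr0 -bconst0 rsC.
have [ak ad] := Sk _ Sal.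
have [g Eg] : exists g : R, rs (z a) w (\prod_(b | b != a) lam b ^+ al b) = 'X^(\sum_(b | b != a) al b) * g%:P.
  elim/big_rec2: _ => [|b m Q ba [g Eg]].
    by exists 1; rewrite expr0 polyC1 mulr1 -bconst1 rsC.
  have [h Eh] := rs_bary a b w.
  exists (h ^+ al b * g); rewrite rsM Eg rsXn Eh (negPf ba) polyC0 add0r.
  rewrite exprZn exprD polyCM -!mul_polyC; poly_ring.
exists (c * g + e); rewrite rsD rsM IH rsC /mono (bigD1 a) //= rsM Eg rsXn.
have -> : (k - d = al a)%N by lia.
have -> : (\sum_(b | b != a) al b = d)%N.
  by move: ak; rewrite (bigD1 a) //= -ad => /addnI.
by rewrite polyCD polyCM; poly_ring.
Qed.

(* The part of lowest order at the vertex is homogeneous along every line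
   through it, so it has to be zero. *)
Lemma span_vanish a k s S P : (forall al, S al -> \sum_b al b = k)%N ->
  (s <= k.+1)%N -> span S P -> vanish s P (z a) ->
  span (fun al => S al /\ (al a + s <= k)%N) P.
Proof.
move=> Sk + sP; elim: s => [|s IH] sk vP.
  apply: span_sub sP => al Sal; split => //.
  by rewrite addn0 -(Sk _ Sal) (bigD1 a) //= leq_addr.
have {}IH := IH (ltnW sk) (vanishW vP).
have [P1 [P2 [PE s1 s2]]] := span_split (fun al => al a + s == k)%N IH.
suff P10 : P1 = 0.
  rewrite PE P10 add0r; apply: span_sub s2 => al [[Sal als] nals]; split=> //.
  by rewrite addnS ltn_neqAle nals als.
have vP1 : vanish s.+1 P1 (z a).
  rewrite (_ : P1 = P - P2); last by rewrite PE addrK.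
  apply: vanishB => //; apply: span_ind_vanish s2 => al [[Sal als] nals].
  by apply: vanish_mono_vertex; rewrite (Sk _ Sal) addnS ltn_neqAle nals als.
apply: (@rs_eq0 _ (z a)) => w.
have [|c Ec] := @rs_span a k s w _ P1 _ s1.
  by move=> al [[Sal _] /eqP ?]; split => //; apply: Sk.
(* [X^(s+1)] divides [lam a ^(k-s) X^s c] on the line, and [lam a] is 1 at the vertex, so
   [c = 0]. *)
have := @vanish_dvdp _ s.+1 P1 (z a) w 0.
rewrite /pt !mul0r !addr0 -surjective_pairing => /(_ vP1); rewrite polyC0 subr0 Ec.
rewrite mulrAC exprS mulrC [X in X %| _]mulrC dvdp_mul2r ?expf_neq0 ?polyX_eq0 //.
rewrite -['X]subr0 -polyC0 dvdp_XsubCl /root hornerM horner_exp horner_rs hornerC.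
rewrite /pt !mul0r !addr0 -surjective_pairing bary_vertex // eqxx expr1n mul1r => /eqP c0.
by rewrite c0 polyC0 mulr0 mul0r.
Qed.

(** The monomials with [al a >= k - r] carry all derivatives of order at most r at [z a]. At another
    vertex [z b] they have [al b <= r], hence order at least [k - r > r], so the three vertices do
    not interact. *)
Lemma vertex_extension r k (A : 'I_3 -> bipoly R) : (r.*2 < k)%N -> (forall a, deg k (A a)) ->
  exists g, deg k g /\ forall a, vanish r.+1 (g - A a) (z a).
Proof.
move=> rk dA.
have H a : exists B, [/\ span (fun al => (\sum_b al b = k)%N /\ (k <= al a + r)%N) B
    & vanish r.+1 (A a - B) (z a)].
  have [B [C [AE sB sC]]] := span_split (fun al => k <= al a + r)%N (deg_span (dA a)).
  exists B; split => //; rewrite AE addrC addKr.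
  apply: span_ind_vanish sC => al [alk alr]; apply: vanish_mono_vertex; lia.
have [B0 [s0 v0]] := H 0; have [B1 [s1 v1]] := H (0 + 1); have [B2 [s2 v2]] := H (0 + 1 + 1).
have van a b B : b != a -> span (fun al => (\sum_b al b = k)%N /\ (k <= al a + r)%N) B ->
    vanish r.+1 B (z b).
  move=> ba; apply: span_ind_vanish => al [alk alr]; apply: vanish_mono_vertex.
  by move: alk; rewrite (bigD1 a) //= (bigD1 b) //=; lia.
exists (B0 + B1 + B2); split.
  by apply: degD; [apply: degD|]; [apply: span_deg s0|apply: span_deg s1|apply: span_deg s2] => al [].
move=> a; have [->|] := eqVneq a 0; last case/ord3_neq => ->.
- rewrite (_ : _ - _ = B1 + B2 - (A 0 - B0)); last by bipoly_ring.
  by apply: vanishB => //; apply: vanishD; [apply: van s1|apply: van s2].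
- rewrite (_ : _ - _ = B0 + B2 - (A (0 + 1) - B1)); last by bipoly_ring.
  by apply: vanishB => //; apply: vanishD; [apply: van s0|apply: van s2].
- rewrite (_ : _ - _ = B0 + B1 - (A (0 + 1 + 1) - B2)); last by bipoly_ring.
  by apply: vanishB => //; apply: vanishD; [apply: van s0|apply: van s1].
Qed.

(** Vanishing at both ends forces [al b <= k - r2 - 1] for [b != a]. Of these monomials, those with
    [al a <= r1] determine [B] to the required order on the edge. Their order at [z a] is at least
    [k - r1 > r2], and on another edge at least [k - r1 - (k - r2 - 1) = r2 + 1 - r1], which exceeds
    r1 because [2 r1 <= r2]. *)
Lemma edge_extension r1 r2 k a B : (r1.*2 <= r2)%N -> (r2.*2 < k)%N -> deg k B ->
  (forall b, b != a -> vanish r2.+1 B (z b)) ->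
  exists C, [/\ deg k C, forall b, vanish r2.+1 C (z b),
    forall x, ev (lam a) x = 0 -> vanish r1.+1 (B - C) x &
    forall b x, b != a -> ev (lam b) x = 0 -> vanish r1.+1 C x].
Proof.
move=> r12 r2k dB vB.
have sB := deg_span dB.
have rk : (r2.+1 <= k.+1)%N by lia.
have {}sB := span_vanish (fun al e => e) rk sB (vB _ (ord3_neq1 a)).
have {}sB := @span_vanish _ _ _ _ _ (fun al e => proj1 e) rk sB (vB _ (ord3_neq2 a)).
have [C [D [BE sC sD]]] := span_split (fun al => al a <= r1)%N sB.
have sumk al : (\sum_b al b = k -> al a + al (a + 1)%R + al (a + 1 + 1)%R = k)%N.
  by move=> <-; rewrite [RHS](sum3 _ a).
exists C; split.
- by apply: span_deg sC => al [[[]]].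
- move=> b; apply: span_ind_vanish sC => al [[[alk al1] al2] ala].
  apply: vanish_mono_vertex; rewrite alk; have := sumk _ alk.
  have [->|] := eqVneq b a; last by case/ord3_neq => ->.
  lia.
- move=> x xa; rewrite BE addrC addKr; apply: span_ind_vanish sD => al [_ ala].
  by apply: vanish_leq (vanish_mono_edge _ xa); rewrite ltnNge.
- move=> b x ba xb; apply: span_ind_vanish sC => al [[[alk al1] al2] ala].
  apply: vanish_leq (vanish_mono_edge _ xb); have := sumk _ alk.
  by case/ord3_neq: ba => ->; lia.
Qed.

(** The vertices are interpolated first; each edge is then corrected by a polynomial invisible, to
    the required orders, at the vertices and on the other two edges. *)
Lemma triangle_extension r1 r2 k (A B : 'I_3 -> bipoly R) :
  (r1.*2 <= r2)%N -> (r2.*2 < k)%N -> (forall a, deg k (A a)) -> (forall a, deg k (B a)) ->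
  (forall a b, b != a -> vanish r2.+1 (B a - A b) (z b)) ->
  exists g, [/\ deg k g, forall a, vanish r2.+1 (g - A a) (z a) &
    forall a x, ev (lam a) x = 0 -> vanish r1.+1 (g - B a) x].
Proof.
move=> r12 r2k dA dB AB.
have [g0 [dg0 vg0]] := vertex_extension r2k dA.
have H a : exists C, [/\ deg k C, forall b, vanish r2.+1 C (z b),
    forall x, ev (lam a) x = 0 -> vanish r1.+1 (B a - g0 - C) x &
    forall b x, b != a -> ev (lam b) x = 0 -> vanish r1.+1 C x].
  apply: edge_extension => //; first exact: degB.
  move=> b ba; apply: (@vanish_trans _ _ _ (A b)); first exact: AB.
  exact/vanish_sym/vg0.
have {H} /fin_all_exists [C HC] := H.
exists (g0 + \sum_a C a); split.
- by apply: degD => //; apply: deg_sum => a; case: (HC a).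
- move=> a; rewrite addrAC; apply: vanishD => //; apply: vanish_sum => b _.
  by case: (HC b).
- move=> a x xa; rewrite (bigD1 a) //=; set u := \sum_(b | _) _.
  have -> : g0 + (C a + u) - B a = u - (B a - g0 - C a) by bipoly_ring.
  apply: vanishB; last by case: (HC a) => _ _ + _; apply.
  by apply: vanish_sum => b ba; case: (HC b) => _ _ _ /(_ a x); apply; rewrite // eq_sym.
Qed.

End Span.

(** * Free edges of a grid *)

(** Totality and transitivity are asked on [E] only, because comparison of directions by the sign of
    a cross product is transitive only within a half-plane. *)
Lemma exists_least (F : finType) (E : {set F}) (r : rel F) :
  E != finset.set0 -> {in E &, total r} -> {in E & &, transitive r} ->
  exists2 e, e \in E & forall e', e' \in E -> r e e'.
Proof.
move: {2}#|E| (erefl #|E|) => n; elim: n E => [|n IH] E En E0 tot tr.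
  by move/eqP: En; rewrite cards_eq0 (negPf E0).
have [e eE] := finset.set0Pn _ E0.
have [Ee0|] := eqVneq (E :\ e) finset.set0.
  exists e => // e' e'E; have [->|e'e] := eqVneq e' e; first by have := tot e e eE eE; rewrite orbb.
  by have : e' \in E :\ e by [rewrite !inE e'e e'E]; rewrite Ee0 finset.in_set0.
have sub x : x \in E :\ e -> x \in E by rewrite inE => /andP[].
case/IH.
- by move: En; rewrite (cardsD1 e) eE => -[].
- by move=> x y /sub xE /sub yE; apply: tot.
- by move=> x y t /sub xE /sub yE /sub tE; apply: tr.
move=> e1 /[dup] e1E' /sub e1E H.
case/orP: (tot e e1 eE e1E) => r1.
  exists e => // e' e'E; have [->|e'e] := eqVneq e' e; first by have := tot e e eE eE; rewrite orbb.
  by apply: tr r1 _ => //; apply: H; rewrite !inE e'e.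
exists e1 => // e' e'E; have [->//|e'e] := eqVneq e' e.
by apply: H; rewrite !inE e'e.
Qed.

Lemma ord3_third (a b : 'I_3) : a != b -> exists c, (a = c + 1 /\ b = c + 1 + 1) \/ (b = c + 1 /\ a = c + 1 + 1).
Proof.
move=> ab; have [c cE] : exists c, a = c + 1 by exists (a + 1 + 1); rewrite ord3_cycle.
move: ab; rewrite eq_sym cE => /ord3_neq[->|->]; first by exists c; left.
exists (c + 1 + 1); right; rewrite ord3_cycle; split=> //.
Qed.

(** Increments around a 3-cycle come from vertex values as soon as they add up to zero. *)
Lemma ord3_potential (V : zmodType) (d : 'I_3 -> V) : \sum_b d b = 0 ->
  exists h : 'I_3 -> V, forall b, h (b + 1 + 1) - h (b + 1) = d b.
Proof.
rewrite (sum3 _ 0) => d0.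
exists (fun b => if b == 0 then 0 else if b == 0 + 1 then d (0 + 1 + 1) else d (0 + 1 + 1) + d 0).
move=> b; have [->/=|] := eqVneq b 0; first by rewrite addrC addKr.
case/ord3_neq => -> /=; last by rewrite subr0; congr d; apply: val_inj.
by rewrite sub0r; apply/eqP; rewrite eqr_oppLR -addr_eq0 addrC addrA -d0; apply/eqP; rewrite -addrA addrC -addrA addrC.
Qed.

Section Combinatorics.
Context {R : realFieldType} (N : nat) (T : 'I_N -> 'I_3 -> R * R).
Implicit Types (i j : 'I_N) (a b c : 'I_3).

(* The edge [(i, a)] of the triangle [i] is the one opposite to its vertex [a]. *)
Definition ends (e : 'I_N * 'I_3) : seq (R * R) := [:: T e.1 (e.2 + 1); T e.1 (e.2 + 1 + 1)].
Definition same_edge e e' : bool := perm_eq (ends e) (ends e').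

(** [pick] depends only on the extension of its predicate, so all copies of a geometric edge get the
    same representative, and an unknown per edge is a function of it. *)
Definition edge_rep (e : 'I_N * 'I_3) : 'I_N * 'I_3 := odflt e [pick e' | same_edge e e'].

Lemma edge_repP e : same_edge e (edge_rep e).
Proof. by rewrite /edge_rep; case: pickP => //= _; exact: perm_refl. Qed.

Lemma edge_rep_eq e e' : (edge_rep e == edge_rep e') = same_edge e e'.
Proof.
apply/eqP/idP => [E|ee'].
  by apply: perm_trans (edge_repP e) _; rewrite E perm_sym; apply: edge_repP.
rewrite /edge_rep (@eq_pick _ (same_edge e) (same_edge e')); last by move=> f; apply: (permPl ee').
by case: pickP => // /(_ e'); rewrite /same_edge perm_refl.
Qed.

Lemma same_edgeP e e' : same_edge e e' ->
  (T e.1 (e.2 + 1) = T e'.1 (e'.2 + 1) /\ T e.1 (e.2 + 1 + 1) = T e'.1 (e'.2 + 1 + 1)) \/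
  (T e.1 (e.2 + 1) = T e'.1 (e'.2 + 1 + 1) /\ T e.1 (e.2 + 1 + 1) = T e'.1 (e'.2 + 1)).
Proof.
rewrite /same_edge /ends => ee'; have := perm_mem ee' (T e.1 (e.2 + 1)).
rewrite !inE eqxx => /esym/orP[]/eqP E1.
  by left; split => //; move: ee'; rewrite E1 perm_cons => /perm_mem/(_ (T e.1 (e.2 + 1 + 1))); rewrite !inE eqxx => /esym/eqP.
right; split => //.
have := perm_trans ee' (permEl (perm_catC [:: T e'.1 (e'.2 + 1)] [:: T e'.1 (e'.2 + 1 + 1)])).
rewrite /= E1 perm_cons => /perm_mem/(_ (T e.1 (e.2 + 1 + 1))).
by rewrite !inE eqxx => /esym/eqP.
Qed.

Hypothesis nz : forall i, det3 (T i 0) (T i (0 + 1)) (T i (0 + 1 + 1)) != 0.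
Hypothesis opposite : forall i j a b, i != j -> same_edge (i, a) (j, b) ->
  det3 (T i a) (T i (a + 1)) (T i (a + 1 + 1)) * det3 (T j b) (T i (a + 1)) (T i (a + 1 + 1)) < 0.

Lemma vertex_inj i : injective (T i).
Proof.
move=> a b ab; apply/eqP/negPn/negP => /ord3_third[c [[aE bE]|[aE bE]]];
  have := det3_neq0 (nz i) c; rewrite -bE -aE ab /det3 => /eqP; apply; lra.
Qed.

Lemma same_edge_inj i a b : same_edge (i, a) (i, b) -> b = a.
Proof.
move=> /same_edgeP /= [[/vertex_inj/addIr -> //]|[/vertex_inj/addIr aE /vertex_inj/addIr bE]].
by have := ord3_neq2 b; rewrite -aE bE eqxx.
Qed.

Lemma lex_max_vertex (S : {set 'I_N}) : S != finset.set0 -> exists i a, i \in S /\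
  forall j b, j \in S -> (T j b).1 < (T i a).1 \/ (T j b).1 = (T i a).1 /\ (T j b).2 <= (T i a).2.
Proof.
move=> /finset.set0Pn[i0 i0S].
have : (finset.setX S [set: 'I_3]) != finset.set0 by apply/finset.set0Pn; exists (i0, 0); rewrite !inE i0S.
pose r (e e' : 'I_N * 'I_3) := (T e'.1 e'.2).1 < (T e.1 e.2).1 \/ (T e'.1 e'.2).1 = (T e.1 e.2).1 /\ (T e'.1 e'.2).2 <= (T e.1 e.2).2.
pose rb (e e' : 'I_N * 'I_3) := ((T e'.1 e'.2).1 < (T e.1 e.2).1) || ((T e'.1 e'.2).1 == (T e.1 e.2).1) && ((T e'.1 e'.2).2 <= (T e.1 e.2).2).
have rP e e' : reflect (r e e') (rb e e').
  rewrite /r /rb; apply: (iffP orP) => -[?|H]; first by left.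
  - by right; case/andP: H => /eqP.
  - by left.
  - by right; case: H => -> ->; rewrite eqxx.
case/(@exists_least _ _ rb).
- by move=> e e' _ _; rewrite /rb; case: ltgtP => //= _; rewrite ?orbT // le_total.
- move=> e1 e2 e3 _ _ _ /rP r1 /rP r2; apply/rP; rewrite /r; move: r1 r2; rewrite /r; lra.
move=> [i a]; rewrite !inE andbT => iS H; exists i, a; split => // j b jS.
by have /rP := H (j, b) ltac:(by rewrite !inE jS).
Qed.

Definition cross (u v : R * R) : R := u.1 * v.2 - u.2 * v.1.

(** Angles in an open half-plane, completed by one of its boundary rays, are linearly ordered. The
    proof rests on [v.1 * cross u t = u.1 * cross v t + t.1 * cross u v], where all first
    coordinates are nonpositive; the ray [v.1 = 0] is separate. *)
Lemma cross_trans (u v t : R * R) :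
  let neg (w : R * R) := w.1 < 0 \/ w.1 = 0 /\ w.2 < 0 in
  neg u -> neg v -> neg t -> 0 <= cross u v -> 0 <= cross v t -> 0 <= cross u t.
Proof.
rewrite /cross => /= nu nv nt uv vt.
have [v10|v10] : v.1 < 0 \/ v.1 = 0 /\ v.2 < 0 by [].
  rewrite -(nmulr_rle0 _ v10).
  have -> : v.1 * (u.1 * t.2 - u.2 * t.1) = u.1 * (v.1 * t.2 - v.2 * t.1) + t.1 * (u.1 * v.2 - u.2 * v.1) by lra.
  have u1 : u.1 <= 0 by case: nu => [/ltW|[-> _]].
  have t1 : t.1 <= 0 by case: nt => [/ltW|[-> _]].
  by rewrite -[0]addr0 lerD // mulr_le0_ge0.
case: v10 => v1 v2; rewrite v1 mul0r sub0r in vt.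
have t1 : t.1 = 0.
  case: nt => [t1|[->//]]; have : 0 < v.2 * t.1 by rewrite nmulr_rgt0.
  lra.
case: nt => [|[_ t2]]; first by rewrite t1 ltxx.
have u1 : u.1 <= 0 by case: nu => [/ltW|[-> _]].
rewrite t1 mulr0 subr0; nra.
Qed.

(* At the lexicographically largest vertex, all edges point into a half-plane,
   and the outermost one of them lies on a single triangle. *)
Lemma free_edge (S : {set 'I_N}) : S != finset.set0 ->
  exists i a, i \in S /\ forall j b, j \in S -> same_edge (i, a) (j, b) -> (j, b) = (i, a).
Proof.
move=> /lex_max_vertex[i0 [a0 [i0S maxw]]]; set w := T i0 a0 in maxw.
(* A triple [(i, a, b)] in [E] is an edge of the triangle i leaving [w = T i a] towards [T i b]; [D]
   is its direction. *)
pose D (e : 'I_N * 'I_3 * 'I_3) : R * R :=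
  ((T e.1.1 e.2).1 - w.1, (T e.1.1 e.2).2 - w.2).
pose E := [set e : 'I_N * 'I_3 * 'I_3 | [&& e.1.1 \in S, T e.1.1 e.1.2 == w & e.1.2 != e.2]].
have ED e : e \in E -> (D e).1 < 0 \/ (D e).1 = 0 /\ (D e).2 < 0.
  rewrite inE => /and3P[eS /eqP eW ab]; rewrite /D /=.
  case: (maxw _ e.2 eS) => [?|[E1 E2]]; first by left; rewrite subr_lt0.
  right; rewrite E1 subrr subr_lt0; split => //; rewrite lt_neqAle E2 andbT.
  apply: contraNneq ab => E3; apply/eqP/(@vertex_inj e.1.1); rewrite eW.
  by case: (w) (T _ _) E1 E3 => [? ?] [? ?] /= -> ->.
have : E != finset.set0.
  by apply/finset.set0Pn; exists (i0, a0, a0 + 1); rewrite inE /= i0S eqxx eq_sym ord3_neq1.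
case/(@exists_least _ _ (fun e e' => 0 <= cross (D e) (D e'))).
- by move=> e e' _ _ /=; rewrite /cross; lra.
- move=> v u t vE uE tE /=; apply: cross_trans; exact: ED.
move=> [[i a] b] /[dup] iE; rewrite inE => /and3P[/= iS /eqP aw ab] H.
have [c abc] := ord3_third ab.
exists i, c; split => // j c' jS ic.
have [jE|ij] := eqVneq i j.
  by rewrite -jE in ic *; rewrite (same_edge_inj ic).
(* As the edge [(i, a, b)] is extreme among all directions at [w], the third vertices of both
   triangles would lie weakly on the same side of it. *)
have ci : 0 <= cross (D (i, a, b)) (D (i, a, c)).
  apply: H; rewrite inE /= iS aw eqxx /=.
  by case: abc => [[-> _]|[_ ->]]; rewrite ?ord3_neq1 ?ord3_neq2.
have cj : 0 <= cross (D (i, a, b)) (D (j, a, c')).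
  have [a1 [ja ac]] : exists a1, T j a1 = w /\ a1 != c'.
    have := same_edgeP ic => /=; rewrite -aw.
    case: abc => [[-> _]|[_ ->]] [[E1 E2]|[E1 E2]].
    - by exists (c' + 1); rewrite E1 ord3_neq1.
    - by exists (c' + 1 + 1); rewrite E1 ord3_neq2.
    - by exists (c' + 1 + 1); rewrite E2 ord3_neq2.
    - by exists (c' + 1); rewrite E2 ord3_neq1.
  by have := H (j, a1, c'); apply; rewrite inE /= jS ja eqxx ac.
have := opposite ij ic; rewrite ltNge => /negP; case.
have := mulr_ge0 ci cj; rewrite /cross /D /= -aw.
case: abc => -[<- <-]; rewrite /det3.
  by congr (0 <= _); lra.
by congr (0 <= _); lra.
Qed.

(* The triangles are removed one by one along free edges; the unknown of the
   removed edge does not occur in the equations that remain. *)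
Lemma edge_system (s : 'I_N * 'I_3 -> R) (d : 'I_N -> R) : (forall e, s e != 0) ->
  exists c : 'I_N * 'I_3 -> R, forall i, \sum_a c (edge_rep (i, a)) * s (i, a) = d i.
Proof.
move=> s0.
suff H (S : {set 'I_N}) : exists c : 'I_N * 'I_3 -> R, forall i, i \in S ->
    \sum_a c (edge_rep (i, a)) * s (i, a) = d i.
  by have [c Hc] := H [set: 'I_N]; exists c => i; apply: Hc; rewrite inE.
move: {2}#|S| (erefl #|S|) => n; elim: n S => [|n IH] S Sn.
  by exists (fun=> 0) => i; move: Sn => /cards0_eq ->; rewrite finset.in_set0.
have [i [a [iS free]]] : exists i a, i \in S /\ forall j b, j \in S -> same_edge (i, a) (j, b) -> (j, b) = (i, a).
  by apply: free_edge; rewrite -cards_eq0 Sn.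
have [c Hc] := IH (S :\ i) ltac:(by move: Sn; rewrite (cardsD1 i) iS => -[]).
pose f := edge_rep (i, a).
exists (fun e => if e == f then (d i - \sum_(b | b != a) c (edge_rep (i, b)) * s (i, b)) / s (i, a) else c e).
move=> j jS; have [->|ji] := eqVneq j i.
  rewrite (bigD1 a) //= eqxx divfK // -[RHS](subrK (\sum_(b | b != a) c (edge_rep (i, b)) * s (i, b))).
  congr (_ + _); apply: eq_bigr => b ba; rewrite edge_rep_eq.
  case: ifP => // ib; suff: (i, b) = (i, a) by case=> /eqP; rewrite (negPf ba).
  by apply: free; rewrite // /same_edge perm_sym.
rewrite -(Hc j) ?inE ?ji //; apply: eq_bigr => b _; rewrite edge_rep_eq.
case: ifP => // jb; suff: (j, b) = (i, a) by case=> /eqP; rewrite (negPf ji).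
by apply: free; rewrite // /same_edge perm_sym.
Qed.

End Combinatorics.

(** * Surjectivity of the divergence *)

Section Lines.
Context {R : realFieldType}.
Implicit Types (x y p q w : R * R) (P I J U V : bipoly R).

Lemma line_pt p q x : p != q -> det3 x p q = 0 ->
  exists t, x = pt p (q.1 - p.1, q.2 - p.2) t.
Proof.
rewrite /det3; case: p q x => [a b] [c d] [e f] /= pq xpq.
have [ca|ca] := eqVneq (c - a) 0.
  have db : d - b != 0.
    apply: contraNneq pq => db; apply/eqP; congr pair; apply/esym/eqP; by rewrite -subr_eq0 ?ca ?db.
  have c_a : c = a by apply/eqP; rewrite -subr_eq0 ca.
  have /eqP : (a - e) * (d - b) = 0 by rewrite -xpq c_a; lra.
  rewrite mulf_eq0 (negPf db) orbF subr_eq0 => /eqP <-.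
  by exists ((f - b) / (d - b)); rewrite /pt /= divfK // c_a subrr mulr0 addr0; congr pair; lra.
exists ((e - a) / (c - a)); rewrite /pt /= divfK //; congr pair; first by lra.
apply: (mulIf ca); rewrite mulrDl mulrAC divfK //; apply/eqP; rewrite -subr_eq0; apply/eqP.
by rewrite -[RHS]xpq; lra.
Qed.

Lemma det3_pt p q t : det3 (pt p (q.1 - p.1, q.2 - p.2) t) p q = 0.
Proof. by rewrite /det3 /pt /=; lra. Qed.

Lemma norm2_neq0 p q : p != q -> (q.1 - p.1) ^+ 2 + (q.2 - p.2) ^+ 2 != 0.
Proof.
move=> pq; apply: contraNneq pq => /eqP; rewrite paddr_eq0 ?sqr_ge0 // !sqrf_eq0 !subr_eq0.
by case: p q => [a b] [c d] /= /andP[/eqP -> /eqP ->].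
Qed.

(* curl I agrees with (U, 0) to order [s] at [x]. *)
Definition curl_near (s : nat) I U x : Prop :=
  vanish s (bD2 I - U) x /\ vanish s (bD1 I) x.

Lemma curl_nearD s I J U V x : curl_near s I U x -> curl_near s J V x -> curl_near s (I + J) (U + V) x.
Proof.
case=> u2 u1 [v2 v1]; split; last by rewrite bD1D; apply: vanishD.
by rewrite bD2D opprD addrACA; apply: vanishD.
Qed.

Lemma curl_near_sub s I J x : vanish s.+1 (I - J) x -> curl_near s (I - J) 0 x.
Proof. by move=> H; split; rewrite ?subr0 ?bD1E ?bD2E; apply: vanish_bD H. Qed.

Lemma curl_near_eq s I J U x : vanish s.+1 (I - J) x -> curl_near s J U x -> curl_near s I U x.
Proof.
move=> /curl_near_sub IJ JU; rewrite -[I](subrK J) -[U]add0r; exact: curl_nearD.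
Qed.

Lemma curl_near_const s I U x c : curl_near s I U x -> curl_near s (I + bconst c) U x.
Proof. by case=> u2 u1; split; rewrite ?bD1E ?bD2E bDD bDC addr0 -?bD1E -?bD2E. Qed.

Lemma curl_near_bconstM s I c d x : vanish s.+1 (I - bconst d) x -> curl_near s (bconst c * I) 0 x.
Proof.
move=> H; apply: (@curl_near_eq _ _ (bconst (c * d))).
  by rewrite bconstM -mulrBr; apply: vanishMl.
by split; rewrite ?subr0 ?bD1E ?bD2E bDC; apply: vanish0.
Qed.

Lemma curl_near_unique s I J U x : curl_near s I U x -> curl_near s J U x ->
  ev I x = ev J x -> vanish s.+1 (I - J) x.
Proof.
move=> [i2 i1] [j2 j1] IJ.
have e12 : (1 : R) * 1 - 0 * 0 != 0 by rewrite mulr1 mulr0 subr0 oner_eq0.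
apply/(@vanishS R s (I - J) x (1, 0) (0, 1) e12); rewrite evB IJ subrr -bD1E -bD2E.
split=> //; first by rewrite bD1E bDB -!bD1E; apply: vanishB.
by rewrite bD2E bDB -!bD2E; apply: vanish_trans i2 (vanish_sym j2).
Qed.

End Lines.

Section DivSurjective.
Context {R : realFieldType} (N : nat) (T : 'I_N -> 'I_3 -> R * R).
Implicit Types (i j : 'I_N) (a b c : 'I_3).
Hypothesis nz : forall i, det3 (T i 0) (T i (0 + 1)) (T i (0 + 1 + 1)) != 0.
Hypothesis opposite : forall i j a b, i != j -> same_edge T (i, a) (j, b) ->
  det3 (T i a) (T i (a + 1)) (T i (a + 1 + 1)) * det3 (T j b) (T i (a + 1)) (T i (a + 1 + 1)) < 0.

Variables (r1 r2 k : nat).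
Hypotheses (r1_gt0 : (0 < r1)%N) (r12 : (r1.*2 <= r2)%N) (r2k : (r2.*2 < k)%N).
Variable q : 'I_N -> bipoly R.
Hypothesis dq : forall i, deg k.-2 (q i).
Hypothesis q_vertex : forall i j a b, T i a = T j b -> vanish r2.-1 (q i - q j) (T i a).
Hypothesis q_edge : forall i j a b, same_edge T (i, a) (j, b) ->
  forall x, det3 x (T i (a + 1)) (T i (a + 1 + 1)) = 0 -> vanish r1.-1 (q i - q j) x.

(** A reference triangle for each grid point. Near that point every [u i - curl (g i)] will be
    matched with the field of the reference triangle, so pairwise compatibility is automatic. *)
Definition vertex_rep i a : 'I_N := (odflt (i, a) [pick e | T e.1 e.2 == T i a]).1.

Lemma vertex_repP i a : exists b, T (vertex_rep i a) b = T i a.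
Proof.
rewrite /vertex_rep; case: pickP => [[j b] /= /eqP ?|_]; first by exists b.
by exists a.
Qed.

Lemma vertex_rep_eq i j a b : T i a = T j b -> vertex_rep i a = vertex_rep j b.
Proof.
move=> ab; rewrite /vertex_rep.
rewrite (@eq_pick _ _ (fun e : 'I_N * 'I_3 => T e.1 e.2 == T j b)); last by move=> e; rewrite ab.
by case: pickP => // /(_ (j, b)); rewrite eqxx.
Qed.

Lemma vertex_neq i a b : a != b -> T i a != T i b.
Proof. by apply: contraNneq => /(vertex_inj nz) ->. Qed.

Lemma edge_neq i a : T i (a + 1) != T i (a + 1 + 1).
Proof. by apply: vertex_neq; rewrite eq_sym ord3_neq1. Qed.

Lemma same_edge_vertex i j a b c : same_edge T (i, a) (j, b) -> c != a ->
  exists d, T i c = T j d.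
Proof.
by case/same_edgeP => /= -[E1 E2] /ord3_neq[->|->]; rewrite ?E1 ?E2; eexists.
Qed.

Lemma same_edge_line i j a b x : same_edge T (i, a) (j, b) ->
  det3 x (T i (a + 1)) (T i (a + 1 + 1)) = 0 -> det3 x (T j (b + 1)) (T j (b + 1 + 1)) = 0.
Proof.
case/same_edgeP => /= -[-> ->] //; rewrite /det3 => H.
by rewrite -[RHS]oppr0 -H; lra.
Qed.

Lemma line_vertex i a b : b != a -> det3 (T i b) (T i (a + 1)) (T i (a + 1 + 1)) = 0.
Proof. by case/ord3_neq => ->; rewrite /det3; lra. Qed.

Lemma bary_line i a x : ev (bary (T i) a) x = 0 <-> det3 x (T i (a + 1)) (T i (a + 1 + 1)) = 0.
Proof.
rewrite ev_bary; split => [/eqP|->]; last by rewrite mul0r.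
by rewrite mulf_eq0 invr_eq0 (negPf (det3_neq0 (nz i) a)) orbF => /eqP.
Qed.

(* v_i = u_i - curl g_i, where div u_i = q_i.  The potentials g_i are built from
   the local potentials [A i a] at vertices and [B i a] along edges of the jumps
   of u; near a vertex these agree up to constants, which the free parameters
   [c] on the edges allow to adjust around every triangle. *)
Lemma div_surjective : exists v1 v2 : 'I_N -> bipoly R,
  [/\ forall i, deg k.-1 (v1 i) /\ deg k.-1 (v2 i),
      forall i, bD1 (v1 i) + bD2 (v2 i) = q i,
      forall i j a b, T i a = T j b ->
        vanish r2 (v1 i - v1 j) (T i a) /\ vanish r2 (v2 i - v2 j) (T i a) &
      forall i j a b, same_edge T (i, a) (j, b) ->
        forall x, det3 x (T i (a + 1)) (T i (a + 1 + 1)) = 0 ->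
        vanish r1 (v1 i - v1 j) x /\ vanish r1 (v2 i - v2 j) x].
Proof.
have k2 : (k.-2.+1 = k.-1)%N by lia.
have k1 : (k.-1.+1 = k)%N by lia.
have r2_gt0 : (0 < r2)%N by lia.
(* The local solution is the field [(u i, 0)], from integrating [q i] in the first variable; all
   jumps thus have second component zero, as in [curl_near]. *)
have /fin_all_exists[u Hu] : forall i, exists I, deg k.-1 I /\ bD1 I = q i.
  move=> i.
  have e01 : ((0, 1) : R * R).1 ^+ 2 + ((0, 1) : R * R).2 ^+ 2 != 0.
    by rewrite /= expr0n expr1n add0r oner_eq0.
  have [I [dI DI _]] := antiderivative (0, 0) e01 (dq i).
  by exists I; rewrite -k2 bD1E -normal10.
have du i : deg k.-1 (u i) by case: (Hu i).
have pot i j x y : x != y -> exists I, deg k I /\ forall s z, det3 z x y = 0 ->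
    vanish s (q i - q j) z -> curl_near s.+1 I (u i - u j) z.
  move=> xy.
  have dij : deg k.-1 (u i - u j) by apply: degB.
  have [I [dI HI]] := @line_potential _ k.-1 x (y.1 - x.1, y.2 - x.2) _ 0 (norm2_neq0 xy) dij (deg0 _).
  exists I; rewrite k1 in dI; split => // s z /(line_pt xy)[t ->] vz.
  have dv : bD1 (u i - u j) + bD2 0 = q i - q j.
    by rewrite bD1E bDB bD2E bD0 addr0 -!bD1E (Hu i).2 (Hu j).2.
  have := HI s t; rewrite dv => /(_ vz)[H1 H2].
  by split => //; move/vanishN: H2; rewrite subr0 opprK.
have [A HA] : exists A : 'I_N -> 'I_3 -> bipoly R, forall i a,
    deg k (A i a) /\ curl_near r2 (A i a) (u i - u (vertex_rep i a)) (T i a).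
  suff H : forall i a, exists I, deg k I /\ curl_near r2 I (u i - u (vertex_rep i a)) (T i a).
    have /fin_all_exists[A HA] : forall i, exists A : 'I_3 -> bipoly R, forall a,
      deg k (A a) /\ curl_near r2 (A a) (u i - u (vertex_rep i a)) (T i a).
      by move=> i; have /fin_all_exists := H i.
    by exists A.
  move=> i a.
  have [b ab] := vertex_repP i a.
  (* Potentials are built relative to a line; any line through the vertex serves, here that of the
     edge to [a + 1]. *)
  have aa : a != a + 1 by rewrite eq_sym ord3_neq1.
  have [I [dI HI]] := pot i (vertex_rep i a) (T i a) (T i (a + 1)) (vertex_neq i aa).
  exists I; split => //; rewrite -(prednK r2_gt0); apply: HI; first by rewrite /det3; lra.
  by apply: (q_vertex (esym ab)).
have /fin_all_exists[G HG] : forall i, exists G,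
    deg k G /\ forall a, vanish r2.+1 (G - A i a) (T i a).
  by move=> i; apply: (vertex_extension (nz i)) => // a; case: (HA i a).
(* [K e] is 1 near one end of the edge e and 0 near the other two vertices, to order r2: adding a
   multiple of it moves the increment along the edge but not the curl at the vertices. *)
have /fin_all_exists[K HK] : forall e : 'I_N * 'I_3, exists K, deg k K /\
    forall a, vanish r2.+1 (K - bconst (a == e.2 + 1 + 1)%:R) (T e.1 a).
  by move=> e; apply: (vertex_extension (nz e.1)) => // a; exact: degC.
pose rep := edge_rep T.
have /fin_all_exists[L HL] : forall e : 'I_N * 'I_3, exists L, [/\ deg k L,
    forall x, det3 x (T e.1 (e.2 + 1)) (T e.1 (e.2 + 1 + 1)) = 0 ->
      curl_near r1 L (u e.1 - u (rep e).1) x &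
    forall c, c != e.2 -> curl_near r2 L (u e.1 - u (rep e).1) (T e.1 c)].
  move=> -[i a] /=.
  have [I [dI HI]] := pot i (rep (i, a)).1 _ _ (edge_neq i a).
  have := edge_repP T (i, a); rewrite -/rep; case: (rep (i, a)) dI HI => j b /= dI HI ab.
  exists I; split => //.
    by move=> x xa; rewrite -(prednK r1_gt0); apply: HI => //; apply: q_edge ab _ _.
  move=> c ca; rewrite -(prednK r2_gt0); apply: HI; first exact: line_vertex.
  by have [d /q_vertex] := same_edge_vertex ab ca.
(* [W] is the potential assigned to the representative of an edge, and [B] the one that a triangle
   must then take there: [u i - curl B] becomes the representative's [u - curl W], the same from
   both sides. *)
pose W (cf : 'I_N * 'I_3 -> R) f := G f.1 + bconst (cf f) * K f.
pose B cf e := L e + W cf (rep e).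
have dB cf e : deg k (B cf e).
  by apply: degD; [case: (HL e)|apply: degD; [case: (HG (rep e).1)|apply: degCM; case: (HK (rep e))]].
have HB cf i a b : b != a -> curl_near r2 (B cf (i, a)) (u i - u (vertex_rep i b)) (T i b).
  move=> ba; have [_ _ /(_ b ba) HLb] := HL (i, a).
  have := edge_repP T (i, a); rewrite /B -/rep; case: (rep (i, a)) HLb => j a' /= HLb aa'.
  have [d ijd] := same_edge_vertex aa' ba.
  have -> : u i - u (vertex_rep i b) = (u i - u j) + (u j - u (vertex_rep j d) + 0).
    by rewrite (vertex_rep_eq ijd); bipoly_ring.
  apply: curl_nearD => //; rewrite ijd; apply: curl_nearD.
    by apply: (curl_near_eq ((HG j).2 d)); case: (HA j d).
  by apply: curl_near_bconstM ((HK (j, a')).2 d).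
(* The increment of [K] along the edge as oriented by the triangle [e.1]. It is 1 or -1 according to
   whether the representative has the same orientation. *)
pose s e := ev (K (rep e)) (T e.1 (e.2 + 1 + 1)) - ev (K (rep e)) (T e.1 (e.2 + 1)).
have s_neq0 e : s e != 0.
  have evK f a : ev (K f) (T f.1 a) = (a == f.2 + 1 + 1)%:R.
    by have [_ /(_ a)[/eqP]] := HK f; rewrite evB evC subr_eq0 => /eqP.
  have neq (a : 'I_3) : (a + 1 == a + 1 + 1) = false.
    by apply: negbTE; rewrite eq_sym ord3_neq1.
  rewrite /s; case: (same_edgeP (edge_repP T e)) => -[-> ->]; rewrite !evK eqxx neq.
    by rewrite subr0 oner_eq0.
  by rewrite sub0r oppr_eq0 oner_eq0.
pose B0 e := L e + G (rep e).1.
have [cf Hc] := edge_system nz opposite (fun i => - \sum_a (ev (B0 (i, a)) (T i (a + 1 + 1)) - ev (B0 (i, a)) (T i (a + 1)))) s_neq0.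
have Bsum i : \sum_a (ev (B cf (i, a)) (T i (a + 1 + 1)) - ev (B cf (i, a)) (T i (a + 1))) = 0.
  rewrite -[RHS](subrr (\sum_a (ev (B0 (i, a)) (T i (a + 1 + 1)) - ev (B0 (i, a)) (T i (a + 1))))).
  rewrite -Hc -big_split /=; apply: eq_bigr => a _.
  by rewrite /B /B0 /W /s /rep /= !evE; lra.
have /fin_all_exists[g Hg] : forall i, exists g, [/\ deg k g,
    forall a, curl_near r2 g (u i - u (vertex_rep i a)) (T i a) &
    forall a x, det3 x (T i (a + 1)) (T i (a + 1 + 1)) = 0 ->
      curl_near r1 (g - B cf (i, a)) 0 x].
  move=> i; have [h Hh] := ord3_potential (Bsum i).
  (* The constants give [A' a] the value [h a] at its vertex and [B' a] the value [h (a + 1)] at the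
     start of its edge; by the choice of [h] its value at the other end is [h (a + 1 + 1)]. *)
  pose A' a := A i a + bconst (h a - ev (A i a) (T i a)).
  pose B' a := B cf (i, a) + bconst (h (a + 1) - ev (B cf (i, a)) (T i (a + 1))).
  have HA' a : curl_near r2 (A' a) (u i - u (vertex_rep i a)) (T i a).
    by apply: curl_near_const; case: (HA i a).
  have [|||gi [dgi gA gB]] := @triangle_extension _ (T i) (nz i) r1 r2 k A' B' r12 r2k.
  - by move=> a; apply: degD; [case: (HA i a)|exact: degC].
  - by move=> a; apply: degD; [exact: dB|exact: degC].
  - move=> a b ba; apply: curl_near_unique (HA' b) _; first exact/curl_near_const/HB.
    rewrite /A' /B' evD [RHS]evD !evC; have := Hh a.
    by case/ord3_neq: ba => -> E; lra.
  - exists gi; split => //.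
      by move=> a; apply: curl_near_eq (gA a) (HA' a).
    move=> a x /bary_line xa.
    have -> : gi - B cf (i, a) = gi - B' a + bconst (h (a + 1) - ev (B cf (i, a)) (T i (a + 1))).
      by rewrite /B'; bipoly_ring.
    by apply/curl_near_const/curl_near_sub/gB.
exists (fun i => u i - bD2 (g i)), (fun i => bD1 (g i)).
(* On an edge the corrected field agrees with one that depends only on the representative of the
   edge. *)
have Hv i a x : det3 x (T i (a + 1)) (T i (a + 1 + 1)) = 0 ->
    vanish r1 (u i - bD2 (g i) - (u (rep (i, a)).1 - bD2 (W cf (rep (i, a))))) x /\
    vanish r1 (bD1 (g i) - bD1 (W cf (rep (i, a)))) x.
  move=> xa; have [_ _ /(_ a x xa) Hgi] := Hg i; have [_ /(_ x xa) HLi _] := HL (i, a).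
  have [] := curl_nearD Hgi HLi.
  have -> : g i - B cf (i, a) + L (i, a) = g i - W cf (rep (i, a)) by rewrite /B; bipoly_ring.
  rewrite add0r /= bD1E bD2E !bDB -!bD1E -!bD2E => H2 H1; split => //.
  by move/vanishN: H2; congr vanish; bipoly_ring.
split.
- move=> i; case: (Hg i) => dg _ _; split; last by rewrite bD1E; apply: deg_bD.
  by apply: degB => //; rewrite bD2E; apply: deg_bD.
- move=> i; rewrite [bD1 (_ - _)]bD1E bDB -!bD1E (Hu i).2.
  by rewrite bD2E bD2E !bD1E bDcomm subrK.
- move=> i j a b ab; have [_ /(_ a)[i2 i1] _] := Hg i; have [_ /(_ b)[j2 j1] _] := Hg j.
  rewrite -ab -?(vertex_rep_eq ab) in j2 j1; split; last exact: vanishB.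
  move: (vanishB j2 i2); congr vanish; bipoly_ring.
- move=> i j a b ab x xa; have [v1 v2] := Hv i a x xa.
  have [w1 w2] := Hv j b x (same_edge_line ab xa).
  have E : rep (i, a) = rep (j, b) by apply/eqP; rewrite edge_rep_eq.
  by rewrite -E in w1 w2; split; apply: vanish_trans (vanish_sym _); eauto.
Qed.

End DivSurjective.

Local Open Scope classical_set_scope.
Local Open Scope ring_scope.

(** * Continuation of potentials *)

(** The target is an arbitrary type: besides real functions, this is applied to propositions and to
    sets of values. *)
Lemma connected_locally_constant (T : topologicalType) (U : Type) (S : set T) (f : T -> U) :
  connected S -> (forall x, S x -> \forall y \near x, S y -> f y = f x) ->
  forall x y, S x -> S y -> f x = f y.
Proof.
move=> cS lf x y Sx Sy.
suff E : [set z | S z /\ f z = f x] = S.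
  by have : S y by []; rewrite -E => -[].
apply: cS; first by exists x.
- exists (interior [set z | S z -> f z = f x]); first exact: open_interior.
  apply/seteqP; split => z /=; last by case=> Sz /interior_subset fz; split=> //; exact: fz.
  case=> Sz fz; split => //; apply: filterS (lf z Sz) => w fw Sw.
  by rewrite fw.
- exists (~` (interior [set z | S z -> f z <> f x])); first exact/open_closedC/open_interior.
  apply/seteqP; split => z /=.
    by case=> Sz fz; split => // /interior_subset /(_ Sz).
  case=> Sz nz; split => //; apply: contrapT => fz; apply: nz.
  by apply: filterS (lf z Sz) => w fw Sw; rewrite fw.
Qed.

Section Plane.
Context {R : realType}.
Local Notation X := (R * R)%type.

Lemma line_continuous (x y : X) : continuous (fun t : R => x + t *: (y - x)).
Proof.
by move=> t; apply: cvgD; [exact: cvg_cst|apply: cvgZ; [exact: cvg_id|exact: cvg_cst]].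
Qed.

Definition segment_convex (S : set X) := forall x y t, S x -> S y -> t \in `[0, 1] -> S (x + t *: (y - x)).

Lemma convex_locally_constant (U : Type) (S : set X) (f : X -> U) :
  segment_convex S -> (forall x, S x -> \forall y \near x, S y -> f y = f x) ->
  forall x y, S x -> S y -> f x = f y.
Proof.
move=> cS lf x y Sx Sy.
have xE : x + 0 *: (y - x) = x by rewrite scale0r addr0.
have yE : x + 1 *: (y - x) = y by rewrite scale1r addrC subrK.
have := @connected_locally_constant R _ [set` `[0 : R, 1]] (fun t : R => f (x + t *: (y - x))) _ _ 0 1.
rewrite xE yE; apply.
- exact: segment_connected.
- move=> t t01; have St := cS x y t Sx Sy t01.
  have L : \forall s \near t, S (x + s *: (y - x)) -> f (x + s *: (y - x)) = f (x + t *: (y - x)).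
    exact: (@line_continuous x y t _ (lf _ St)).
  apply: filterS L => s H s01.
  by apply: H; apply: cS.
- by rewrite /= in_itv /= lexx ler01.
- by rewrite /= in_itv /= lexx ler01.
Qed.

Lemma ball_convex (x : X) r : segment_convex (ball x r).
Proof.
move=> y z t [y1 y2] [z1 z2]; rewrite in_itv /= => /andP[t0 t1].
rewrite /ball /= in y1 y2 z1 z2.
have aux (a b c : R) : `|a - b| < r -> `|a - c| < r -> `|a - (b + t * (c - b))| < r.
  move=> ab ac.
  have -> : a - (b + t * (c - b)) = (1 - t) * (a - b) + t * (a - c) by lra.
  apply: le_lt_trans (ler_normD _ _) _; rewrite !normrM (ger0_norm t0) ger0_norm ?subr_ge0 //.
  have [->|tN0] := eqVneq t 0; first by rewrite mul0r subr0 mul1r addr0.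
  have : t * `|a - c| < t * r by rewrite ltr_pM2l // lt_neqAle eq_sym tN0.
  have : (1 - t) * `|a - b| <= (1 - t) * r by rewrite ler_wpM2l ?subr_ge0 // ltW.
  lra.
by split; rewrite /ball /=; apply: aux.
Qed.

End Plane.

Section Cocycle.
Context {R : realType}.
Local Notation X := (R * R)%type.
Variables (Omega : set X) (N : nat) (K : 'I_N -> set X) (phi : 'I_N -> X -> R).
Hypothesis closedK : forall i, closed (K i).
Hypothesis coverK : closure Omega = \bigcup_(i in [set: 'I_N]) K i.
Hypothesis phi_cocycle : forall i j x y, K i x -> K i y -> K j x -> K j y ->
  phi i y - phi i x = phi j y - phi j x.
Hypothesis openO : open Omega.

(* On a small ball around [x] the [phi i] differ by constants, so that [jump x] is a
   common primitive; [increment] is independent of the ball used to compute it. *)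
Definition jump (x y : X) : R :=
  if [pick i | `[< K i x >] && `[< K i y >]] is Some i then phi i y - phi i x else 0.

Lemma jumpE i x y : K i x -> K i y -> jump x y = phi i y - phi i x.
Proof.
move=> ix iy; rewrite /jump; case: pickP => [j /andP[/asboolP jx /asboolP jy]|/(_ i)].
  exact: phi_cocycle.
by rewrite !asboolT.
Qed.

Lemma jump_refl x : jump x x = 0.
Proof. by rewrite /jump; case: pickP => // i _; rewrite subrr. Qed.

(** The ball stays in the star of [x]. As there are finitely many [K i], all closed, such a radius
    always exists. *)
Definition in_star (x : X) (r : R) := forall i y, K i y -> ball x r y -> K i x.

Lemma in_star_exists x : exists2 r : R, 0 < r & in_star x r.
Proof.
have H i : \forall y \near x, K i y -> K i x.
  have [ix|nix] := pselect (K i x); first exact: filterE.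
  have : nbhs x (~` K i) by apply: open_nbhs_nbhs; split=> //; exact: closed_openC.
  by apply: filterS => y niy iy.
have {}H : \forall y \near x, forall i, K i y -> K i x by exact: (@filter_forall _ _ (fun i y => K i y -> K i x) _ (nbhs_filter x) H).
have /nbhs_ballP[r /= r0 {}H] := H.
exists r => // i y iy xy; exact: (H y xy i).
Qed.

Definition radius_spec (x : X) (r : R) :=
  [/\ 0 < r, in_star x r & Omega x -> ball x r `<=` Omega].

Lemma radius_exists x : exists r, radius_spec x r.
Proof.
have [r r0 sr] := in_star_exists x.
have [Ox|nOx] := pselect (Omega x); last by exists r; split.
have /nbhs_ballP[d /= d0 H] : nbhs x Omega by apply: open_nbhs_nbhs.
exists (Num.min r d); split; first by rewrite lt_min r0 d0.
  by move=> i y iy xy; apply: (sr i y) => //; apply: le_ball xy; rewrite ge_min lexx.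
by move=> _; apply: subset_trans H; apply: le_ball; rewrite ge_min lexx orbT.
Qed.

Definition rad (x : X) : R := xget 0 (radius_spec x).

Lemma radP x : radius_spec x (rad x).
Proof. by have [r] := radius_exists x; exact: xgetI. Qed.

Lemma rad_gt0 x : 0 < rad x. Proof. by case: (radP x). Qed.
Lemma rad_star x : in_star x (rad x). Proof. by case: (radP x). Qed.
Lemma rad_sub x : Omega x -> ball x (rad x) `<=` Omega. Proof. by case: (radP x). Qed.
Lemma rad_center x : ball x (rad x) x. Proof. exact/ballxx/rad_gt0. Qed.

Lemma OmegaK x : Omega x -> exists i, K i x.
Proof. by move=> /subset_closure; rewrite coverK => -[i _ ?]; exists i. Qed.

(** Any [K i] containing [w] contains both centres [z] and [y], so all three jumps are read off the
    same [phi i]. *)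
Lemma jump_trans z y w : Omega w -> ball z (rad z) y -> ball z (rad z) w -> ball y (rad y) w ->
  jump z w - jump z y = jump y w.
Proof.
move=> /OmegaK[i iw] zy zw yw.
have iz := rad_star iw zw; have iy := rad_star iw yw.
by rewrite !(jumpE iz) // (jumpE iy) //; lra.
Qed.

Lemma ball_near (x y : X) r : ball x r y -> \forall z \near y, ball x r z.
Proof.
move=> xy; have : open (ball x r) by exact: ball_open.
by rewrite openE => /(_ y xy).
Qed.

(** On each ball the jump from the centre is a primitive of the same local data, so the difference
    of the two is locally constant on the intersection, which is convex. *)
Lemma jump_independent z z' y y' : Omega z -> Omega z' ->
  ball z (rad z) y -> ball z (rad z) y' -> ball z' (rad z') y -> ball z' (rad z') y' ->
  jump z y' - jump z y = jump z' y' - jump z' y.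
Proof.
move=> Oz Oz' zy zy' z'y z'y'.
have := @convex_locally_constant R R (ball z (rad z) `&` ball z' (rad z')) (fun w => jump z w - jump z' w).
move=> /(_ _ _ y y') H; suff : jump z y - jump z' y = jump z y' - jump z' y' by lra.
apply: H; [| |by split|by split].
  move=> a b t [? ?] [? ?] ?; split; exact: ball_convex.
move=> w [zw z'w]; have := ball_near (rad_center w); apply: filterS => v wv [zv z'v].
have Ov : Omega v by exact: rad_sub zv.
by have := jump_trans Ov zw zv wv; have := jump_trans Ov z'w z'v wv; lra.
Qed.

Definition near_pair (y y' : X) := [set z | [/\ Omega z, ball z (rad z) y & ball z (rad z) y']].

Definition increment (y y' : X) : R := let z := xget y (near_pair y y') in jump z y' - jump z y.

Lemma increment_refl y : increment y y = 0.
Proof. by rewrite /increment subrr. Qed.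

Lemma incrementE z y y' : near_pair y y' z -> increment y y' = jump z y' - jump z y.
Proof.
move=> H; rewrite /increment; case: xgetP => [z' _ [Oz' z'y z'y']|/(_ z) //].
by case: H => *; apply: jump_independent.
Qed.

Lemma near_pairC y y' z : near_pair y y' z -> near_pair y' y z.
Proof. by case. Qed.

Lemma incrementN y y' z : near_pair y y' z -> increment y' y = - increment y y'.
Proof. by move=> H; rewrite (incrementE H) (incrementE (near_pairC H)); lra. Qed.

(** A discrete path with its accumulated increment: continuation of the local primitives from ball
    to ball. *)
Inductive chain (a : X) : X -> R -> Prop :=
| chain_nil : chain a a 0
| chain_cons b b' c z : chain a b c -> near_pair b b' z -> chain a b' (c + increment b b').

Lemma chain_cat a b d c c' : chain a b c -> chain b d c' -> chain a d (c + c').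
Proof.
move=> ab; elim=> [|b1 b2 e z _ IH z12]; first by rewrite addr0.
by rewrite addrA; apply: chain_cons IH z12.
Qed.

Lemma chain_rev a b c : chain a b c -> chain b a (- c).
Proof.
elim=> [|b1 b2 e z _ IH z12]; first by rewrite oppr0; constructor.
rewrite opprD addrC -(incrementN z12) -[increment _ _]add0r.
apply: chain_cat IH; apply: chain_cons (near_pairC z12); constructor.
Qed.

Lemma chain_seq a b c : chain a b c -> exists n (y : nat -> X), [/\ y 0%N = a, y n = b,
  forall i, (i < n)%N -> exists z, near_pair (y i) (y i.+1) z & c = \sum_(i < n) increment (y i) (y i.+1)].
Proof.
elim=> [|b1 b2 e z _ [n [y [y0 yn H E]]] z12].
  by exists 0%N, (fun=> a); split => //; rewrite big_ord0.
exists n.+1, (fun i => if (i <= n)%N then y i else b2); split; rewrite ?leq0n ?ltnn //.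
  move=> i; rewrite ltnS => i_n; rewrite i_n; case: ltnP => [/H //|n_i].
  by have -> : i = n by [apply/eqP; rewrite eqn_leq i_n]; rewrite yn; exists z.
rewrite big_ord_recr /= ltnn leqnn yn E; congr (_ + _).
by apply: eq_bigr => i _; rewrite ltnW // ltn_ord.
Qed.

Lemma sum_increment M (f : nat -> X) z : Omega z -> (forall m, (m <= M)%N -> ball z (rad z) (f m)) ->
  \sum_(m < M) increment (f m) (f m.+1) = increment (f 0%N) (f M).
Proof.
move=> Oz H.
rewrite (@incrementE z); last by split=> //; apply: H.
rewrite -(big_mkord xpredT (fun m => increment (f m) (f m.+1))).
rewrite (@telescope_sumr_eq _ 0 M (fun m => jump z (f m))) // => m /andP[_ mM].
by rewrite (@incrementE z) //; split=> //; apply: H; rewrite // ltnW.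
Qed.

Definition clamp (s : R) : R := Num.max 0 (Num.min s 1).

(** The polygonal path through [y 0, ..., y m] at integer times. Written as a sum of clamped
    displacements, it is continuous without any gluing. *)
Fixpoint polygon (y : nat -> X) (m : nat) (s : R) : X :=
  if m is m'.+1 then polygon y m' s + clamp (s - m'%:R) *: (y m'.+1 - y m') else y 0%N.

Lemma polygon_end y m s : m%:R <= s -> polygon y m s = y m.
Proof.
elim: m s => //= m IH s ms.
rewrite IH; last by apply: le_trans ms; rewrite ler_nat.
have -> : clamp (s - m%:R) = 1.
  have : 1 <= s - m%:R by move: ms; rewrite -natr1; lra.
  by move=> H; rewrite /clamp (min_idPr H) (max_idPr ler01).
by rewrite scale1r addrC subrK.
Qed.

Lemma polygon_mid y m i s : (i < m)%N -> i%:R <= s <= i.+1%:R ->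
  polygon y m s = y i + (s - i%:R) *: (y i.+1 - y i).
Proof.
elim: m => // m IH; rewrite ltnS leq_eqVlt => /orP[/eqP ->|im] /andP[s0 s1] /=.
  rewrite polygon_end //; congr (_ + _ *: _).
  rewrite /clamp min_l; last by move: s1; rewrite -natr1; lra.
  by rewrite max_r // subr_ge0.
rewrite IH ?s0 //; have -> : clamp (s - m%:R) = 0; last by rewrite scale0r addr0.
have : s - m%:R <= 0.
  by rewrite subr_le0; apply: le_trans s1 _; rewrite ler_nat.
by move=> H; rewrite /clamp max_l // ge_min H.
Qed.

Lemma clamp_continuous : continuous clamp.
Proof.
have -> : clamp = ((fun=> 0) \max (id \min (fun=> 1)) : R -> R^o) by [].
move=> s; apply: continuous_max; first exact: cvg_cst.
by apply: continuous_min; [exact: cvg_id|exact: cvg_cst].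
Qed.

Lemma polygon_continuous y m : continuous (polygon y m).
Proof.
elim: m => [|m IH] s /=; first exact: cvg_cst.
apply: cvgD; first exact: IH.
apply: cvgZ; last exact: cvg_cst.
apply: (@continuous_cvg _ _ _ (nbhs s) _ (fun s => s - m%:R) clamp); first exact: clamp_continuous.
by apply: cvgB; [exact: cvg_id|exact: cvg_cst].
Qed.

End Cocycle.

(** * Homotopy invariance of the increments *)

Section Monodromy.
Context {R : realType}.
Local Notation X := (R * R)%type.
Variables (Omega : set X) (N : nat) (K : 'I_N -> set X) (phi : 'I_N -> X -> R).
Hypothesis closedK : forall i, closed (K i).
Hypothesis coverK : closure Omega = \bigcup_(i in [set: 'I_N]) K i.
Hypothesis phi_cocycle : forall i j x y, K i x -> K i y -> K j x -> K j y ->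
  phi i y - phi i x = phi j y - phi j x.
Hypothesis openO : open Omega.
Local Notation rad := (rad Omega K).
Local Notation increment := (increment Omega K phi).
Local Notation chain := (chain Omega K phi).
Local Notation near_pair := (near_pair Omega K).
Local Notation square := ([set` `[0 : R, 1]] `*` [set` `[0 : R, 1]]).

Lemma lebesgue_number (H : X -> X) : {within square, continuous H} ->
  (forall p, square p -> Omega (H p)) ->
  exists2 e : R, 0 < e & forall p, square p -> exists2 z, Omega z &
    forall p', square p' -> ball p e p' -> ball z (rad z) (H p').
Proof.
move=> cH OH.
have : compact square by apply: compact_setX; exact: segment_compact.
move=> /compact_near_coveringP cpt.
have : \forall e \near (0 : R)^'+, square `<=` (fun p => exists2 z, Omega z &
    forall p', square p' -> ball p e p' -> ball z (rad z) (H p')).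
  apply: (cpt R (0 : R)^'+ (fun e p => exists2 z, Omega z &
    forall p', square p' -> ball p e p' -> ball z (rad z) (H p'))) => p sp.
  have : \forall q \near p, square q -> ball (H p) (rad (H p)) (H q).
    have /subspace_continuousP/(_ p sp) Hp := cH.
    exact: (Hp _ (nbhsx_ballx (H p) _ (rad_gt0 closedK openO (H p)))).
  move=> /nbhs_ballP[d /= d0 Hd].
  (* Half the radius goes to moving the centre from [p] to [q], the other half bounds e. *)
  exists (ball p (d / 2), [set e | e < d / 2]) => /=.
    split; first by apply: nbhsx_ballx; rewrite divr_gt0.
    by apply: nbhs_right_lt; rewrite divr_gt0.
  move=> [q e] /= [pq ed]; exists (H p); first exact: OH.
  move=> p' sp' qp'; apply: Hd => //; rewrite (splitr d).
  by apply: ball_triangle pq _; apply: le_ball qp'; exact: ltW.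
move=> He; near (0 : R)^'+ => e; exists e => //.
by near: e.
Unshelve. all: by end_near. Qed.

(** Monodromy: the contracting homotopy is subdivided into cells that each map into one ball. The
    increments around a cell cancel, so the sum along a row of the subdivision does not change from
    the loop to the constant path. *)
Lemma chain_loop a c : simply_connected Omega -> Omega a -> chain a a c -> c = 0.
Proof.
move=> [_ sc] Oa /chain_seq[n [y [y0 yn np ->]]].
have [n0|n_gt0] := posnP n; first by rewrite n0 big_ord0.
have [gam gamE] : exists gam, forall t, gam t = polygon y n (n%:R * t) by exists (fun t => polygon y n (n%:R * t)).
have gam0 : gam 0 = a by rewrite gamE mulr0 (@polygon_mid _ _ _ 0) ?n_gt0 ?lexx ?ler01 // subrr scale0r addr0.
have gam1 : gam 1 = a by rewrite gamE mulr1 polygon_end.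
have gamO t : t \in `[0, 1] -> Omega (gam t).
  rewrite in_itv /= => /andP[t0 t1].
  have [i i_n it] : exists2 i, (i < n)%N & i%:R <= n%:R * t <= i.+1%:R.
    have nt : 0 <= n%:R * t by rewrite mulr_ge0.
    have := truncn_itv nt; set i := Num.truncn _ => /andP[it ti].
    have [i_n|n_i] := ltnP i n; first by exists i => //; rewrite it ltW.
    (* At [t = 1] the truncation returns [n], beyond the last segment, so that segment is used. *)
    exists n.-1; rewrite ?prednK //; have : n%:R * t <= n%:R by rewrite ler_piMr.
    move=> ->; rewrite andbT; apply: le_trans it; rewrite ler_nat; lia.
  rewrite gamE (polygon_mid _ i_n it); have [z [Oz zi zi1]] := np i i_n.
  apply: (rad_sub closedK openO Oz); apply: ball_convex => //.
  by move: it; rewrite in_itv /= -natr1; lra.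
have cgam : {within [set` `[0, 1]], continuous gam}.
  apply: continuous_subspaceT => t; rewrite (funext gamE).
  apply: (@continuous_cvg _ _ _ (nbhs t) _ (fun t => n%:R * t) (polygon y n)).
    exact: polygon_continuous.
  by apply: cvgM; [exact: cvg_cst|exact: cvg_id].
have [H [cH HO Hbt Hs]] := sc gam cgam gamO (etrans gam0 (esym gam1)).
have [|e e0 He] := lebesgue_number cH.
  by move=> [t s] [/= t01 s01]; apply: HO.
have [M M_gt0 Me] : exists2 M, (0 < M)%N & e^-1 < M%:R.
  exists (Num.truncn e^-1).+1 => //.
  by have /truncn_itv/andP[] : 0 <= e^-1 by rewrite invr_ge0 ltW.
(* The subdivision is a multiple of [n] so that the nodes of the chain are among its points, and
   fine enough because of [M]. *)
have [L LE] : exists L, L = (n * M)%N by exists (n * M)%N.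
have L0 : 0 < L%:R :> R by rewrite ltr0n LE muln_gt0 n_gt0.
have Le : L%:R^-1 < e.
  rewrite invf_plt ?posrE //; apply: lt_le_trans Me _; rewrite ler_nat LE.
  by rewrite leq_pmull.
have [p pE] : exists p : nat -> R, forall m, p m = m%:R / L%:R by exists (fun m => m%:R / L%:R).
have p01 m : (m <= L)%N -> p m \in `[0, 1].
  by move=> mL; rewrite in_itv /= pE divr_ge0 // ler_pdivrMr // mul1r ler_nat.
have [h hE] : exists h : nat -> nat -> X, forall m l, h m l = H (p m, p l) by exists (fun m l => H (p m, p l)).
have p0 : p 0%N = 0 by rewrite pE mul0r.
have pL : p L = 1 by rewrite pE divff // gt_eqF.
have pS m : p m.+1 - p m = L%:R^-1 by rewrite !pE -mulrBl -natr1 addrC addKr mul1r.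
have cell m l : (m < L)%N -> (l < L)%N -> exists z, [/\ Omega z,
    ball z (rad z) (h m l) /\ ball z (rad z) (h m.+1 l),
    ball z (rad z) (h m l.+1) & ball z (rad z) (h m.+1 l.+1)].
  move=> mL lL.
  have [|z Oz Hz] := He (p m, p l); first by split=> /=; apply: p01; exact: ltnW.
  have b0 (x : R) : ball x e x by exact: ballxx.
  have b1 m' : ball (p m') e (p m'.+1).
    by rewrite /ball /= distrC pS ger0_norm // invr_ge0 ltW.
  have hz m' l' : (m' <= L)%N -> (l' <= L)%N -> ball (p m) e (p m') -> ball (p l) e (p l') ->
      ball z (rad z) (h m' l').
    by move=> m'L l'L bm bl; rewrite hE; apply: Hz; split=> //=; apply: p01.
  by exists z; split => //; first split; apply: hz => //; rewrite ltnW.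
have [row rowE] : exists row : nat -> R, forall l, row l = \sum_(m < L) increment (h m l) (h m.+1 l) by eexists.
have rowS l : (l < L)%N -> row l = row l.+1.
  move=> lL; apply/eqP; rewrite -subr_eq0 !rowE -sumrB.
  (* By the cell identity the difference of two rows telescopes into vertical increments, and those
     at both ends vanish as the homotopy fixes the base point. *)
  pose v m := increment (h m l) (h m l.+1).
  have E (m : 'I_L) : increment (h m l) (h m.+1 l) - increment (h m l.+1) (h m.+1 l.+1) = - v m.+1 - - v m.
    have [z [Oz [z1 z2] z3 z4]] := cell _ _ (ltn_ord m) lL.
    have st x x' : ball z (rad z) x -> ball z (rad z) x' ->
        increment x x' = jump K phi z x' - jump K phi z x.
      by move=> zx zx'; apply: incrementE => //; split.
    by rewrite /v !st //; lra.
  rewrite (eq_bigr _ (fun m _ => E m)).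
  rewrite -(big_mkord xpredT (fun m => - v m.+1 - - v m)) telescope_sumr //.
  have h0 l' : (l' <= L)%N -> h 0%N l' = gam 0 by move=> /p01/Hs[]; rewrite hE p0.
  have hL l' : (l' <= L)%N -> h L l' = gam 0.
    by move=> /p01/Hs[]; rewrite hE pL.
  by rewrite /v !h0 ?hL ?(ltnW lL) // !increment_refl oppr0 subrr.
have row0L : row 0%N = row L.
  suff H0 l : (l <= L)%N -> row 0%N = row l by exact: H0.
  by elim: l => // l IH lL; rewrite IH 1?ltnW // rowS.
have rowL : row L = 0.
  rewrite rowE; apply: big1 => m _.
  have hL m' : (m' <= L)%N -> h m' L = gam 0.
    by move=> /p01/Hbt[_]; rewrite hE pL.
  by rewrite !hL ?increment_refl // ltnW.
rewrite -[RHS]rowL -row0L rowE.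
have hgam m : (m <= L)%N -> h m 0%N = gam (p m).
  by move=> /p01/Hbt[+ _]; rewrite hE p0.
have -> : \sum_(m < L) increment (h m 0%N) (h m.+1 0%N) = \sum_(m < L) increment (gam (p m)) (gam (p m.+1)).
  by apply: eq_bigr => m _; rewrite !hgam // ltnW.
(* Each step of the chain is cut into [M] pieces of a segment inside a single ball, so they sum to
   the increment of that step. *)
suff Hj j : (j <= n)%N -> \sum_(m < j * M) increment (gam (p m)) (gam (p m.+1)) = \sum_(i < j) increment (y i) (y i.+1).
  by rewrite LE Hj.
elim: j => [|j IH] jn; first by rewrite !big_ord0.
rewrite big_ord_recr /= -IH ?(ltnW jn) // mulSn addnC big_split_ord /=; congr (_ + _).
have [z [Oz zj zj1]] := np j jn.
have gamp m : (m <= M)%N -> gam (p (j * M + m)%N) = y j + (m%:R / M%:R) *: (y j.+1 - y j).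
  move=> mM; have M0 : 0 < M%:R :> R by rewrite ltr0n.
  have E : n%:R * p (j * M + m)%N = j%:R + m%:R / M%:R.
    rewrite pE LE natrM natrD natrM.
    have n0 : n%:R != 0 :> R by rewrite pnatr_eq0 -lt0n.
    rewrite mulrA; apply: (canLR (mulfK _)); first by rewrite mulf_neq0 // gt_eqF.
    have := congr1 (fun u => m%:R * n%:R * u) (mulfV (lt0r_neq0 M0)); move: (M%:R^-1) => f.
    by lra.
  rewrite gamE (@polygon_mid _ _ _ j) // E; last first.
    by rewrite -natr1 lerDl divr_ge0 // lerD2l ler_pdivrMr // mul1r ler_nat.
  by rewrite addrAC subrr add0r.
have gamz m : (m <= M)%N -> ball z (rad z) (gam (p (j * M + m)%N)).
  move=> mM; rewrite gamp //; apply: ball_convex => //.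
  by rewrite in_itv /= divr_ge0 // ler_pdivrMr ?ltr0n // mul1r ler_nat.
have := @sum_increment _ _ _ _ _ closedK coverK phi_cocycle openO M (fun m => gam (p (j * M + m)%N)) z Oz gamz.
rewrite gamp // gamp // mul0r scale0r addr0 divff ?pnatr_eq0 -?lt0n // scale1r addrC subrK => <-.
by apply: eq_bigr => m _; rewrite addnS.
Qed.

End Monodromy.

(** * A global potential on the closed domain *)

Section Potential.
Context {R : realType}.
Local Notation X := (R * R)%type.
Variables (Omega : set X) (N : nat) (K : 'I_N -> set X) (phi : 'I_N -> X -> R).
Hypothesis closedK : forall i, closed (K i).
Hypothesis convexK : forall i, segment_convex (K i).
Hypothesis coverK : closure Omega = \bigcup_(i in [set: 'I_N]) K i.
Hypothesis phi_cocycle : forall i j x y, K i x -> K i y -> K j x -> K j y ->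
  phi i y - phi i x = phi j y - phi j x.
Hypothesis polyO : polygonal_domain Omega.
Hypothesis scO : simply_connected Omega.
Local Notation rad := (rad Omega K).
Local Notation jump := (jump K phi).
Local Notation increment := (increment Omega K phi).
Local Notation chain := (chain Omega K phi).
Local Notation near_pair := (near_pair Omega K).

Let openO : open Omega. Proof. by case: polyO. Qed.

Lemma near_pair_center x y : Omega x -> ball x (rad x) y -> near_pair x y x.
Proof. by move=> Ox xy; split => //; exact: rad_center. Qed.

Lemma increment_center x y : Omega x -> ball x (rad x) y -> increment x y = jump x y.
Proof.
move=> Ox xy; rewrite (incrementE closedK coverK phi_cocycle openO (near_pair_center Ox xy)).
by rewrite jump_refl subr0.
Qed.

Lemma chain_exists a x : Omega a -> Omega x -> exists c, chain a x c.
Proof.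
move=> Oa Ox; have [_ _ cO _ _] := polyO.
have : (exists c, chain a a c) = (exists c, chain a x c).
  apply: (@connected_locally_constant _ _ Omega (fun x => exists c, chain a x c)) => // y Oy.
  have := ball_near (rad_center closedK openO y); apply: filterS => z yz _.
  have np := near_pair_center Oy yz.
  apply/propext; split=> -[c ac]; eexists.
    exact: chain_cons ac (near_pairC np).
  exact: chain_cons ac np.
by move=> <-; exists 0; constructor.
Qed.

(** The value at [x] is the total of any chain from a base point to [x]; two such chains form a
    loop, so the choice does not matter. *)
Lemma primitive_exists : exists psi : X -> R, forall x y z, Omega x ->
  near_pair x y z -> psi y - psi x = increment x y.
Proof.
have [[a Oa] _ _ _ _] := polyO.
exists (fun x => xget 0 [set c | chain a x c]) => x y z Ox np.
have [c ac] := chain_exists Oa Ox.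
have E b d : chain a b d -> xget 0 [set c | chain a b c] = d.
  move=> abd; apply: xget_unique => //= d' abd'.
  have := chain_loop closedK coverK phi_cocycle openO scO Oa
    (chain_cat abd' (chain_rev closedK coverK phi_cocycle openO abd)).
  by move/eqP; rewrite subr_eq0 => /eqP.
by rewrite (E _ _ ac) (E _ _ (chain_cons ac np)) addrC addKr.
Qed.

Lemma polar_continuous (x : X) th : continuous (fun p : X => x + p.1 *: ((cos (th + p.2), sin (th + p.2)) : X)).
Proof.
move=> p; apply: cvgD; first exact: cvg_cst.
apply: cvgZ; first exact: cvg_fst.
have cth : th + q.2 @[q --> p] --> th + p.2 by apply: cvgD; [exact: cvg_cst|exact: cvg_snd].
have cc : cos (th + q.2) @[q --> p] --> cos (th + p.2).
  by apply: continuous_cvg cth; exact: continuous_cos.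
have cs : sin (th + q.2) @[q --> p] --> sin (th + p.2).
  by apply: continuous_cvg cth; exact: continuous_sin.
exact: (cvg_pair cc cs).
Qed.

Lemma polar_ball (x : X) th s d : 0 < s -> s < d -> ball x d (x + s *: ((cos th, sin th) : X)).
Proof.
move=> s0 sd.
have H (a b : R) : `|b| <= 1 -> ball a d (a + s * b).
  move=> b1; rewrite /ball /= opprD addNKr normrN normrM (gtr0_norm s0).
  apply: le_lt_trans sd; by rewrite ler_piMr // ltW.
by split; apply: H; rewrite ler_norml ?cos_geN1 ?cos_le1 ?sin_geN1 ?sin_le1.
Qed.

(** Balls are taken in the sup norm: two coordinates below [d / 2] give a Euclidean radius below
    [d / sqrt 2], hence below [d]. *)
Lemma polar_ball_inv (x : X) th s d : 0 < s -> ball x (d / 2) (x + s *: ((cos th, sin th) : X)) -> s < d.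
Proof.
move=> s0 [/= b1 b2].
have {b1} : `|s * cos th| < d / 2 by move: b1; rewrite /ball /= opprD addNKr normrN.
have {b2} : `|s * sin th| < d / 2 by move: b2; rewrite /ball /= opprD addNKr normrN.
move=> h1 h2; have d0 : 0 < d / 2 by apply: le_lt_trans h1.
have e1 : (s * sin th) ^+ 2 <= (d / 2) ^+ 2.
  by rewrite -real_normK ?num_real // lerXn2r ?nnegrE // ltW.
have e2 : (s * cos th) ^+ 2 <= (d / 2) ^+ 2.
  by rewrite -real_normK ?num_real // lerXn2r ?nnegrE // ltW.
have := cos2Dsin2 th => cs.
have ss : s ^+ 2 <= d ^+ 2 / 2.
  have : s ^+ 2 * (cos th ^+ 2 + sin th ^+ 2) = s ^+ 2 by rewrite cs mulr1.
  by move: e1 e2; rewrite !exprMn exprVn; lra.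
have dpos : 0 < d by lra.
rewrite -(@ltr_pXn2r _ 2) ?nnegrE //; [|exact: ltW|exact: ltW].
by apply: le_lt_trans ss _; have : 0 < d ^+ 2 by [rewrite exprn_gt0]; lra.
Qed.

(* At a boundary point, Omega is locally a sector, hence connected. *)
Lemma closure_locally_constant (f : X -> R) x r : closure Omega x -> 0 < r ->
  (Omega x -> ball x r `<=` Omega) ->
  (forall y, Omega y -> ball x r y -> \forall z \near y, Omega z -> ball x r z -> f z = f y) ->
  exists2 d, 0 < d <= r & forall y z, Omega y -> Omega z -> ball x d y -> ball x d z -> f y = f z.
Proof.
move=> cx r0 rO lf.
have [Ox|nOx] := pselect (Omega x).
  exists r; first by rewrite r0 lexx.
  move=> y z Oy Oz xy xz; apply: (@convex_locally_constant _ _ (ball x r) f) => //.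
    exact: ball_convex.
  move=> w xw; have := lf w (rO Ox w xw) xw; apply: filterS => v H xv.
  by apply: H => //; apply: rO.
have [_ _ _ _ /(_ x (conj cx nOx))[th [be [be0 _ cone]]]] := polyO.
have /nbhs_ballP[d0 /= d00 Hd] := cone.
pose d := Num.min r d0.
have d_gt0 : 0 < d by rewrite lt_min r0 d00.
have dr : d <= r by rewrite ge_min lexx.
have dd0 : d <= d0 by rewrite ge_min lexx orbT.
exists (d / 2); first by rewrite divr_gt0 //=; lra.
pose pol (p : X) : X := x + p.1 *: ((cos (th + p.2), sin (th + p.2)) : X).
(* In polar coordinates the sector is a rectangle, hence convex even when the angle exceeds pi;
   local constancy is pulled back to it. *)
pose S : set X := [set p | 0 < p.1 < d /\ 0 < p.2 < be].
have polS p : S p -> Omega (pol p) /\ ball x d (pol p).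
  move=> [/andP[p1 p1d] /andP[p2 p2b]].
  have xp : ball x d (pol p) by exact: polar_ball.
  split => //; apply/(Hd _ _).2; last by exists p.1, p.2; split.
  by apply: le_ball xp.
have const p q : S p -> S q -> f (pol p) = f (pol q).
  apply: (@convex_locally_constant _ _ S (fun p => f (pol p))).
    move=> a b t [a1 a2] [b1 b2]; rewrite in_itv /= => /andP[t0 t1].
    have aux (m u v : R) : 0 < u < m -> 0 < v < m -> 0 < u + t * (v - u) < m.
      move=> /andP[u0 um] /andP[v0 vm].
      have [->|tN0] := eqVneq t 0; first by rewrite mul0r addr0 u0.
      have t_gt0 : 0 < t by rewrite lt_neqAle eq_sym tN0.
      have e1 : 0 < t * v by rewrite mulr_gt0.
      have e2 : 0 <= (1 - t) * u by rewrite mulr_ge0 ?subr_ge0 // ltW.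
      have e3 : t * v < t * m by rewrite ltr_pM2l.
      have e4 : (1 - t) * u <= (1 - t) * m by rewrite ler_wpM2l ?subr_ge0 // ltW.
      apply/andP; split; lra.
    by split; apply: aux.
  move=> p' Sp'; have [Op' xp'] := polS p' Sp'.
  have xrp' : ball x r (pol p') by exact: le_ball xp'.
  have L : \forall v \near p', Omega (pol v) -> ball x r (pol v) -> f (pol v) = f (pol p').
    exact: (@polar_continuous x th p' _ (lf _ Op' xrp')).
  apply: filterS L => v H Sv; have [Ov xv] := polS v Sv.
  by apply: H => //; exact: le_ball xv.
have inS y : Omega y -> ball x (d / 2) y -> exists2 p, S p & y = pol p.
  move=> Oy xy.
  have xdy : ball x d0 y by apply: le_ball xy; lra.
  have [s [t [s0 t0 tb yE]]] := (Hd y xdy).1 Oy.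
  exists (s, t) => //; split; rewrite /= ?t0 ?tb ?s0 //=.
  by apply: (@polar_ball_inv x (th + t)) => //; rewrite -yE.
move=> y z Oy Oz /(inS y Oy)[p Sp ->] /(inS z Oz)[q Sq ->]; exact: const.
Qed.

(** Near any point [x] of the closure, [psi - jump x] is constant on the domain; that constant
    extends [psi] to [x]. On each [K i] the extension minus [phi i] is locally constant, and [K i]
    is convex. *)
Theorem cocycle_potential : exists e : X -> R, forall i x y, K i x -> K i y ->
  e y - e x = phi i y - phi i x.
Proof.
have [psi Hpsi] := primitive_exists.
have radx x := rad_gt0 closedK openO x.
have sub x : Omega x -> ball x (rad x) `<=` Omega by exact: rad_sub.
have inK x i w : K i w -> ball x (rad x) w -> K i x by exact: rad_star.
(* The first component is a radius, the second the value of the extension at [x]. *)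
pose spec x (p : R * R) := 0 < p.1 /\ p.1 <= rad x /\
  (closure Omega x -> forall w, Omega w -> ball x p.1 w -> psi w - jump x w = p.2).
have /choice[de Hde] x : exists p, spec x p.
  have [cx|ncx] := pselect (closure Omega x); last by exists (rad x, 0); split; [exact: radx|split].
  have [|d /andP[d0 dr] Hd] := @closure_locally_constant (fun w => psi w - jump x w) x (rad x) cx (radx x) (@sub x).
    move=> y Oy xy; have := ball_near (rad_center closedK openO y); apply: filterS => z yz Oz xz.
    have := Hpsi y z y Oy (near_pair_center Oy yz); rewrite increment_center //.
    by have := jump_trans closedK coverK phi_cocycle openO Oz xy xz yz; lra.
  have : nbhs x (ball x d) by apply: nbhsx_ballx.
  move=> /cx[w [Ow xw]]; exists (d, psi w - jump x w); split => //; split => // _ v Ov xv.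
  exact: Hd.
exists (fun x => (de x).2) => i x y ix iy.
have clK j z : K j z -> closure Omega z by move=> jz; rewrite coverK; exists j.
suff : (de x).2 - phi i x = (de y).2 - phi i y by lra.
apply: (@convex_locally_constant _ _ (K i) (fun x => (de x).2 - phi i x)) => //.
move=> {x y ix iy} x ix; have [dx [dxr Hx]] := Hde x.
have := ball_near (ballxx x dx); apply: filterS => y xy iy.
have [dy [dyr Hy]] := Hde y.
have : nbhs y (ball x (de x).1 `&` ball y (de y).1).
  by apply: filterI; [exact: ball_near|exact: nbhsx_ballx].
move=> /(clK _ _ iy)[w [Ow [xw yw]]].
have := Hx (clK _ _ ix) w Ow xw; have := Hy (clK _ _ iy) w Ow yw.
have [j jw] := OmegaK coverK Ow.
have jx : K j x by apply: inK jw _; exact: le_ball xw.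
have jy : K j y by apply: inK jw _; exact: le_ball yw.
rewrite !(jumpE phi_cocycle jx) // !(jumpE phi_cocycle jy) //.
by have := phi_cocycle ix iy jx jy; lra.
Qed.

End Potential.

(** * Degrees of freedom *)

Section Evaluation.
Context {R : realType}.
Implicit Types (P Q : bipoly R) (x y w : R * R) (p q : {poly R}) (m n s : nat).

Lemma ptE x w (t : R) : x + t *: w = pt x w t.
Proof. by []. Qed.

(** The difference quotient along [w] is that of the univariate restriction to a line, whose
    derivative is known. *)
Lemma is_derive_ev P x w : is_derive x w (ev P) (ev (bD w P) x).
Proof.
have E : (fun h : R => h^-1 *: ((ev P \o shift x) (h *: w) - ev P x)) =
    (fun h : R => h^-1 *: ((horner (rs x w P) \o shift 0) (h *: 1) - horner (rs x w P) 0)).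
  apply/funext => h; rewrite /= !horner_rs [h%:A]mulr1 addr0; congr (_ *: (ev P _ - ev P _)).
    by rewrite /pt /= addrC.
  by rewrite /pt !mul0r !addr0 -surjective_pairing.
have [dh vh] := is_derive_poly (rs x w P) 0.
split; first by rewrite /derivable E; exact: dh.
rewrite /derive E; move: vh; rewrite /derive => ->.
by rewrite deriv_rs horner_rs /pt !mul0r !addr0 -surjective_pairing.
Qed.

Lemma derive_ev w P : (fun x => 'D_w (ev P) x) = ev (bD w P).
Proof. by apply/funext => x; have [_ ->] := is_derive_ev P x w. Qed.

Lemma d1_ev P : d1 (ev P) = ev (bD1 P).
Proof. by rewrite bD1E -derive_ev. Qed.

Lemma d2_ev P : d2 (ev P) = ev (bD2 P).
Proof. by rewrite bD2E -derive_ev. Qed.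

Lemma iter_d1_d2_ev a b P : iter a (@d1 R) (iter b (@d2 R) (ev P)) = ev (iter a (@bD1 R) (iter b (@bD2 R) P)).
Proof.
have -> : iter b (@d2 R) (ev P) = ev (iter b (@bD2 R) P) by elim: b => //= b ->; rewrite d2_ev.
by elim: a => //= a ->; rewrite d1_ev.
Qed.

Lemma normal_derivative_ev x y n P : normal_derivative x y n (ev P) = ev (iter n (bD (unit_normal x y)) P).
Proof. by rewrite /normal_derivative; elim: n => //= n ->; rewrite derive_ev. Qed.

Lemma polynomial_of_degree_leP m (p : R * R -> R) :
  polynomial_of_degree_le m%:Z p <-> exists2 P, deg m P & p = ev P.
Proof.
split=> [[c pE]|[P + ->]].
  pose Q := \sum_(a < m.+1) \sum_(b < m.+1)
    (if (a + b <= m)%N then bconst (c a b) * (bX ^+ a * bY ^+ b) else 0).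
  exists Q.
    apply: deg_sum => a; apply: deg_sum => b; case: ifP => ab; last exact: deg0.
    apply: degCM; apply: (@deg_leq _ (a * 1 + b * 1)); first by rewrite !muln1.
    by apply: degM; apply: degXn; [exact: degbX|exact: degbY].
  apply/funext => x; rewrite pE /Q ev_sum; apply: eq_bigr => a _.
  rewrite ev_sum big_mkcond /=; apply: eq_bigr => b _; rewrite lez_nat.
  by case: ifP => _; rewrite ?ev0 // !evM evC !evXn evbX evbY mulrA.
apply: (@deg_lincomb3_ind _ bX bY 1 m (fun P => polynomial_of_degree_le m (ev P))).
- by exists 0, 0, 1; rewrite bconst0 bconst1; bipoly_ring.
- by exists 1, 0, 0; rewrite bconst0 bconst1; bipoly_ring.
- by exists 0, 1, 0; rewrite bconst0 bconst1; bipoly_ring.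
- by exists (fun _ _ => 0) => x; rewrite ev0 big1 // => a _; rewrite big1 // => b _; rewrite !mul0r.
- move=> A B [c cE] [d dE]; exists (fun a b => c a b + d a b) => x; rewrite evD cE dE -big_split.
  apply: eq_bigr => a _; rewrite -big_split; apply: eq_bigr => b _.
  by rewrite !mulrDl.
- move=> e A [c cE]; exists (fun a b => e * c a b) => x; rewrite evM evC cE mulr_sumr.
  by apply: eq_bigr => a _; rewrite mulr_sumr; apply: eq_bigr => b _; rewrite !mulrA.
- move=> i j l ijl; exists (fun a b => ((a == i) && (b == j))%:R) => x.
  have ilt : (i < m.+1)%N by lia.
  have jlt : (j < m.+1)%N by lia.
  rewrite (bigD1 (Ordinal ilt)) //= [X in _ + X]big1 => [|a ai]; last first.
    apply: big1 => b _; rewrite (_ : (a == i :> nat) = false) ?mul0r //.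
    by apply: contraNF ai => /eqP ai; apply/eqP/val_inj.
  rewrite addr0 (bigD1 (Ordinal jlt)) /=; last by rewrite lez_nat -ijl leq_addr.
  rewrite big1 => [|b /andP[_ bj]]; last first.
    rewrite (_ : (b == j :> nat) = false) ?andbF ?mul0r //.
    by apply: contraNF bj => /eqP bj; apply/eqP/val_inj.
  by rewrite !eqxx mul1r addr0 expr1n mulr1 evM !evXn evbX evbY.
Qed.

Lemma vanish_locally_zero P (U : set (R * R)) : open U -> U !=set0 ->
  (forall x, U x -> ev P x = 0) -> P = 0.
Proof.
move=> oU [x Ux] PU; apply: (@rs_eq0 _ x) => w.
apply/eqP/negPn/negP => rN0.
have : \forall t \near (0 : R), U (x + t *: w).
  have c : x + t *: w @[t --> (0 : R)] --> x + 0 *: w.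
    by apply: cvgD; [exact: cvg_cst|apply: cvgZ; [exact: cvg_id|exact: cvg_cst]].
  rewrite scale0r addr0 in c; apply: (c U); exact: open_nbhs_nbhs.
move=> /nbhs_ballP[d /= d0 H].
(* Distinct points of the line within distance [d], more of them than the restriction can have
   roots. *)
pose r := [seq d / i.+2%:R | i <- iota 0 (size (rs x w P))].
have := @max_poly_roots _ (rs x w P) r rN0.
rewrite /r map_inj_uniq ?iota_uniq ?size_map ?size_iota ?ltnn; last first.
  by move=> i j /(mulfI (lt0r_neq0 d0))/invr_inj/eqP; rewrite eqr_nat => /eqP [].
move=> K; suff: false by []; apply: K => //; apply/allP=> t /mapP[i _ ->].
apply/rootP; rewrite horner_rs -ptE; apply/PU/H.
rewrite /ball /= sub0r normrN ger0_norm ?divr_ge0 // ?ltW //.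
rewrite ltr_pdivrMr // -[X in X < _]mulr1 ltr_pM2l //.
by rewrite ltr1n.
Qed.

End Evaluation.

(** * Integrals of polynomials over the unit interval *)

Section UnitIntegral.
Context {R : realType}.
Implicit Types (p q : {poly R}).
Local Notation mu := (@lebesgue_measure R).

Lemma integrable_horner p : mu.-integrable [set` `[0, 1]] (EFin \o horner p).
Proof.
apply: continuous_compact_integrable; first exact: segment_compact.
by apply: continuous_subspaceT; exact: continuous_horner.
Qed.

Lemma unit_integralB p q :
  \int[mu]_(t in `[0, 1]) (p.[t] - q.[t]) = \int[mu]_(t in `[0, 1]) p.[t] - \int[mu]_(t in `[0, 1]) q.[t].
Proof. by rewrite RintegralB //; exact: integrable_horner. Qed.

(** A nonnegative function with zero integral vanishes almost everywhere, whereas a nonzero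
    polynomial is nonzero on some interval of positive length. *)
Lemma unit_integral_sqr_eq0 p : \int[mu]_(t in `[0, 1]) (p * p).[t] = 0 -> p = 0.
Proof.
move=> I0; apply/eqP/negPn/negP => pN0.
have intp := integrable_horner (p * p).
have : ae_eq mu [set` `[0, 1]] (EFin \o horner (p * p)) (cst 0%E).
  apply/ae_eq_integral_abs => //; first by case/integrableP: intp.
  have E : (\int[mu]_(t in [set` `[0%R, 1%R]]) (EFin \o horner (p * p)) t = 0)%E.
    by rewrite -[LHS]fineK; [congr EFin|exact: integrable_fin_num].
  rewrite -[RHS]E; apply: eq_integral => t _ /=; congr (_%:E); rewrite ger0_norm //.
  by rewrite hornerM -expr2 sqr_ge0.
case=> B [mB B0 sB].
have [t0 /andP[t00 t01] pt0] : exists2 t : R, 0 < t < 1 & p.[t] != 0.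
  apply: contrapT => H.
  pose r := [seq (i.+2%:R : R)^-1 | i <- iota 0 (size p)].
  have := @max_poly_roots _ p r pN0.
  rewrite /r map_inj_uniq ?iota_uniq ?size_map ?size_iota ?ltnn; last first.
    by move=> i j /invr_inj/eqP; rewrite eqr_nat => /eqP [].
  move=> K; suff: false by []; apply: K => //; apply/allP=> t /mapP[i _ ->].
  apply/negPn/negP => nr; apply: H; exists i.+2%:R^-1 => //.
  by rewrite invr_gt0 ltr0n /= invf_lt1 ?ltr1n.
have : \forall t \near t0, [/\ p.[t] != 0, 0 < t & t < 1].
  have h1 : \forall t \near t0, p.[t] != 0.
    have := @continuous_horner R p t0; move=> /(_ [set y | y != 0]); apply.
    by apply: open_nbhs_nbhs; split => //; exact: open_neq.
  have h2 : \forall t \near t0, 0 < t by exact: lt_nbhsr.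
  have h3 : \forall t \near t0, t < 1 by exact: lt_nbhsl.
  by near=> t; split; near: t.
move=> /nbhs_ballP[d /= d0 Hd].
pose J : set R := [set` `]t0 - d, t0 + d[].
have sub : J `<=` B.
  move=> t; rewrite /J /= in_itv /= => /andP[td dt].
  have [pt tg tl] : [/\ p.[t] != 0, 0 < t & t < 1].
    by apply: Hd; rewrite /ball /= ltr_norml; apply/andP; split; lra.
  apply: sB => /= /(_ _)/eqP; rewrite in_itv /= !ltW // => /(_ isT).
  by rewrite /= eqe hornerM mulf_eq0 (negPf pt).
have : (mu J <= mu B)%E by apply: le_measure => //; rewrite inE //; exact: measurable_itv.
rewrite B0 /J lebesgue_measure_itv /= lte_fin ifT; last by lra.
by rewrite -EFinD lee_fin; lra.
Unshelve. all: by end_near. Qed.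

End UnitIntegral.

Section IterD.
Context {R : realFieldType}.
Implicit Types (P Q : bipoly R) (x v : R * R) (m n s : nat).

Lemma iter_bDB n v P Q : iter n (bD v) (P - Q) = iter n (bD v) P - iter n (bD v) Q.
Proof. by elim: n => //= n ->; rewrite bDB. Qed.

Lemma deg_iter_bD m n v P : deg m P -> deg (m - n) (iter n (bD v) P).
Proof.
by move=> dP; elim: n => [|n IH] /=; [rewrite subn0|rewrite subnS; apply: deg_bD].
Qed.

Lemma vanish_iter_bD s n v P x : vanish s P x -> vanish (s - n) (iter n (bD v) P) x.
Proof.
by move=> dP; elim: n => [|n IH] /=; [rewrite subn0|rewrite subnS; apply: vanish_bD].
Qed.

End IterD.

(** * Edge moments *)

Section EdgeMoments.
Context {R : realType}.
Implicit Types (P Q : bipoly R) (x y w : R * R) (p q : {poly R}) (m n s : nat).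

Lemma edge_length_neq0 x y : x != y -> edge_length x y != 0.
Proof.
move=> /norm2_neq0 xy; rewrite /edge_length sqrtr_eq0 -ltNge lt_neqAle eq_sym xy.
by rewrite addr_ge0 ?sqr_ge0.
Qed.

(** With [rho2 = s - 1] the strict bound [rho2 - n < i] is [s - n <= i]; for [n < s] the truncated
    subtraction is exact. *)
Lemma edge_test_spaceE s m n v : (n < s)%N -> (n <= m)%N ->
  edge_test_space (s%:Z - 1) m%:Z n v <->
  exists c : nat -> nat -> R, forall t, v t = \sum_(i < m.+1) \sum_(j < m.+1 |
    [&& (i + j == m - n)%N, (s - n <= i)%N & (s - n <= j)%N]) c i j * ((1 - t) ^+ i * t ^+ j).
Proof.
move=> ns nm; rewrite /edge_test_space /=; split=> -[c cE]; exists c => t; rewrite cE;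
  by apply: eq_bigr => i _; apply: eq_bigl => j; lia.
Qed.

Lemma edge_test_space_horner s m n p : (n < s)%N -> (n <= m)%N ->
  (size p <= (m - n).+1)%N -> 'X ^+ (s - n) %| p -> ('X - 1%:P) ^+ (s - n) %| p ->
  edge_test_space (s%:Z - 1) m%:Z n (horner p).
Proof.
move=> ns nm sp d0 d1; apply/edge_test_spaceE => //.
apply: (@bernstein_vanish_ind R (s - n) (m - n) (fun p => exists c : nat -> nat -> R, forall t,
  p.[t] = \sum_(i < m.+1) \sum_(j < m.+1 |
    [&& (i + j == m - n)%N, (s - n <= i)%N & (s - n <= j)%N]) c i j * ((1 - t) ^+ i * t ^+ j))) d0 d1 => //.
- exists (fun _ _ => 0) => t; rewrite horner0 big1 // => i _.
  by rewrite big1 // => j _; rewrite mul0r.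
- move=> a b [c cE] [d dE]; exists (fun i j => c i j + d i j) => t.
  rewrite hornerD cE dE -big_split; apply: eq_bigr => i _; rewrite -big_split.
  by apply: eq_bigr => j _; rewrite mulrDl.
- move=> e a [c cE]; exists (fun i j => e * c i j) => t; rewrite hornerZ cE mulr_sumr.
  by apply: eq_bigr => i _; rewrite mulr_sumr; apply: eq_bigr => j _; rewrite mulrA.
- move=> i j ij si sj; exists (fun a b => ((a == i) && (b == j))%:R) => t.
  have ilt : (i < m.+1)%N by lia.
  have jlt : (j < m.+1)%N by lia.
  rewrite (bigD1 (Ordinal ilt)) //= [X in _ = _ + X]big1 => [|a ai]; last first.
    apply: big1 => b _; rewrite (_ : (a == i :> nat) = false) ?mul0r //.
    by apply: contraNF ai => /eqP ai; apply/eqP/val_inj.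
  rewrite addr0 (bigD1 (Ordinal jlt)) /=; last by rewrite ij eqxx si sj.
  rewrite big1 => [|b /andP[_ bj]]; last first.
    rewrite (_ : (b == j :> nat) = false) ?andbF ?mul0r //.
    by apply: contraNF bj => /eqP bj; apply/eqP/val_inj.
  by rewrite !eqxx mul1r addr0 !hornerE.
Qed.

Lemma edge_moment_ev x y n P v : x != y ->
  edge_moment x y n (ev P) v = \int[@lebesgue_measure R]_(t in `[0, 1])
    ((rs x (y.1 - x.1, y.2 - x.2) (iter n (bD (unit_normal x y)) P)).[t] * v t).
Proof.
move=> xy; rewrite /edge_moment /edge_integral mulKf ?edge_length_neq0 //.
by apply: eq_Rintegral => t _; rewrite normal_derivative_ev horner_rs.
Qed.

(* The moments against the restricted jump itself show that its square integrates to zero. *)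
Lemma edge_moments_eq s1 s2 m x y P Q : x != y -> (s1 <= s2)%N -> (s2 <= m.+1)%N ->
  deg m P -> deg m Q -> vanish s2 (P - Q) x -> vanish s2 (P - Q) y ->
  (forall n : nat, n%:Z <= s1%:Z - 1 -> forall v, edge_test_space (s2%:Z - 1) m%:Z n v ->
     edge_moment x y n (ev P) v = edge_moment x y n (ev Q) v) ->
  forall t, vanish s1 (P - Q) (pt x (y.1 - x.1, y.2 - x.2) t).
Proof.
move=> xy s12 s2m dP dQ vx vy mom.
have len0 := edge_length_neq0 xy.
apply: (@vanish_line _ _ _ _ _ (unit_normal x y)).
  rewrite /unit_normal /= /GRing.scale /=.
  have -> : (edge_length x y)^-1 * (y.2 - x.2) * (y.2 - x.2) - (edge_length x y)^-1 * - (y.1 - x.1) * (y.1 - x.1)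
    = (edge_length x y)^-1 * ((y.1 - x.1) ^+ 2 + (y.2 - x.2) ^+ 2) by lra.
  by rewrite mulf_neq0 ?invr_eq0 //; exact: norm2_neq0.
move=> n ns; set w := (_, _); set q := rs _ _ _.
have E : q = rs x w (iter n (bD (unit_normal x y)) P) - rs x w (iter n (bD (unit_normal x y)) Q).
  by rewrite /q iter_bDB rsB.
have x0 : pt x w 0 = x by rewrite /pt !mul0r !addr0 -surjective_pairing.
have y1 : pt x w 1 = y.
  by rewrite /pt /w /= !mul1r ![_ + (_ - _)]addrC !subrK -surjective_pairing.
have tq : edge_test_space (s2%:Z - 1) m%:Z n (horner q).
  apply: edge_test_space_horner; [lia|lia| | |].
  - by apply: size_rs; apply: deg_iter_bD; exact: degB.
  - rewrite -['X]subr0 -polyC0; apply: vanish_dvdp; rewrite x0; exact: vanish_iter_bD.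
  - by apply: vanish_dvdp; rewrite y1; exact: vanish_iter_bD.
have n1 : n%:Z <= s1%:Z - 1 by lia.
have := mom n n1 _ tq; rewrite (edge_moment_ev n P _ xy) (edge_moment_ev n Q _ xy) => momq.
apply: unit_integral_sqr_eq0; rewrite {1}E mulrBl.
under eq_Rintegral do rewrite hornerD hornerN.
rewrite unit_integralB.
under eq_Rintegral do rewrite hornerM.
under [X in _ - X]eq_Rintegral do rewrite hornerM.
by rewrite momq subrr.
Qed.

End EdgeMoments.

(** * Finite element functions as families of polynomials *)

Section Pieces.
Context {R : realType}.
Variables (Omega : set (R * R)) (N : nat) (T : 'I_N -> 'I_3 -> R * R).
Hypothesis nz : forall i, det3 (T i 0) (T i (0 + 1)) (T i (0 + 1 + 1)) != 0.

(* [s1] and [s2] stand for rho_1 + 1 and rho_2 + 1, so that discontinuous functions have s1 = 0. *)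
Definition is_pieces (s1 s2 m : nat) (u : R * R -> R) (P : 'I_N -> bipoly R) : Prop :=
  [/\ forall i, deg m (P i),
      forall i x, interior (triangle (T i)) x -> u x = ev (P i) x,
      forall i j a b, T i a = T j b -> vanish s2 (P i - P j) (T i a) &
      forall i j a b, same_edge T (i, a) (j, b) ->
        forall x, det3 x (T i (a + 1)) (T i (a + 1 + 1)) = 0 -> vanish s1 (P i - P j) x].

Lemma is_edge_same_edge i j x y : is_edge (T i) x y -> is_edge (T j) x y ->
  exists a b, same_edge T (i, a) (j, b) /\
    forall z, det3 z x y = 0 -> det3 z (T i (a + 1)) (T i (a + 1 + 1)) = 0.
Proof.
move=> [a [a' [aa' <- <-]]] [b [b' [bb' bx by_]]].
have [c cE] := ord3_third aa'; have [d dE] := ord3_third bb'.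
exists c, d; split; last first.
  move=> z; case: cE => -[-> ->] // H; rewrite /det3 in H *.
  by rewrite -[RHS]oppr0 -H; lra.
rewrite /same_edge /ends /=; case: cE => -[ca ca']; case: dE => -[db db'];
  rewrite -?ca' -?ca -?db' -?db bx by_ //; exact: (permEl (perm_catC [:: _] [:: _])).
Qed.

(** Moments become vanishing jumps by [edge_moments_eq], fed with the vertex conditions at both
    ends. Conversely, the relevant normal derivatives of a vanishing jump restrict to zero on the
    edge, so moments against any test function agree. *)
Lemma fe_spaceP s1 s2 m (rho1 rho2 k : int) u : rho1 = s1%:Z - 1 -> rho2 = s2%:Z - 1 -> k = m%:Z ->
  (s1 <= s2)%N -> (s2 <= m.+1)%N ->
  fe_space Omega T rho1 rho2 k u <-> in_L2 Omega u /\ exists P, is_pieces s1 s2 m u P.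
Proof.
move=> -> -> -> s12 s2m; split=> -[L2 [p Hp]]; split=> //.
  have [dp up vp ep] := Hp.
  have /choice[P HP] i : exists P, deg m P /\ p i = ev P.
    by have /polynomial_of_degree_leP[P dP pE] := dp i; exists P.
  have vP i j a b : T i a = T j b -> vanish s2 (P i - P j) (T i a).
    move=> ab; apply/vanish_partials => c d cd.
    have [_ pi] := HP i; have [_ pj] := HP j.
    have := vp i j (T i a) (ex_intro _ a erefl) (ex_intro _ b (esym ab)) c d ltac:(lia).
    rewrite pi pj !iter_d1_d2_ev => E.
    suff -> : iter c (@bD1 R) (iter d (@bD2 R) (P i - P j)) =
        iter c (@bD1 R) (iter d (@bD2 R) (P i)) - iter c (@bD1 R) (iter d (@bD2 R) (P j)).
      by rewrite evB E subrr.
    have -> : iter d (@bD2 R) (P i - P j) = iter d (@bD2 R) (P i) - iter d (@bD2 R) (P j).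
      by elim: d {cd E} => //= d ->; rewrite !bD2E bDB.
    by elim: c {cd E} => //= c ->; rewrite !bD1E bDB.
  exists P; split=> //; [by move=> i; case: (HP i)|by move=> i x /up ->; have [_ ->] := HP i|].
  move=> i j a b ab x xa; have ne := edge_neq nz i a.
  have [t ->] := line_pt ne xa.
  have [dPi pi] := HP i; have [dPj pj] := HP j.
  have e1 : is_edge (T i) (T i (a + 1)) (T i (a + 1 + 1)).
    by exists (a + 1), (a + 1 + 1); rewrite eq_sym ord3_neq1.
  have e2 : is_edge (T j) (T i (a + 1)) (T i (a + 1 + 1)).
    case: (same_edgeP ab) => /= -[-> ->].
      by exists (b + 1), (b + 1 + 1); rewrite eq_sym ord3_neq1.
    by exists (b + 1 + 1), (b + 1); rewrite ord3_neq1.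
  apply: (edge_moments_eq ne s12 s2m dPi dPj).
  - by have [c] := same_edge_vertex ab (ord3_neq1 a); apply: vP.
  - by have [c] := same_edge_vertex ab (ord3_neq2 a); apply: vP.
  - by move=> n ns v tv; rewrite -pi -pj; apply: ep.
have [dp up vp ep] := Hp.
exists (fun i => ev (p i)); split=> //.
- by move=> i; apply/polynomial_of_degree_leP; exists (p i).
- move=> i j x [a <-] [b ab] c d cd; rewrite !iter_d1_d2_ev.
  have /vanish_partials/(_ c d ltac:(lia)) := vp i j a b (esym ab).
  have -> : iter d (@bD2 R) (p i - p j) = iter d (@bD2 R) (p i) - iter d (@bD2 R) (p j).
    by elim: d {cd} => //= d ->; rewrite !bD2E bDB.
  have -> : iter c (@bD1 R) (iter d (@bD2 R) (p i) - iter d (@bD2 R) (p j)) =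
      iter c (@bD1 R) (iter d (@bD2 R) (p i)) - iter c (@bD1 R) (iter d (@bD2 R) (p j)).
    by elim: c {cd} => //= c ->; rewrite !bD1E bDB.
  by rewrite evB => /eqP; rewrite subr_eq0 => /eqP.
- move=> i j x y ex ey n ns v tv.
  have [a [b [ab xyab]]] := is_edge_same_edge ex ey.
  have xy : x != y.
    by case: ex => c [d [cd <- <-]]; apply: (vertex_neq nz).
  rewrite (edge_moment_ev n (p i) v xy) (edge_moment_ev n (p j) v xy); apply: eq_Rintegral => t _; congr (_.[t] * _).
  apply/subr0_eq; rewrite -rsB -iter_bDB.
  apply: (@vanish_iter _ s1); first lia.
  by move=> r; apply: ep ab _ _; apply: xyab; exact: det3_pt.
Qed.

End Pieces.

(** * Almost everywhere equality on the grid *)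

Section PlaneMeasure.
Context {R : realType}.
Local Notation X := (measurableTypeR R * measurableTypeR R)%type.
Local Notation mu := (@plane_measure R).

Lemma plane_measureX (A B : set (measurableTypeR R)) : measurable A -> measurable B ->
  mu (A `*` B) = (@lebesgue_measure R A * @lebesgue_measure R B)%E.
Proof. by move=> mA mB; exact: product_measure1E. Qed.

Lemma plane_measure_xsection (A : set X) :
  mu A = (\int[@lebesgue_measure R]_x (@lebesgue_measure R \o xsection A) x)%E.
Proof. by []. Qed.

Lemma measurable_ev (P : bipoly R) : measurable_fun [set: X] (ev P : X -> R).
Proof.
elim/bipoly_ind: P => [c|P IH|P IH|P Q IP IQ].
- have -> : ev (bconst c) = cst c by apply/funext => x; rewrite evC.
  exact: measurable_cst.
- have -> : ev (bX * P) = (fun x : X => x.1 * ev P x) by apply/funext => x; rewrite evM evbX.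
  by apply: measurable_funM => //; exact: measurable_fst.
- have -> : ev (bY * P) = (fun x : X => x.2 * ev P x) by apply/funext => x; rewrite evM evbY.
  by apply: measurable_funM => //; exact: measurable_snd.
- have -> : ev (P + Q) = (fun x : X => ev P x + ev Q x) by apply/funext => x; rewrite evD.
  exact: measurable_funD.
Qed.

Lemma negligible_not_ball (A : set X) (x : R * R) (d : R) : mu.-negligible A -> 0 < d ->
  ~ (ball x d `<=` A).
Proof.
move=> [B [mB B0 AB]] d0 xA.
pose J (c : R) : set R := [set` `]c - d, c + d[].
have mJ c : measurable (J c) by exact: measurable_itv.
have sub : J x.1 `*` J x.2 `<=` B.
  move=> y [/=]; rewrite /J /= !in_itv /= => /andP[a1 a2] /andP[b1 b2].
  by apply/AB/xA; split; rewrite /ball /= ltr_norml; apply/andP; split; lra.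
have : (mu (J x.1 `*` J x.2) <= mu B)%E.
  by apply: le_measure => //; rewrite inE //; apply: measurableX; exact: mJ.
have lJ c : @lebesgue_measure R (J c) = (d + d)%:E.
  rewrite /J lebesgue_measure_itv /= lte_fin ifT; last by lra.
  by rewrite -EFinD; congr EFin; lra.
rewrite B0 (_ : mu _ = ((d + d)%:E * (d + d)%:E)%E); last first.
  rewrite (plane_measureX (mJ _) (mJ _)); congr (_ * _)%E; exact: lJ.
rewrite -EFinM lee_fin leNgt => /negP; apply.
by apply: mulr_gt0; lra.
Qed.

(** A vertical line is a point times an axis; any other line has sections reduced to one point, and
    Fubini applies. *)
Lemma line_negligible (p q : R * R) : p != q -> mu.-negligible [set x : X | det3 x p q = 0].
Proof.
move=> pq; set A := [set x : X | _].
pose L : bipoly R := bconst (p.1 * q.2 - p.2 * q.1) + bconst (p.2 - q.2) * bX + bconst (q.1 - p.1) * bY.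
have LE x : ev L x = det3 x p q by rewrite !evE /det3; lra.
have mA : measurable A.
  have -> : A = [set: X] `&` (ev L : X -> R) @^-1` [set 0].
    by rewrite setTI; apply/seteqP; split => x /=; rewrite LE.
  by apply: measurable_ev => //; exact: measurable_set1.
exists A; split => //.
have [q1|q1] := eqVneq (q.1 - p.1) 0.
  have sub : A `<=` [set p.1] `*` [set: measurableTypeR R].
    move=> x; rewrite /A /det3 /= => H; split => //=.
    have : p.2 != q.2.
      apply: contraNneq pq => E; case: p q q1 E {A L LE mA H} => [a b] [c e] /= q1 ->.
      by rewrite (_ : c = a) //; lra.
    rewrite -subr_eq0 => p2; have : (p.1 - x.1) * (p.2 - q.2) = 0.
      by have := congr1 (fun u => u * (p.2 - x.2)) q1; lra.
    by move/eqP; rewrite mulf_eq0 (negPf p2) orbF subr_eq0 => /eqP ->.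
  have m1 : measurable ([set p.1] : set (measurableTypeR R)) by exact: measurable_set1.
  apply/eqP; rewrite -measure_le0.
  apply: le_trans (_ : (mu ([set p.1] `*` [set: measurableTypeR R]) <= _)%E).
    by apply: le_measure => //; rewrite inE //; exact: (measurableX m1 measurableT).
  rewrite (plane_measureX m1 measurableT) [X in (X * _)%E](_ : _ = 0%E) ?mul0e //.
  exact: lebesgue_measure_set1.
rewrite plane_measure_xsection; apply: integral0_eq => x _ /=.
pose y := p.2 + (x - p.1) / (q.1 - p.1) * (q.2 - p.2).
apply/eqP; rewrite -measure_le0 -(lebesgue_measure_set1 y).
apply: le_measure; rewrite ?inE.
- exact: measurable_xsection.
- exact: measurable_set1.
move=> t; rewrite /xsection /= inE /A /det3 /= => H; rewrite /y.
apply: (mulIf q1); rewrite mulrDl mulrAC divfK //; lra.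
Qed.

Lemma bounded_ev (P : bipoly R) (r : R) : exists2 M : R, 0 <= M &
  forall x : R * R, `|x.1| <= r -> `|x.2| <= r -> `|ev P x| <= M.
Proof.
elim/bipoly_ind: P => [c|P [M M0 H]|P [M M0 H]|P Q [M M0 HP] [M' M0' HQ]].
- by exists `|c| => // x _ _; rewrite evC.
- exists (`|r| * M) => [|x x1 x2]; first exact: mulr_ge0.
  rewrite evM evbX normrM; apply: ler_pM => //; last exact: H.
  exact: le_trans (ler_norm r).
- exists (`|r| * M) => [|x x1 x2]; first exact: mulr_ge0.
  rewrite evM evbY normrM; apply: ler_pM => //; last exact: H.
  exact: le_trans (ler_norm r).
- exists (M + M') => [|x x1 x2]; first exact: addr_ge0.
  rewrite evD; apply: le_trans (ler_normD _ _) _.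
  by apply: lerD; [exact: HP|exact: HQ].
Qed.

Lemma bounded_support_Lfun2 (f : X -> R) (r M : R) : measurable_fun [set: X] f ->
  (forall x, `|f x| <= M) -> (forall x : R * R, f x != 0 -> `|x.1| <= r /\ `|x.2| <= r) ->
  f \in Lfun mu 2%:E.
Proof.
move=> mf fM fr.
pose J : set R := [set` `[- r, r]].
have mJ : measurable J by exact: measurable_itv.
pose B : set X := J `*` J.
have mB : measurable B by exact: measurableX.
have muB : (mu B < +oo)%E.
  have lJ : (@lebesgue_measure R J < +oo)%E.
    by rewrite /J lebesgue_measure_itv /=; case: ifP => _; rewrite ?ltry // -EFinD ltry.
  by rewrite (plane_measureX mJ mJ); apply: lte_mul_pinfty => //; rewrite ge0_fin_numE.
rewrite inE; apply/andP; split; rewrite inE //=.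
rewrite /finite_norm unlock /=; apply: poweR_lty.
have M0 : 0 <= M by apply: le_trans (fM (0, 0)).
apply: (@le_lt_trans _ _ (\int[mu]_x ((M `^ 2)%:E * (\1_B x)%:E))%E).
  apply: ge0_le_integral => //.
  - apply: measurableT_comp => //.
    apply: (@measurableT_comp _ _ _ _ _ _ (fun x : R => x `^ 2)) => //.
    by apply: measurableT_comp => //.
  - apply: emeasurable_funM => //.
    exact/measurable_EFinP/measurable_indic.
  move=> x _; rewrite /= ?poweR_EFin -EFinM lee_fin indicE.
  have [xB|xB] := boolP (x \in B).
    by rewrite mulr1; apply: ge0_ler_powR => //; rewrite nnegrE.
  rewrite mulr0 (_ : f x = 0) ?normr0 ?powR0 //.
  apply/eqP/negPn/negP => /fr[x1 x2]; move/negP: xB; apply; rewrite inE.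
  by split; rewrite /J /= in_itv /= -ler_norml.
rewrite ge0_integralZl_EFin //; last 2 first.
  exact/measurable_EFinP/measurable_indic.
  exact: powR_ge0.
rewrite integral_indic // setIT; apply: lte_mul_pinfty => //.
by rewrite lee_fin powR_ge0.
Qed.

End PlaneMeasure.

(** * Geometry of a triangle *)

Section Triangle.
Context {R : realType}.
Implicit Types (x y w p q : R * R).

Lemma fst_sum (I : Type) (r : seq I) (F : I -> R * R) : (\sum_(i <- r) F i).1 = \sum_(i <- r) (F i).1.
Proof. by elim/big_rec2: _ => // i u v _ <-. Qed.

Lemma snd_sum (I : Type) (r : seq I) (F : I -> R * R) : (\sum_(i <- r) F i).2 = \sum_(i <- r) (F i).2.
Proof. by elim/big_rec2: _ => // i u v _ <-. Qed.

Lemma nondegenerate_det3 (z : 'I_3 -> R * R) : Defs.nondegenerate z -> det3 (z 0) (z (0 + 1)) (z (0 + 1 + 1)) != 0.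
Proof.
rewrite /Defs.nondegenerate /=.
have -> : inord 0 = 0 :> 'I_3 by apply: val_inj; rewrite /= inordK.
have -> : inord 1 = 0 + 1 :> 'I_3 by apply: val_inj; rewrite /= inordK.
by have -> : inord 2 = 0 + 1 + 1 :> 'I_3 by apply: val_inj; rewrite /= inordK.
Qed.

Variable z : 'I_3 -> R * R.
Hypothesis nz : det3 (z 0) (z (0 + 1)) (z (0 + 1 + 1)) != 0.
Local Notation lam := (bary z).

Lemma bary_affine (a : 'I_3) x y t : ev (lam a) (x + t *: (y - x)) = ev (lam a) x + t * (ev (lam a) y - ev (lam a) x).
Proof. by rewrite !ev_bary ptE /det3 /pt /=; lra. Qed.

Lemma sum_ev_bary x : \sum_a ev (lam a) x = 1.
Proof. by rewrite -ev_sum (sum_bary nz) ev1. Qed.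

Lemma triangleP x : triangle z x <-> forall a, 0 <= ev (lam a) x.
Proof.
split=> [[l [l0 l1 ->]] a|H].
  suff -> : ev (lam a) (\sum_a l a *: z a) = l a by [].
  rewrite ev_bary; apply: (canLR (mulfK (det3_neq0 nz a))).
  rewrite /det3 fst_sum snd_sum /= !(sum3 _ a) /=.
  have -> : l a = 1 - l (a + 1) - l (a + 1 + 1) by rewrite -l1 (sum3 _ a); lra.
  by rewrite /GRing.scale /=; lra.
exists (fun a => ev (lam a) x); split => //; first exact: sum_ev_bary.
apply/eqP; rewrite -pair_eqE /pair_eq /= fst_sum snd_sum /=; apply/andP; split; apply/eqP.
  rewrite -{1}(evbX x) (bX_bary nz) ev_sum; apply: eq_bigr => a _.
  by rewrite evM evC mulrC.
rewrite -{1}(evbY x) (bY_bary nz) ev_sum; apply: eq_bigr => a _.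
by rewrite evM evC mulrC.
Qed.

Lemma triangle_vertex a : triangle z (z a).
Proof. by apply/triangleP => b; rewrite bary_vertex // ler0n. Qed.

Lemma triangle_convex : segment_convex (triangle z).
Proof.
move=> x y t /triangleP tx /triangleP ty; rewrite in_itv /= => /andP[t0 t1].
apply/triangleP => a; rewrite bary_affine; have := tx a; have := ty a.
move: (ev _ x) (ev _ y) => u v v0 u0.
have -> : u + t * (v - u) = (1 - t) * u + t * v by lra.
by rewrite addr_ge0 // mulr_ge0 // subr_ge0.
Qed.

Lemma ev_continuous (P : bipoly R) : continuous (ev P : R * R -> R).
Proof.
elim/bipoly_ind: P => [c|P IH|P IH|P Q IP IQ] x.
- have -> : ev (bconst c) = cst c :> (R * R -> R) by apply/funext => y; rewrite evC.
  exact: cvg_cst.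
- have -> : ev (bX * P) = (fun x : R * R => x.1 * ev P x) by apply/funext => y; rewrite evM evbX.
  by apply: cvgM; [exact: cvg_fst|exact: IH].
- have -> : ev (bY * P) = (fun x : R * R => x.2 * ev P x) by apply/funext => y; rewrite evM evbY.
  by apply: cvgM; [exact: cvg_snd|exact: IH].
- have -> : ev (P + Q) = (fun x : R * R => ev P x + ev Q x) by apply/funext => y; rewrite evD.
  by apply: cvgD; [exact: IP|exact: IQ].
Qed.

Lemma triangle_closed : closed (triangle z).
Proof.
have -> : triangle z = \bigcap_(a in [set: 'I_3]) [set x | 0 <= ev (lam a) x].
  by apply/seteqP; split=> x; [move=> /triangleP H a _; apply: H|move=> H; apply/triangleP => a; apply: H].
apply: closed_bigI => a _.
have -> : [set x | 0 <= ev (lam a) x] = (ev (lam a) : R * R -> R) @^-1` [set y | 0 <= y] by [].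
by apply: closed_comp => [x _|]; [exact: ev_continuous|exact: closed_ge].
Qed.

Lemma inside_interior x : (forall a, 0 < ev (lam a) x) -> interior (triangle z) x.
Proof.
move=> H; have : nbhs x [set y | forall a, 0 < ev (lam a) y].
  have Ha a : \forall y \near x, 0 < ev (lam a) y.
    have := @ev_continuous (lam a) x; move=> /(_ [set t | 0 < t]); apply.
    by apply: open_nbhs_nbhs; split; [exact: open_gt|exact: H].
  exact: (@filter_forall _ _ (fun a y => 0 < ev (lam a) y) _ (nbhs_filter x) Ha).
apply: filterS => y Hy; apply/triangleP => a; exact: ltW.
Qed.

Lemma triangle_bounded : exists r : R, forall x, triangle z x -> `|x.1| <= r /\ `|x.2| <= r.
Proof.
exists (\sum_a (`|(z a).1| + `|(z a).2|)) => x [l [l0 l1 ->]].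
have lle1 a : l a <= 1 by rewrite -l1 (bigD1 a) //= lerDl sumr_ge0.
rewrite fst_sum snd_sum; split; apply: le_trans (ler_norm_sum _ _ _) _; apply: ler_sum => a _;
  rewrite /= normrM ger0_norm //; apply: le_trans (ler_wpM2r _ (lle1 a)) _ => //; rewrite mul1r ?lerDl ?lerDr //.
Qed.

End Triangle.

(** * Geometry of a conforming grid *)

Section Grid.
Context {R : realType}.
Implicit Types (x y w p q : R * R).
Variables (Omega : set (R * R)) (N : nat) (T : 'I_N -> 'I_3 -> R * R).
Hypothesis grid : conforming_grid Omega T.

Lemma grid_nz i : det3 (T i 0) (T i (0 + 1)) (T i (0 + 1 + 1)) != 0.
Proof. by case: grid => nd _ _; exact: nondegenerate_det3. Qed.

Lemma segment_det3 (x y p q m : R * R) : segment x y p -> segment x y q -> segment x y m -> det3 m p q = 0.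
Proof. by case=> s _ <- [t _ <-] [r _ <-]; rewrite !ptE /det3 /pt /=; lra. Qed.

Lemma triangles_meet i j p : i != j -> triangle (T i) p -> triangle (T j) p ->
  (exists x, [/\ is_vertex (T i) x, is_vertex (T j) x &
      triangle (T i) `&` triangle (T j) = [set x]]) \/
  exists x y, [/\ is_edge (T i) x y, is_edge (T j) x y &
      triangle (T i) `&` triangle (T j) = segment x y].
Proof.
case: grid => _ _ /(_ i j) H ij ip jp; case: (H ij) => [E|?|?]; [|by left|by right].
by have : (set0 : set (R * R)) p by rewrite -E.
Qed.

(** If both third vertices were on the same side, a point slightly off the midpoint of the edge
    would belong to both triangles, while conformity confines their intersection to a vertex or to
    the line of the edge. *)
Lemma grid_opposite i j a b : i != j -> same_edge T (i, a) (j, b) ->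
  det3 (T i a) (T i (a + 1)) (T i (a + 1 + 1)) * det3 (T j b) (T i (a + 1)) (T i (a + 1 + 1)) < 0.
Proof.
move=> ij ab; set p := T i (a + 1); set q := T i (a + 1 + 1).
have pq : p != q by exact: edge_neq grid_nz _ _.
have di : det3 (T i a) p q != 0 by exact: (det3_neq0 (grid_nz i)).
have jE : (p = T j (b + 1) /\ q = T j (b + 1 + 1)) \/ (p = T j (b + 1 + 1) /\ q = T j (b + 1)).
  exact: (same_edgeP ab).
have dj : det3 (T j b) p q != 0.
  have := det3_neq0 (grid_nz j) b; case: jE => -[-> ->] //; apply: contraNneq => H.
  by apply/eqP; rewrite /det3 in H *; lra.
have lamb x : ev (bary (T j) b) x = det3 x p q / det3 (T j b) p q.
  rewrite ev_bary; case: jE => -[-> ->] //.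
  have opp y u v : det3 y u v = - det3 y v u by rewrite /det3; lra.
  by rewrite opp [det3 (T j b) _ _]opp invrN mulrNN.
have ip : triangle (T i) p by apply: triangle_vertex; exact: grid_nz.
have iq : triangle (T i) q by apply: triangle_vertex; exact: grid_nz.
have [jp jq] : triangle (T j) p /\ triangle (T j) q.
  by case: jE => -[-> ->]; split; apply: triangle_vertex; exact: grid_nz.
rewrite ltNge; apply/negP => dd.
pose mid := p + (2^-1 : R) *: (q - p).
have imid : triangle (T i) mid.
  by apply: triangle_convex; rewrite ?in_itv /=; [exact: grid_nz| | |lra].
(* With [e = 1 / (1 + 2 S)] the shift changes each coordinate that is 1/2 at the midpoint by at most
   [e S < 1/2], so it stays positive. *)
pose S := \sum_c `|ev (bary (T j) c) (T i a) - 2^-1|.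
have S0 : 0 <= S by apply: sumr_ge0.
pose e : R := (1 + 2 * S)^-1.
have e0 : 0 < e by rewrite invr_gt0; lra.
have e1 : e <= 1 by rewrite invf_le1; lra.
have eS : e * (1 + 2 * S) = 1 by rewrite mulVf // gt_eqF //; lra.
pose m := mid + e *: (T i a - mid).
have im : triangle (T i) m.
  apply: triangle_convex => //; first exact: grid_nz.
    by apply: triangle_vertex; exact: grid_nz.
  by rewrite in_itv /= e1 ltW.
have jm : triangle (T j) m.
  apply/(triangleP (grid_nz j)) => c; rewrite bary_affine.
  have [->|cb] := eqVneq c b.
    have -> : ev (bary (T j) b) mid = 0.
      by rewrite lamb /mid ptE /det3 /pt /=; apply/eqP; rewrite mulf_eq0; apply/orP; left; apply/eqP; lra.
    rewrite add0r subr0 lamb mulr_ge0 ?(ltW e0) //.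
    have -> : det3 (T i a) p q / det3 (T j b) p q = det3 (T i a) p q * det3 (T j b) p q / det3 (T j b) p q ^+ 2.
      by rewrite expr2 invfM mulrA mulfK.
    by rewrite divr_ge0 // sqr_ge0.
  have -> : ev (bary (T j) c) mid = 2^-1.
    have b1 := bary_vertex (grid_nz j) c (b + 1); have b2 := bary_vertex (grid_nz j) c (b + 1 + 1).
    have f2 : (b + 1 + 1 == b + 1) = false by apply: negbTE; exact: ord3_neq1.
    have f1 : (b + 1 == b + 1 + 1) = false by rewrite eq_sym.
    by rewrite /mid bary_affine; case: jE => -[-> ->]; rewrite b1 b2;
      case/ord3_neq: cb => ->; rewrite ?eqxx ?f1 ?f2 /=; lra.
  have cS : `|ev (bary (T j) c) (T i a) - 2^-1| <= S.
    by rewrite /S (bigD1 c) //= lerDl sumr_ge0.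
  have h1 : e * `|ev (bary (T j) c) (T i a) - 2^-1| <= e * S by rewrite ler_wpM2l // ltW.
  have := ler_norm (- (e * (ev (bary (T j) c) (T i a) - 2^-1))).
  rewrite normrN normrM (gtr0_norm e0); lra.
have : det3 m p q = e * det3 (T i a) p q by rewrite /m /mid !ptE /det3 /pt /=; lra.
have [[x [_ _ E]]|[x [y [_ _ E]]]] := triangles_meet ij ip jp.
  have Ep : [set x] p by rewrite -E.
  have Eq : [set x] q by rewrite -E.
  by move: pq; rewrite Ep Eq eqxx.
rewrite (@segment_det3 x y); [|by rewrite -E..].
by move/esym/eqP; rewrite mulf_eq0 (negPf di) gt_eqF.
Qed.

(** The intersection of the interiors is open but lies in a point or on a line, so some nonzero
    affine polynomial would vanish on a nonempty open set. *)
Lemma interiors_disjoint i j x : i != j -> interior (triangle (T i)) x ->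
  interior (triangle (T j)) x -> False.
Proof.
move=> ij ix jx.
have ip := interior_subset ix; have jp := interior_subset jx.
have oU : open (interior (triangle (T i)) `&` interior (triangle (T j))).
  by apply: openI; exact: open_interior.
have [[y [_ _ E]]|[y [y' [yi _ E]]]] := triangles_meet ij ip jp.
  have H : bX - bconst x.1 = 0 :> bipoly R.
    apply: (vanish_locally_zero oU); first by exists x.
    move=> w [/interior_subset wi /interior_subset wj].
    have -> : w = y by have : [set y] w by rewrite -E.
    have -> : x = y by have : [set y] x by rewrite -E.
    by rewrite !evE subrr.
  by have := congr1 (fun P => ev P (x.1 + 1, 0)) H; rewrite !evE /=; lra.
have yy' : y != y'.
  by case: yi => c [d [cd <- <-]]; apply: vertex_neq => //; exact: grid_nz.
pose L : bipoly R := bconst (y.1 * y'.2 - y.2 * y'.1) + bconst (y.2 - y'.2) * bX + bconst (y'.1 - y.1) * bY.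
have LE w : ev L w = det3 w y y' by rewrite !evE /det3; lra.
have L0 : L = 0.
  apply: (vanish_locally_zero oU); first by exists x.
  move=> w [/interior_subset wi /interior_subset wj]; rewrite LE.
  apply: (@segment_det3 y y').
  - by exists 0; [rewrite /= in_itv /= lexx ler01|rewrite scale0r addr0].
  - by exists 1; [rewrite /= in_itv /= lexx ler01|rewrite scale1r addrC subrK].
  - by rewrite -E.
have /negP := yy'; apply.
have l1 := congr1 (fun P => ev P (0, 0)) L0; have l2 := congr1 (fun P => ev P (1, 0)) L0.
have l3 := congr1 (fun P => ev P (0, 1)) L0; rewrite /= /L !evE /= in l1 l2 l3.
rewrite -pair_eqE /pair_eq /=; apply/andP; split; apply/eqP; lra.
Qed.

Lemma closure_triangle x : closure Omega x -> exists i, triangle (T i) x.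
Proof. by case: grid => _ -> _ [i _ ?]; exists i. Qed.

(** The full lines through the edges rather than the edges themselves: still a null set, with a
    simpler description. *)
Definition skeleton : set (R * R) := \bigcup_(e in [set: 'I_N * 'I_3]) [set x | ev (bary (T e.1) e.2) x = 0].

Lemma not_skeleton_interior x : closure Omega x -> ~ skeleton x -> exists i, interior (triangle (T i)) x.
Proof.
move=> /closure_triangle[i ix] nS; exists i; apply: inside_interior; first exact: grid_nz.
move=> a; rewrite lt_neqAle (triangleP (grid_nz i) x).1 // andbT eq_sym.
by apply/eqP => xa; apply: nS; exists (i, a).
Qed.

Lemma skeleton_negligible : (@plane_measure R).-negligible skeleton.
Proof.
have H (e : 'I_N * 'I_3) : (@plane_measure R).-negligible [set x | ev (bary (T e.1) e.2) x = 0].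
  have -> : [set x | ev (bary (T e.1) e.2) x = 0] = [set x | det3 x (T e.1 (e.2 + 1)) (T e.1 (e.2 + 1 + 1)) = 0].
    by apply/seteqP; split=> x /=; [move/(bary_line grid_nz)|move=> ?; apply/(bary_line grid_nz)].
  by apply: line_negligible; exact: edge_neq grid_nz _ _.
have Hae (e : 'I_N * 'I_3) : \forall x \ae @plane_measure R, ev (bary (T e.1) e.2) x <> 0.
  by apply: negligibleS (H e) => x /= /contrapT.
have all_ae : \forall x \ae @plane_measure R, forall e : 'I_N * 'I_3, ev (bary (T e.1) e.2) x <> 0.
  by apply: (@filter_forall (measurableTypeR R * measurableTypeR R)%type ('I_N * 'I_3)%type
    (fun e x => ev (bary (T e.1) e.2) x <> 0) (almost_everywhere (@plane_measure R))).
by apply: negligibleS all_ae => x [e _ /= xe] /(_ e).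
Qed.

Lemma ae_eq_interior (V : Type) (f g : R * R -> V) :
  (forall i x, Omega x -> interior (triangle (T i)) x -> f x = g x) -> eq_L2 Omega f g.
Proof.
move=> H; apply: negligibleS skeleton_negligible => x /not_implyP[Ox nf].
apply: contrapT => nS; have [i ix] := not_skeleton_interior (subset_closure Ox) nS.
exact/nf/H/ix.
Qed.

(* An almost everywhere identity of polynomials on a triangle holds at every point,
   since Omega meets the interior of the triangle in a nonempty open set. *)
Lemma ae_triangle_eq0 i (P : bipoly R) : open Omega ->
  (\forall x \ae @plane_measure R, Omega x -> interior (triangle (T i)) x -> ev P x = 0) -> P = 0.
Proof.
move=> oO ae0.
pose U := Omega `&` interior (triangle (T i)).
have oU : open U by apply: openI => //; exact: open_interior.
apply: (vanish_locally_zero oU).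
  pose c : R * R := \sum_a (3^-1 : R) *: T i a.
  have ic : interior (triangle (T i)) c.
    apply: inside_interior; first exact: grid_nz.
    move=> a; suff -> : ev (bary (T i) a) c = 3^-1 by rewrite invr_gt0.
    rewrite ev_bary; apply: (canLR (mulfK (det3_neq0 (grid_nz i) a))).
    rewrite /c /det3 fst_sum snd_sum !(sum3 _ a) /= /GRing.scale /=; lra.
  have cc : closure Omega c by case: grid => _ -> _; exists i => //; exact: interior_subset ic.
  have [w [Ow iw]] := cc (interior (triangle (T i))) ltac:(by apply: open_nbhs_nbhs; split => //; exact: open_interior).
  by exists w; split.
move=> x Ux; apply/eqP/negPn/negP => xN0.
have : \forall y \near x, U y /\ ev P y != 0.
  apply: filterI; first exact: open_nbhs_nbhs.
  have := @ev_continuous R P x; move=> /(_ [set t | t != 0]); apply.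
  by apply: open_nbhs_nbhs; split => //; exact: open_neq.
move=> /nbhs_ballP[d /= d0 Hd].
apply: (@negligible_not_ball _ _ x d ae0 d0) => y xy /= H.
have [[Oy iy] /eqP] := Hd y xy; apply; exact: H.
Qed.

(** The values of [u] on the edges are arbitrary, so [u] is replaced by [f], which is zero off the
    open triangles and hence measurable, bounded and of bounded support. *)
Lemma piecewise_in_L2 (u : R * R -> R) (P : 'I_N -> bipoly R) :
  (forall i x, interior (triangle (T i)) x -> u x = ev (P i) x) -> in_L2 Omega u.
Proof.
move=> uP.
pose I i : set (R * R) := [set x | forall a, 0 < ev (bary (T i) a) x].
have Ii i x : I i x -> interior (triangle (T i)) x by move=> Ix; apply: inside_interior => //; exact: grid_nz.
pose f x : R := \sum_i (\1_(I i) x : R) * ev (P i) x.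
have mI i : measurable (I i : set (measurableTypeR R * measurableTypeR R)).
  have -> : I i = \bigcap_(a in [set: 'I_3]) [set x | 0 < ev (bary (T i) a) x].
    by apply/seteqP; split=> x; [move=> H a _; apply: H|move=> H a; apply: H].
  apply: fin_bigcap_measurable => [|a _]; first exact: finite_finset.
  have := measurable_ev (bary (T i) a) measurableT (measurable_itv `]0, +oo[).
  rewrite setTI; congr measurable; apply/seteqP; split => x /=; by rewrite in_itv /= andbT.
have fE i x : I i x -> f x = ev (P i) x.
  move=> Ix; rewrite /f (bigD1 i) //= [X in _ + X]big1 => [|j ji].
    by rewrite indicE (mem_set Ix) mul1r addr0.
  rewrite indicE memNset ?mul0r // => Jx.
  exact: (interiors_disjoint ji (Ii _ _ Jx) (Ii _ _ Ix)).
have f0 x : f x != 0 -> exists2 i, I i x & f x = ev (P i) x.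
  move=> fx; have [[i Ix]|nI] := pselect (exists i, I i x); first by exists i => //; exact: fE.
  move/eqP: fx; case; rewrite /f big1 // => i _.
  by rewrite indicE memNset ?mul0r // => Ix; apply: nI; exists i.
have /fin_all_exists[r Hr] i := triangle_bounded (T i).
have /fin_all_exists2[M M0 HM] i := bounded_ev (P i) (r i).
have tI i x : I i x -> triangle (T i) x by move=> /Ii/interior_subset.
exists f; last first.
  apply: negligibleS skeleton_negligible => x /not_implyP[Ox nf].
  apply: contrapT => nS; apply: nf.
  have [i ix] := closure_triangle (subset_closure Ox).
  have Ix : I i x.
    move=> a; rewrite lt_neqAle (triangleP (grid_nz i) x).1 // andbT eq_sym.
    by apply/eqP => xa; apply: nS; exists (i, a).
  by rewrite (fE i) //; apply: uP; exact: Ii.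
apply: (@bounded_support_Lfun2 _ f (\sum_i `|r i|) (\sum_i M i)).
- rewrite /f; apply: measurable_sum => i; apply: measurable_funM; last exact: measurable_ev.
  exact: measurable_indic.
- move=> x; have [->|/f0[i Ix ->]] := eqVneq (f x) 0; first by rewrite normr0 sumr_ge0.
  have [x1 x2] := Hr i x (tI _ _ Ix).
  apply: le_trans (HM i x x1 x2) _; rewrite (bigD1 i) //= lerDl sumr_ge0 //.
- move=> x /f0[i Ix _]; have [x1 x2] := Hr i x (tI _ _ Ix).
  have : r i <= \sum_j `|r j|.
    by apply: le_trans (ler_norm _) _; rewrite [leRHS](bigD1 i) //= lerDl sumr_ge0.
  by move=> ri; split; apply: le_trans ri.
Qed.

End Grid.

(** * Exactness *)

Section DeRham.
Context {R : realType}.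
Implicit Types (x y w : R * R) (P Q F G : bipoly R).

Lemma derive_interior (U : set (R * R)) (u : R * R -> R) P w x :
  (forall y, interior U y -> u y = ev P y) -> interior U x -> 'D_w u x = ev (bD w P) x.
Proof.
move=> uP Ux; have [_ <-] := is_derive_ev P x w.
apply: near_eq_derive; have : nbhs x (interior U) by apply: open_nbhs_nbhs; split => //; exact: open_interior.
by apply: filterS => y /uP.
Qed.

Lemma bD_eq0_const P : bD1 P = 0 -> bD2 P = 0 -> P = bconst (ev P (0, 0)).
Proof.
move=> D1 D2; apply: ev_inj => x; rewrite evC.
have E : rs (0, 0) x P = (rs (0, 0) x P).[0]%:P.
  by apply: deriv_eq0; rewrite deriv_rs bDE D1 D2 !mulr0 addr0 -bconst0 rsC.
have := congr1 (fun p => p.[1]) E; rewrite hornerC !horner_rs /pt /= !add0r !mul1r !mul0r.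
by rewrite -surjective_pairing.
Qed.

Lemma line_constant P (p q : R * R) :
  (forall x, det3 x p q = 0 -> ev (bD1 P) x = 0 /\ ev (bD2 P) x = 0) ->
  forall s t, ev P (pt p (q.1 - p.1, q.2 - p.2) s) = ev P (pt p (q.1 - p.1, q.2 - p.2) t).
Proof.
move=> H s t; rewrite -!horner_rs [rs _ _ _]deriv_eq0 ?hornerC //.
apply: poly_eq0_inf => r; rewrite deriv_rs horner_rs bDE !evE.
by have [-> ->] := H _ (det3_pt p q r); rewrite !mulr0 addr0.
Qed.

Variables (Omega : set (R * R)) (N : nat) (T : 'I_N -> 'I_3 -> R * R).
Hypothesis polyO : polygonal_domain Omega.
Hypothesis grid : conforming_grid Omega T.

Let openO : open Omega. Proof. by case: polyO. Qed.
Let coverT : closure Omega = \bigcup_(i in [set: 'I_N]) triangle (T i). Proof. by case: grid. Qed.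
Let nz := grid_nz grid.
Let closedT i : closed (triangle (T i)). Proof. exact/triangle_closed/nz. Qed.

Lemma piecewise_exists (P : 'I_N -> bipoly R) :
  exists u : R * R -> R, forall i x, interior (triangle (T i)) x -> u x = ev (P i) x.
Proof.
exists (fun x => if [pick i | `[< interior (triangle (T i)) x >]] is Some i then ev (P i) x else 0).
move=> i x ix; case: pickP => [j /asboolP jx|/(_ i)]; last by rewrite asboolT.
have [->//|ji] := eqVneq j i.
by case: (interiors_disjoint grid ji jx ix).
Qed.

(** Two triangles meet in a vertex, where nothing is claimed, or along an edge, where the gradient
    of [F i - F j] vanishes. *)
Lemma grid_cocycle (F : 'I_N -> bipoly R) :
  (forall i j a b, same_edge T (i, a) (j, b) -> forall x, det3 x (T i (a + 1)) (T i (a + 1 + 1)) = 0 ->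
     ev (bD1 (F i - F j)) x = 0 /\ ev (bD2 (F i - F j)) x = 0) ->
  forall i j x y, triangle (T i) x -> triangle (T i) y -> triangle (T j) x -> triangle (T j) y ->
  ev (F i) y - ev (F i) x = ev (F j) y - ev (F j) x.
Proof.
move=> HF i j x y ix iy jx jy; have [->//|ij] := eqVneq i j.
have [[z [_ _ E]]|[p [q [ei ej E]]]] := triangles_meet grid ij ix jx.
  have -> : x = z by have : [set z] x by rewrite -E.
  have -> : y = z by have : [set z] y by rewrite -E.
  by rewrite !subrr.
have [a [b [ab pqab]]] := is_edge_same_edge ei ej.
have C : ev (F i - F j) x = ev (F i - F j) y.
  have : segment p q x by rewrite -E.
  have : segment p q y by rewrite -E.
  move=> [s _ <-] [t _ <-]; rewrite !ptE; apply: line_constant => r rpq.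
  exact: HF ab _ (pqab _ rpq).
by move: C; rewrite !evB; lra.
Qed.

(** Triangles that meet share a vertex, so [c] descends to a locally constant function of the point,
    and Omega is connected. *)
Lemma vertex_constant (c : 'I_N -> R) :
  (forall i j a b, T i a = T j b -> c i = c j) ->
  exists d, forall i x, Omega x -> triangle (T i) x -> c i = d.
Proof.
move=> Hc.
have cE i j x : triangle (T i) x -> triangle (T j) x -> c i = c j.
  move=> ix jx; have [->//|ij] := eqVneq i j.
  have [[z [[a ia] [b jb] _]]|[p [q [[a [_ [_ ia _]]] [b [_ [_ jb _]]] _]]]] := triangles_meet grid ij ix jx;
    by apply: (Hc _ _ a b); rewrite ia jb.
have [[x0 Ox0] _ cO _ _] := polyO.
have [i0 i0x0] := closure_triangle grid (subset_closure Ox0).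
exists (c i0) => i x Ox ix.
(* The set of all values at [y] avoids choosing a triangle there; it is a singleton wherever a
   triangle contains [y]. *)
pose S y := [set d | exists2 j, triangle (T j) y & d = c j].
have SE j y : triangle (T j) y -> S y = [set c j].
  move=> jy; apply/seteqP; split=> [d [l ly ->]|d /= ->]; last by exists j.
  exact: cE ly jy.
have : S x = S x0.
  apply: (connected_locally_constant cO) => // y Oy.
  have [r r0 sr] := in_star_exists closedT y.
  have := nbhsx_ballx y r r0; apply: filterS => z yz Oz.
  have [j jz] := closure_triangle grid (subset_closure Oz).
  by rewrite (SE j z jz) (SE j y (sr j z jz yz)).
rewrite (SE _ _ ix) (SE _ _ i0x0) => E.
by have : [set c i] (c i) by []; rewrite E.
Qed.

Lemma is_pieces_derive s1 s2 m u (P : 'I_N -> bipoly R) w : (0 < m)%N -> is_pieces T s1.+1 s2.+1 m u P ->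
  is_pieces T s1 s2 m.-1 (fun x => 'D_w u x) (fun i => bD w (P i)).
Proof.
move=> m0 [dP uP vP eP]; split=> [i|i x ix|i j a b ab|i j a b ab x xa].
- exact: deg_bD.
- by apply: derive_interior ix => y; apply: uP.
- by rewrite -bDB; apply: vanish_bD (vP _ _ _ _ ab).
- by rewrite -bDB; apply: vanish_bD (eP _ _ _ _ ab x xa).
Qed.

Lemma is_pieces_d1 s1 s2 m u (P : 'I_N -> bipoly R) : (0 < m)%N -> is_pieces T s1.+1 s2.+1 m u P ->
  is_pieces T s1 s2 m.-1 (d1 u) (fun i => bD1 (P i)).
Proof.
move=> m0 /(is_pieces_derive (1, 0) m0).
by rewrite (_ : (fun i => bD _ _) = fun i => bD1 (P i)) //; apply/funext => i; rewrite bD1E.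
Qed.

Lemma is_pieces_d2 s1 s2 m u (P : 'I_N -> bipoly R) : (0 < m)%N -> is_pieces T s1.+1 s2.+1 m u P ->
  is_pieces T s1 s2 m.-1 (d2 u) (fun i => bD2 (P i)).
Proof.
move=> m0 /(is_pieces_derive (0, 1) m0).
by rewrite (_ : (fun i => bD _ _) = fun i => bD2 (P i)) //; apply/funext => i; rewrite bD2E.
Qed.

Lemma is_piecesD s1 s2 m u v (P Q : 'I_N -> bipoly R) : is_pieces T s1 s2 m u P -> is_pieces T s1 s2 m v Q ->
  is_pieces T s1 s2 m (fun x => u x + v x) (fun i => P i + Q i).
Proof.
move=> [dP uP vP eP] [dQ uQ vQ eQ]; split=> [i|i x ix|i j a b ab|i j a b ab x xa].
- exact: degD.
- by rewrite evD (uP i) // (uQ i).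
- by rewrite opprD addrACA; apply: vanishD; [apply: vP ab|apply: vQ ab].
- by rewrite opprD addrACA; apply: vanishD; [apply: eP ab _ xa|apply: eQ ab _ xa].
Qed.

Lemma is_piecesN s1 s2 m u (P : 'I_N -> bipoly R) : is_pieces T s1 s2 m u P ->
  is_pieces T s1 s2 m (fun x => - u x) (fun i => - P i).
Proof.
move=> [dP uP vP eP]; split=> [i|i x ix|i j a b ab|i j a b ab x xa].
- exact: degN.
- by rewrite evN (uP i).
- by rewrite -opprD; apply/vanishN/(vP _ _ _ _ ab).
- by rewrite -opprD; apply/vanishN/(eP _ _ _ _ ab x xa).
Qed.

Lemma is_pieces_ae_eq0 s1 s2 m u (P : 'I_N -> bipoly R) : is_pieces T s1 s2 m u P ->
  eq_L2 Omega u (cst 0) -> forall i, P i = 0.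
Proof.
move=> [_ uP _ _] ae0 i; apply: (ae_triangle_eq0 grid (i := i) openO).
by apply: filterS ae0 => x Hx Ox ix; rewrite -(uP i) // Hx.
Qed.

Lemma curl_interior m s1 s2 phi (P : 'I_N -> bipoly R) : is_pieces T s1 s2 m phi P ->
  forall i x, interior (triangle (T i)) x -> curl phi x = (ev (bD2 (P i)) x, ev (- bD1 (P i)) x).
Proof.
move=> [_ uP _ _] i x ix; rewrite /curl /d1 /d2 evN bD1E bD2E.
by rewrite !(derive_interior _ (fun y => @uP i y) ix).
Qed.

Lemma div_interior m s1 s2 v (P Q : 'I_N -> bipoly R) :
  is_pieces T s1 s2 m (fst \o v) P -> is_pieces T s1 s2 m (snd \o v) Q ->
  forall i x, interior (triangle (T i)) x -> div v x = ev (bD1 (P i) + bD2 (Q i)) x.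
Proof.
move=> [_ uP _ _] [_ uQ _ _] i x ix; rewrite /div /d1 /d2 evD bD1E bD2E.
by rewrite (derive_interior _ (fun y => @uP i y) ix) (derive_interior _ (fun y => @uQ i y) ix).
Qed.

Hypothesis scO : simply_connected Omega.

Lemma divfree_potential s1 s2 m (P Q : 'I_N -> bipoly R) u v : (0 < s1)%N ->
  is_pieces T s1 s2 m u P -> is_pieces T s1 s2 m v Q -> (forall i, bD1 (P i) + bD2 (Q i) = 0) ->
  exists phi (F : 'I_N -> bipoly R), is_pieces T s1.+1 s2.+1 m.+1 phi F /\ forall i, bD2 (F i) = P i /\ - bD1 (F i) = Q i.
Proof.
move=> s1_gt0 [dP uP vP eP] [dQ uQ vQ eQ] div0.
have /fin_all_exists[F HF] i := divfree_curl (dP i) (dQ i) (div0 i).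
have D1 i j : bD1 (F i - F j) = Q j - Q i.
  by case: (HF i) => _ _ <-; case: (HF j) => _ _ <-; rewrite bD1E bDB -!bD1E opprK addrC.
have D2 i j : bD2 (F i - F j) = P i - P j.
  by case: (HF i) => _ <- _; case: (HF j) => _ <- _; rewrite bD2E bDB -!bD2E.
have ev0_vanish A x : vanish s1 A x -> ev A x = 0.
  by move=> /(vanish_leq s1_gt0)[].
have D0 i j a b : same_edge T (i, a) (j, b) -> forall x, det3 x (T i (a + 1)) (T i (a + 1 + 1)) = 0 ->
    ev (bD1 (F i - F j)) x = 0 /\ ev (bD2 (F i - F j)) x = 0.
  move=> ab x xa; rewrite D1 D2; split; apply: ev0_vanish; last exact: eP ab _ xa.
  by apply/vanish_sym; exact: eQ ab _ xa.
have [e He] := cocycle_potential closedT (fun i => triangle_convex (nz i)) coverT (grid_cocycle D0) polyO scO.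
(* On the triangle i, [e - ev (F i)] is constant, so matching [e] at one vertex matches it at all
   three. *)
pose G i := F i + bconst (e (T i 0) - ev (F i) (T i 0)).
have Gv i a : ev (G i) (T i a) = e (T i a).
  have := He i (T i 0) (T i a) (triangle_vertex (nz i) 0) (triangle_vertex (nz i) a).
  by rewrite /G evD evC; lra.
have GF i j : G i - G j = F i - F j + bconst (e (T i 0) - ev (F i) (T i 0) - (e (T j 0) - ev (F j) (T j 0))).
  by rewrite /G [bconst (_ - _ - _)]bconstD [bconst (- _)]bconstN opprD addrACA.
have G1 i j : bD1 (G i - G j) = Q j - Q i by rewrite GF bD1E bDD bDC addr0 -bD1E.
have G2 i j : bD2 (G i - G j) = P i - P j by rewrite GF bD2E bDD bDC addr0 -bD2E.
have e12 : (1 : R) * 1 - 0 * 0 != 0 by rewrite mulr1 mulr0 subr0 oner_eq0.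
have vG i j s x : ev (G i - G j) x = 0 -> vanish s (P i - P j) x -> vanish s (Q i - Q j) x ->
    vanish s.+1 (G i - G j) x.
  move=> G0 vp vq; apply/(@vanishS R s (G i - G j) x (1, 0) (0, 1) e12).
  by rewrite -bD1E -bD2E G1 G2; split => //; apply/vanish_sym.
have [phi Hphi] := piecewise_exists G.
exists phi, G; split; first split.
- by move=> i; apply: degD; [case: (HF i)|exact: degC].
- by [].
- move=> i j a b ab; apply: vG; [|exact: vP ab|exact: vQ ab].
  by rewrite evB Gv {2}ab Gv ab subrr.
- move=> i j a b ab x xa; apply: vG; [|exact: eP ab _ xa|exact: eQ ab _ xa].
  have [t ->] := line_pt (edge_neq nz i a) xa.
  (* The jump is constant along the edge, and [t = 0] is a common vertex, where it is zero. *)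
  rewrite (@line_constant _ _ _ _ t 0); last first.
    by move=> y ya; rewrite G1 G2 -D1 -D2; exact: D0 ab _ ya.
  have -> (p q : R * R) : pt p q 0 = p by rewrite /pt !mul0r !addr0 -surjective_pairing.
  have [d abd] := same_edge_vertex ab (ord3_neq1 a).
  by rewrite evB Gv {2}abd Gv abd subrr.
- move=> i; rewrite /G bD1E bD2E !bDD !bDC !addr0 -bD1E -bD2E.
  by case: (HF i) => _ -> ->.
Qed.

End DeRham.

Theorem proposition6p1 (R : realType) (Omega : set (R * R)) (N : nat)
    (T : 'I_N -> 'I_3 -> R * R) (r1 r2 k : int)
    (hOmega : polygonal_domain Omega)
    (hT : conforming_grid Omega T)
    (hr1 : 1 <= r1) (hr2 : 2 * r1 <= r2) (hk : 2 * r2 + 1 <= k)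
    (hsc : simply_connected Omega) :
  let V := fe_space Omega T r1 r2 k in
  let W := fe_space2 Omega T (r1 - 1) (r2 - 1) (k - 1) in
  let Q := fe_space Omega T (r1 - 2) (r2 - 2) (k - 2) in
  curl_div_complex Omega V W Q /\ curl_div_exact Omega V W Q.
Proof.
move=> V W Q; have nz := grid_nz hT.
(* With [r1 = n1 + 1], [r2 = n2 + 1], [k = m + 2], the orders rho + 1 of the three spaces are
   [n + 2], [n + 1], [n] for n = [n1], [n2]: no subtraction remains, and [n1 = 0] is the
   discontinuous case of [Q]. *)
have [n1 [n2 [m [r1E r2E kE]]]] : exists n1 n2 m : nat, [/\ r1 = n1.+1%:Z, r2 = n2.+1%:Z & k = m.+2%:Z].
  by exists (absz (r1 - 1)), (absz (r2 - 1)), (absz (k - 2)); split; lia.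
have n12 : (n1.+1.*2 <= n2.+1)%N by lia.
have n2m : (n2.+1.*2 < m.+2)%N by lia.
have in_fe s1 s2 l (rho1 rho2 d : int) u P : rho1 = s1%:Z - 1 -> rho2 = s2%:Z - 1 -> d = l%:Z ->
    (s1 <= s2)%N -> (s2 <= l.+1)%N -> is_pieces T s1 s2 l u P -> fe_space Omega T rho1 rho2 d u.
  move=> E1 E2 E3 s12 s2l pP; apply/(fe_spaceP Omega nz u E1 E2 E3 s12 s2l); split; last by exists P.
  by apply: (piecewise_in_L2 hT (P := P)); case: pP.
have V_in u P : is_pieces T n1.+2 n2.+2 m.+2 u P -> V u by apply: in_fe; lia.
have W_in u v P P' : is_pieces T n1.+1 n2.+1 m.+1 u P -> is_pieces T n1.+1 n2.+1 m.+1 v P' ->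
    W (fun x => (u x, v x)).
  by move=> pu pv; split; [apply: in_fe pu|apply: in_fe pv]; lia.
have Q_in u P : is_pieces T n1 n2 m u P -> Q u by apply: in_fe; lia.
have V_out u : V u -> exists P, is_pieces T n1.+2 n2.+2 m.+2 u P.
  by case/(@fe_spaceP _ Omega _ T nz n1.+2 n2.+2 m.+2) => //; lia.
have W_out v : W v -> exists P P', is_pieces T n1.+1 n2.+1 m.+1 (fst \o v) P /\
    is_pieces T n1.+1 n2.+1 m.+1 (snd \o v) P'.
  case=> W1 W2; move: W1 => /(@fe_spaceP _ Omega _ T nz n1.+1 n2.+1 m.+1)[]; try lia.
  move=> _ [P HP]; move: W2 => /(@fe_spaceP _ Omega _ T nz n1.+1 n2.+1 m.+1)[]; try lia.
  by move=> _ [P' HP']; exists P, P'.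
have Q_out u : Q u -> exists P, is_pieces T n1 n2 m u P.
  by case/(@fe_spaceP _ Omega _ T nz n1 n2 m) => //; lia.
have pieces_cst s1 s2 l (c : R) : is_pieces T s1 s2 l (cst c) (fun=> bconst c).
  split=> [i|i x _|i j a b _|i j a b _ x _]; rewrite ?subrr ?evC //; [exact: degC|exact: vanish0..].
have curl_cst (c : R) : curl (cst c : R * R -> R) = cst 0.
  by apply/funext => x; rewrite /curl /d1 /d2 !derive_cst oppr0.
have V_curl phi P : is_pieces T n1.+2 n2.+2 m.+2 phi P ->
    is_pieces T n1.+1 n2.+1 m.+1 (fst \o curl phi) (fun i => bD2 (P i)) /\
    is_pieces T n1.+1 n2.+1 m.+1 (snd \o curl phi) (fun i => - bD1 (P i)).
  move=> pP; split; first exact: (is_pieces_d2 (ltn0Sn _) pP).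
  exact/is_piecesN/(is_pieces_d1 (ltn0Sn _) pP).
have W_div v P P' : is_pieces T n1.+1 n2.+1 m.+1 (fst \o v) P -> is_pieces T n1.+1 n2.+1 m.+1 (snd \o v) P' ->
    is_pieces T n1 n2 m (div v) (fun i => bD1 (P i) + bD2 (P' i)).
  move=> pP pP'; apply: is_piecesD; first exact: (is_pieces_d1 (ltn0Sn _) pP).
  exact: (is_pieces_d2 (ltn0Sn _) pP').
have div_curl P : bD1 (bD2 P) + bD2 (- bD1 P) = 0 :> bipoly R.
  by rewrite !bD1E !bD2E bDN bDcomm subrr.
have openO : open Omega by case: hOmega.
split; split.
- by move=> c; apply: V_in (pieces_cst _ _ _ c).
- by move=> phi /V_out[P /V_curl[p1 p2]]; apply: W_in p1 p2.
- by move=> v /W_out[P [P' [pP pP']]]; apply: Q_in (W_div _ _ _ pP pP').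
- by move=> c; rewrite curl_cst; apply: (ae_eq_interior hT).
- move=> phi /V_out[P /V_curl[p1 p2]]; apply: (ae_eq_interior hT) => i x _ ix.
  by rewrite (div_interior p1 p2 ix) div_curl ev0.
- move=> c d cd; have [[x Ox] _ _ _ _] := hOmega.
  have [i _] := closure_triangle hT (subset_closure Ox).
  have /(congr1 (fun P => ev P x)) : bconst (c - d) = 0 :> bipoly R.
    apply: (ae_triangle_eq0 hT (i := i) openO).
    by apply: filterS cd => y Hy Oy iy; rewrite evC; have := Hy Oy; rewrite /= => ->; rewrite subrr.
  by rewrite evC ev0 => /subr0_eq.
(* Both partial derivatives of each piece vanish almost everywhere on its triangle, hence
   identically; the resulting constants agree at common vertices. *)
- move=> phi /V_out[P pP]; split=> [ae0|[c aec]].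
    have D i : bD1 (P i) = 0 /\ bD2 (P i) = 0.
      split; apply: (ae_triangle_eq0 hT (i := i) openO); apply: filterS ae0 => x Hx Ox ix;
        have := Hx Ox; rewrite (curl_interior pP ix) => -[E1 E2] //.
      by apply/eqP; rewrite -oppr_eq0 -evN E2.
    have PC i := bD_eq0_const (D i).1 (D i).2.
    have [|c Hc] := vertex_constant hOmega hT (c := fun i => ev (P i) (0, 0)).
      move=> i j a b ab; have [_ _ vP _] := pP; have [] := vP i j a b ab.
      by rewrite evB PC [P j]PC !evC => /subr0_eq.
    exists c; apply: (ae_eq_interior hT) => i x Ox ix.
    by have [_ uP _ _] := pP; rewrite (uP i) // PC evC; exact: Hc Ox (interior_subset ix).
  have PC i : P i = bconst c.
    apply/subr0_eq/(ae_triangle_eq0 hT (i := i) openO); apply: filterS aec => x Hx Ox ix.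
    by have [_ /(_ i x ix) E _ _] := pP; rewrite evB evC -E Hx // subrr.
  apply: (ae_eq_interior hT) => i x _ ix.
  by rewrite (curl_interior pP ix) PC bD1C bD2C evN ev0 oppr0.
- move=> v /W_out[P [P' [pP pP']]]; split=> [ae0|[phi /V_out[F pF] aev]].
    have div0 := is_pieces_ae_eq0 hOmega hT (W_div _ _ _ pP pP') ae0.
    have [phi [F [pF HF]]] := divfree_potential hOmega hT hsc (ltn0Sn n1) pP pP' div0.
    exists phi; first exact: V_in pF.
    apply: (ae_eq_interior hT) => i x _ ix; rewrite (curl_interior pF ix).
    have [-> ->] := HF i; have [_ /(_ i x ix) <- _ _] := pP; have [_ /(_ i x ix) <- _ _] := pP'.
    exact: surjective_pairing.
  have [p1 p2] := V_curl _ _ pF.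
  have E i : P i = bD2 (F i) /\ P' i = - bD1 (F i).
    split; apply/subr0_eq/(ae_triangle_eq0 hT (i := i) openO); apply: filterS aev => x Hx Ox ix;
      have := Hx Ox; rewrite (curl_interior pF ix) evB.
      by have [_ /(_ i x ix) <- _ _] := pP => /= ->; rewrite subrr.
    by have [_ /(_ i x ix) <- _ _] := pP' => /= ->; rewrite subrr.
  apply: (ae_eq_interior hT) => i x _ ix; rewrite (div_interior pP pP' ix).
  by have [-> ->] := E i; rewrite div_curl ev0.
- move=> q /Q_out[q' [dq qE qv qe]].
  have [P [P' [dP PE Pv Pe]]] := div_surjective nz (@grid_opposite _ _ _ _ hT) (ltn0Sn n1) n12 n2m dq qv qe.
  have [u uE] := piecewise_exists hT P; have [w wE] := piecewise_exists hT P'.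
  have pu : is_pieces T n1.+1 n2.+1 m.+1 u P.
    split=> // [i|i j a b ab|i j a b ab x xa]; first by case: (dP i).
      by case: (Pv _ _ _ _ ab).
    by case: (Pe _ _ _ _ ab x xa).
  have pw : is_pieces T n1.+1 n2.+1 m.+1 w P'.
    split=> // [i|i j a b ab|i j a b ab x xa]; first by case: (dP i).
      by case: (Pv _ _ _ _ ab).
    by case: (Pe _ _ _ _ ab x xa).
  exists (fun x => (u x, w x)); first exact: W_in pu pw.
  apply: (ae_eq_interior hT) => i x _ ix.
  have := @div_interior _ _ _ m.+1 n1.+1 n2.+1 (fun y => (u y, w y)) P P' pu pw i x ix.
  by move=> ->; rewrite PE; exact: qE.
Qed.
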